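(* Let $A$ be a representation-finite artin algebra and $B$ the Auslander algebra of $A$. Then the following conditions are equivalent. (i) $B$ is strongly quasi-hereditary. (ii) $\mathrm{proj}\, B$ has a rejective chain. (iii) $A$ is a Nakayama algebra.
   Context: $A$ is representation-finite if it has only finitely many isomorphism classes of indecomposable finitely generated right modules; its Auslander algebra is $\mathrm{End}_A(M)$, where $M$ is the direct sum of one representative of each such class. $A$ is a Nakayama algebra if and only if every indecomposable finitely generated $A$-module is uniserial. $\mathrm{proj}\,B$ is the category of finitely generated projective right $B$-modules. For an artin algebra $B$ with Jacobson radical $J(B)$: a two-sided ideal $H$ is heredity if $H^2=H$, $H$ is projective as a right $B$-module, and $HJ(B)H=0$. A chain of idempotent ideals $B=H_0>H_1>\cdots>H_n=0$ is a heredity chain if $H_i/H_{i+1}$ is a heredity ideal of $B/H_{i+1}$ for $0\le i\le n-1$. It is a right-strongly (resp. left-strongly) heredity chain if for every $0\le i\le n-1$: (a) $H_i$ is projective as a right (resp. left) $B$-module; (b) $(H_i/H_{i+1})\,J(B/H_{i+1})\,(H_i/H_{i+1})=0$. $B$ is strongly quasi-hereditary if it has a heredity chain which is both a right-strongly and a left-strongly heredity chain. All subcategories are assumed full and closed under isomorphisms, direct sums and direct summands. A subcategory $\mathcal C'$ of an additive category $\mathcal C$ is right (resp. left) rejective if the inclusion functor $\mathcal C'\hookrightarrow\mathcal C$ has a right (resp. left) adjoint whose counit $\varepsilon^-_X$ is a monomorphism in $\mathcal C$ (resp. whose unit $\varepsilon^+_X$ is an epimorphism in $\mathcal C$) for every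 $X\in\mathcal C$; it is rejective if it is both right and left rejective. Let $[\mathcal C']$ be the ideal of $\mathcal C$ of morphisms factoring through an object of $\mathcal C'$; for $\mathcal C$ Krull–Schmidt, $\mathcal C'$ is cosemisimple in $\mathcal C$ if the Jacobson radical of the factor category $\mathcal C/[\mathcal C']$ is zero. A chain of subcategories $\mathcal C=\mathcal C_0\supset\mathcal C_1\supset\cdots\supset\mathcal C_n=0$ is a rejective chain of $\mathcal C$ if $\mathcal C_i$ is a cosemisimple rejective subcategory of $\mathcal C_{i-1}$ for $1\le i\le n$. *)

(* Defs.v *)
From HB Require Import structures.
From mathcomp Require Import all_boot all_algebra.
From mathcomp Require Import boolp classical_sets.

Set Implicit Arguments.
Unset Strict Implicit.
Unset Printing Implicit Defensive.

Import GRing.Theory.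
Local Open Scope classical_set_scope.
Local Open Scope ring_scope.
Local Open Scope quotient_scope.
Local Obligation Tactic := idtac.

(* Left modules over S are the library's [lmodType S]; right modules over S
   are left modules over the converse ring S^c.  The rings are [pzRingType]s,
   so the zero ring (as algebra or as quotient) is allowed. *)

Notation rmodType S := (lmodType S^c).

Section LinearMaps.
Variables (S : pzRingType).
Implicit Types M N P : lmodType S.

Definition Hom M N := {linear M -> N}.

Lemma Hom_ext M N (f g : Hom M N) : (forall x, f x = g x) -> f = g.
Proof.
case: f g => [f [[f1] [f2]]] [g [[g1] [g2]]] /= /funext efg.
subst g; do 3 f_equal; exact: Prop_irrelevance.
Qed.

HB.instance Definition _ M N := gen_eqMixin (Hom M N).
HB.instance Definition _ M N := gen_choiceMixin (Hom M N).

Definition Hom0 M N : Hom M N := \0.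
Definition HomN M N (f : Hom M N) : Hom M N := \- (f : {linear M -> N}).
Definition HomD M N (f g : Hom M N) : Hom M N :=
  (f : {linear M -> N}) \+ (g : {linear M -> N}).

Fact HomDA M N : associative (@HomD M N).
Proof. by move=> f g h; apply: Hom_ext => x /=; rewrite addrA. Qed.
Fact HomDC M N : commutative (@HomD M N).
Proof. by move=> f g; apply: Hom_ext => x /=; rewrite addrC. Qed.
Fact Hom0D M N : left_id (Hom0 M N) (@HomD M N).
Proof. by move=> f; apply: Hom_ext => x /=; rewrite add0r. Qed.
Fact HomND M N : left_inverse (Hom0 M N) (@HomN M N) (@HomD M N).
Proof. by move=> f; apply: Hom_ext => x /=; rewrite addNr. Qed.

HB.instance Definition _ M N :=
  GRing.isZmodule.Build (Hom M N) (@HomDA M N) (@HomDC M N) (@Hom0D M N)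
    (@HomND M N).

Definition Hom_id M : Hom M M := idfun.
Definition Hom_comp M N P (f : Hom N P) (g : Hom M N) : Hom M P :=
  (f : {linear N -> P}) \o (g : {linear M -> N}).

(* End_S(M), with the product f * g = f \o g *)
Definition Endo M := Hom M M.
HB.instance Definition _ M := GRing.Zmodule.on (Endo M).

Fact EndoA M : associative (@Hom_comp M M M : Endo M -> Endo M -> Endo M).
Proof. by move=> f g h; apply: Hom_ext. Qed.
Fact Endo1 M : left_id (Hom_id M : Endo M) (@Hom_comp M M M).
Proof. by move=> f; apply: Hom_ext. Qed.
Fact EndoV M : right_id (Hom_id M : Endo M) (@Hom_comp M M M).
Proof. by move=> f; apply: Hom_ext. Qed.
Fact EndoDl M :
  left_distributive (@Hom_comp M M M : Endo M -> Endo M -> Endo M) +%R.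
Proof. by move=> f g h; apply: Hom_ext. Qed.
Fact EndoDr M :
  right_distributive (@Hom_comp M M M : Endo M -> Endo M -> Endo M) +%R.
Proof. by move=> f g h; apply: Hom_ext => x /=; exact: raddfD. Qed.

HB.instance Definition _ M :=
  GRing.Zmodule_isPzRing.Build (Endo M) (@EndoA M) (@Endo1 M) (@EndoV M)
    (@EndoDl M) (@EndoDr M).

End LinearMaps.

Section DirectSum.
Variables (S : pzRingType) (I : finType) (X : I -> lmodType S).

Definition dsum := forall i, X i.
HB.instance Definition _ := Choice.on dsum.

Definition dsum0 : dsum := fun=> 0.
Definition dsumN (x : dsum) : dsum := fun i => - x i.
Definition dsumD (x y : dsum) : dsum := fun i => x i + y i.
Definition dsumZ (a : S) (x : dsum) : dsum := fun i => a *: x i.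

Fact dsumDA : associative dsumD.
Proof. by move=> x y z; apply: functional_extensionality_dep => i; apply: addrA. Qed.
Fact dsumDC : commutative dsumD.
Proof. by move=> x y; apply: functional_extensionality_dep => i; apply: addrC. Qed.
Fact dsum0D : left_id dsum0 dsumD.
Proof. by move=> x; apply: functional_extensionality_dep => i; apply: add0r. Qed.
Fact dsumND : left_inverse dsum0 dsumN dsumD.
Proof. by move=> x; apply: functional_extensionality_dep => i; apply: addNr. Qed.

HB.instance Definition _ :=
  GRing.isZmodule.Build dsum dsumDA dsumDC dsum0D dsumND.

Fact dsumZA a b x : dsumZ a (dsumZ b x) = dsumZ (a * b) x.
Proof. by apply: functional_extensionality_dep => i; apply: scalerA. Qed.
Fact dsum1Z : left_id 1 dsumZ.
Proof. by move=> x; apply: functional_extensionality_dep => i; apply: scale1r. Qed.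
Fact dsumZDr : right_distributive dsumZ +%R.
Proof. by move=> a x y; apply: functional_extensionality_dep => i; apply: scalerDr. Qed.
Fact dsumZDl x : {morph dsumZ^~ x : a b / a + b}.
Proof. by move=> a b; apply: functional_extensionality_dep => i; apply: scalerDl. Qed.

HB.instance Definition _ :=
  GRing.Zmodule_isLmodule.Build S dsum dsumZA dsum1Z dsumZDr dsumZDl.

End DirectSum.

Section ModuleNotions.
Variables (S : pzRingType).
Implicit Types M N P : lmodType S.

Definition zero_module M : Prop := forall x : M, x = 0.

Definition isomorphic M N : Prop := exists f : {linear M -> N}, bijective f.

Definition finitely_generated M : Prop :=
  exists (n : nat) (g : 'I_n -> M),
    forall x, exists c : 'I_n -> S, x = \sum_i c i *: g i.

Definition projective P : Prop :=
  forall M N (g : {linear M -> N}) (f : {linear P -> N}),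
    (forall y, exists x, g x = y) ->
    exists h : {linear P -> M}, forall x, g (h x) = f x.

Definition indecomposable M : Prop :=
  ~ zero_module M /\
  forall X Y : lmodType S,
    isomorphic M (X * Y)%type -> zero_module X \/ zero_module Y.

Record submod M := Submod {
  submod_set :> set M;
  submod0 : submod_set 0;
  submodL : forall (a : S) (x y : M),
    submod_set x -> submod_set y -> submod_set (a *: x + y) }.

Definition artinian M : Prop :=
  forall N : nat -> submod M, (forall n, N n.+1 `<=` N n) ->
    exists n, forall m, (n <= m)%N -> N m = N n :> set M.

Definition uniserial M : Prop :=
  forall N1 N2 : submod M, N1 `<=` N2 \/ N2 `<=` N1.

Definition maximal_submod M (N : submod M) : Prop :=
  (N : set M) <> setT /\
  forall N' : submod M, N `<=` N' -> N' = N :> set M \/ N' = setT :> set M.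

End ModuleNotions.

Section SubmoduleAsModule.
Variables (S : pzRingType) (M : lmodType S) (N : submod M).

Definition submod_pred : {pred M} := fun x => `[< submod_set N x >].

Fact submod_pred_closed : submod_closed submod_pred.
Proof.
split=> [|a x y /asboolP Nx /asboolP Ny]; apply/asboolP; first exact: submod0.
exact: submodL.
Qed.
HB.instance Definition _ :=
  GRing.isSubmodClosed.Build S M submod_pred submod_pred_closed.

Record submod_type := SubmodType {
  submod_val :> M; _ : submod_val \in submod_pred }.
HB.instance Definition _ := [isSub for submod_val].
HB.instance Definition _ := [Choice of submod_type by <:].
HB.instance Definition _ := [SubChoice_isSubLmodule of submod_type by <:].

End SubmoduleAsModule.

(* The R-algebra structure is a ring morphism from R to the centre of A
   ([algType] would exclude A = 0). *)
Definition artin_algebra (A : pzRingType) : Prop :=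
  exists (R : comPzRingType) (phi : {rmorphism R -> A}),
    [/\ artinian (R^o : lmodType R),
        forall r a, phi r * a = a * phi r &
        exists (n : nat) (g : 'I_n -> A),
          forall a, exists c : 'I_n -> R, a = \sum_i phi (c i) * g i].

Definition indec_fg (A : pzRingType) (M : rmodType A) : Prop :=
  finitely_generated M /\ indecomposable M.

Definition indec_representatives (A : pzRingType) (I : finType)
    (X : I -> rmodType A) : Prop :=
  [/\ forall i, indec_fg (X i),
      forall i j, isomorphic (X i) (X j) -> i = j &
      forall M : rmodType A, indec_fg M -> exists i, isomorphic M (X i)].

Definition representation_finite (A : pzRingType) : Prop :=
  exists (n : nat) (X : 'I_n -> rmodType A),
    forall M : rmodType A, indec_fg M -> exists i, isomorphic M (X i).

Definition auslander_algebra (A : pzRingType) (I : finType)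
    (X : I -> rmodType A) : pzRingType := Endo (dsum X).

Definition nakayama (A : pzRingType) : Prop :=
  forall M : rmodType A, indec_fg M -> uniserial M.

Record subgroup (V : zmodType) := Subgroup {
  subgroup_set :> set V;
  subgroup0 : subgroup_set 0;
  subgroupB : forall x y,
    subgroup_set x -> subgroup_set y -> subgroup_set (x - y) }.

Section GroupQuotient.
Variables (V : zmodType) (N : subgroup V).

Definition subgroup_pred : {pred V} := fun x => `[< subgroup_set N x >].

Fact subgroup_pred_closed : zmod_closed subgroup_pred.
Proof.
split=> [|x y /asboolP Nx /asboolP Ny]; apply/asboolP; first exact: subgroup0.
exact: subgroupB.
Qed.
HB.instance Definition _ :=
  GRing.isZmodClosed.Build V subgroup_pred subgroup_pred_closed.

Definition zquot := Quotient.quot subgroup_pred.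
HB.instance Definition _ := GRing.Zmodule.on zquot.

Definition zproj (x : V) : zquot := \pi_(Quotient.quot subgroup_pred) x.
Definition zrepr (u : zquot) : V := repr (u : Quotient.quot subgroup_pred).

Lemma zreprK u : zproj (zrepr u) = u. Proof. exact: reprK. Qed.
Lemma zprojP x y : zproj x = zproj y <-> subgroup_set N (x - y).
Proof.
split=> [/eqP|Nxy]; last apply/eqP.
  by rewrite -Quotient.idealrBE => /asboolP.
by rewrite -Quotient.idealrBE; apply/asboolP.
Qed.
Lemma zprojD x y : zproj (x + y) = zproj x + zproj y.
Proof. exact: (raddfD \pi_(Quotient.quot subgroup_pred)). Qed.
Lemma zprojN x : zproj (- x) = - zproj x.
Proof. exact: (raddfN \pi_(Quotient.quot subgroup_pred)). Qed.
Lemma zproj0 : zproj 0 = 0.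
Proof. exact: (raddf0 \pi_(Quotient.quot subgroup_pred)). Qed.

End GroupQuotient.
Arguments zrepr {V N} u.

Record ideal (B : pzRingType) := Ideal {
  ideal_group :> subgroup B;
  idealMl : forall b x, subgroup_set ideal_group x -> subgroup_set ideal_group (b * x);
  idealMr : forall b x, subgroup_set ideal_group x -> subgroup_set ideal_group (x * b) }.

Section RingQuotient.
Variables (B : pzRingType) (I : ideal B).

Definition rquot := zquot I.
HB.instance Definition _ := GRing.Zmodule.on rquot.

Definition rproj (x : B) : rquot := zproj I x.
Definition rmul (u v : rquot) : rquot := rproj (zrepr u * zrepr v).

Lemma subgroupD (V : zmodType) (N : subgroup V) x y : 
  subgroup_set N x -> subgroup_set N y -> subgroup_set N (x + y).
Proof.
move=> Nx Ny; rewrite -[y]opprK; apply: subgroupB => //.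
by rewrite -sub0r; apply: subgroupB => //; apply: subgroup0.
Qed.

Lemma rprojM x y : rproj (x * y) = rmul (rproj x) (rproj y).
Proof.
apply/zprojP; set x' := zrepr _; set y' := zrepr _.
have Nx : subgroup_set I (x - x') by apply/zprojP; rewrite zreprK.
have Ny : subgroup_set I (y - y') by apply/zprojP; rewrite zreprK.
have -> : x * y - x' * y' = (x - x') * y + x' * (y - y').
  by rewrite mulrBl mulrBr addrA subrK.
by apply: subgroupD; [apply: idealMr|apply: idealMl].
Qed.

Let rprojK (u : rquot) : rproj (zrepr u) = u. Proof. exact: zreprK. Qed.
Let rprojD x y : rproj (x + y) = rproj x + rproj y. Proof. exact: zprojD. Qed.

Fact rmulA : associative rmul.
Proof.
by move=> u v w; rewrite -[u]rprojK -[v]rprojK -[w]rprojK -!rprojM mulrA.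
Qed.
Fact rmul1 : left_id (rproj 1) rmul.
Proof. by move=> u; rewrite -[u]rprojK -!rprojM mul1r. Qed.
Fact rmulV : right_id (rproj 1) rmul.
Proof. by move=> u; rewrite -[u]rprojK -!rprojM mulr1. Qed.
Fact rmulDl : left_distributive rmul +%R.
Proof.
move=> u v w; rewrite -[u]rprojK -[v]rprojK -[w]rprojK.
by rewrite -rprojD -!rprojM mulrDl rprojD.
Qed.
Fact rmulDr : right_distributive rmul +%R.
Proof.
move=> u v w; rewrite -[u]rprojK -[v]rprojK -[w]rprojK.
by rewrite -rprojD -!rprojM mulrDr rprojD.
Qed.

HB.instance Definition _ :=
  GRing.Zmodule_isPzRing.Build rquot rmulA rmul1 rmulV rmulDl rmulDr.

End RingQuotient.

Section IdealConstructions.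
Variable B : pzRingType.

Program Definition left_submod (I : ideal B) : submod (B^o : lmodType B) :=
  @Submod _ (B^o : lmodType B) (I : set B) _ _.
Next Obligation. by move=> I; apply: subgroup0. Qed.
Next Obligation.
by move=> I a x y Ix Iy; apply: subgroupD => //; apply: idealMl.
Qed.

Program Definition right_submod (I : ideal B) : submod (B^c^o : rmodType B) :=
  @Submod _ (B^c^o : rmodType B) (I : set B) _ _.
Next Obligation. by move=> I; apply: subgroup0. Qed.
Next Obligation.
by move=> I a x y Ix Iy; apply: subgroupD => //; apply: idealMr.
Qed.

(* (I + J)/J, which is I/J when J is contained in I *)
Program Definition ideal_quot (I J : ideal B) : ideal (rquot J) :=
  @Ideal _ (@Subgroup _ (rproj J @` I) _ _) _ _.
Next Obligation.
by move=> I J; exists 0; [apply: subgroup0|apply: zproj0].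
Qed.
Next Obligation.
move=> I J _ _ [x Ix <-] [y Iy <-]; exists (x - y); first exact: subgroupB.
by rewrite /rproj zprojD zprojN.
Qed.
Next Obligation.
move=> I J b _ [x Ix <-]; exists (zrepr b * x); first exact: idealMl.
by rewrite rprojM; congr (rmul _ _); apply: zreprK.
Qed.
Next Obligation.
move=> I J b _ [x Ix <-]; exists (x * zrepr b); first exact: idealMr.
by rewrite rprojM; congr (rmul _ _); apply: zreprK.
Qed.

Definition set_mul (I J : set B) : set B :=
  [set z | exists (n : nat) (x y : 'I_n -> B),
     [/\ forall i, I (x i), forall i, J (y i) & z = \sum_i x i * y i]].

Definition jacobson : set B :=
  [set x | forall m : submod (B^c^o : rmodType B), maximal_submod m -> submod_set m x].

End IdealConstructions.
Arguments jacobson B : clear implicits.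

Definition right_projective (B : pzRingType) (I : ideal B) : Prop :=
  projective (submod_type (right_submod I)).

Definition left_projective (B : pzRingType) (I : ideal B) : Prop :=
  projective (submod_type (left_submod I)).

Definition idempotent_ideal (B : pzRingType) (I : ideal B) : Prop :=
  set_mul I I = I.

Definition heredity_ideal (B : pzRingType) (H : ideal B) : Prop :=
  [/\ idempotent_ideal H, right_projective H &
      set_mul (set_mul H (jacobson B)) H = [set 0]].

Section HeredityChains.
Variables (B : pzRingType) (n : nat) (H : nat -> ideal B).

Definition idempotent_chain : Prop :=
  [/\ H 0%N = setT :> set B, H n = [set 0] :> set B,
      forall i, (i < n)%N -> H i.+1 `<` H i &
      forall i, (i <= n)%N -> idempotent_ideal (H i)].

Definition heredity_chain : Prop :=
  idempotent_chain /\
  forall i, (i < n)%N -> heredity_ideal (ideal_quot (H i) (H i.+1)).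

Definition semisimple_layer (i : nat) : Prop :=
  let L := ideal_quot (H i) (H i.+1) in
  set_mul (set_mul L (jacobson (rquot (H i.+1)))) L = [set 0].

Definition right_strongly_heredity_chain : Prop :=
  idempotent_chain /\
  forall i, (i < n)%N -> right_projective (H i) /\ semisimple_layer i.

Definition left_strongly_heredity_chain : Prop :=
  idempotent_chain /\
  forall i, (i < n)%N -> left_projective (H i) /\ semisimple_layer i.

End HeredityChains.

Definition strongly_quasi_hereditary (B : pzRingType) : Prop :=
  exists (n : nat) (H : nat -> ideal B),
    [/\ heredity_chain n H, right_strongly_heredity_chain n H &
        left_strongly_heredity_chain n H].

Record preadd_category := PreaddCategory {
  obj :> Type;
  hom : obj -> obj -> zmodType;
  idm : forall X, hom X X;
  comp : forall X Y Z, hom Y Z -> hom X Y -> hom X Z;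
  compA : forall X Y Z T (h : hom Z T) (g : hom Y Z) (f : hom X Y),
    comp h (comp g f) = comp (comp h g) f;
  comp1m : forall X Y (f : hom X Y), comp (idm Y) f = f;
  compm1 : forall X Y (f : hom X Y), comp f (idm X) = f;
  compDl : forall X Y Z (g g' : hom Y Z) (f : hom X Y),
    comp (g + g') f = comp g f + comp g' f;
  compDr : forall X Y Z (g : hom Y Z) (f f' : hom X Y),
    comp g (f + f') = comp g f + comp g f' }.

Arguments hom {p} _ _.
Arguments idm {p} X.
Arguments comp {p X Y Z} _ _.

Local Notation "g ∘ f" := (comp g f) (at level 40, left associativity).

Section PreaddNotions.
Variable C : preadd_category.
Implicit Types X Y Z : C.

Definition zero_object Z : Prop := idm Z = 0.

Definition invertible X Y (f : hom X Y) : Prop :=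
  exists g : hom Y X, g ∘ f = idm X /\ f ∘ g = idm Y.

Definition mono X Y (f : hom X Y) : Prop :=
  forall Z (g h : hom Z X), f ∘ g = f ∘ h -> g = h.

Definition epi X Y (f : hom X Y) : Prop :=
  forall Z (g h : hom Y Z), g ∘ f = h ∘ f -> g = h.

Definition biproduct X Y Z : Prop :=
  exists (i1 : hom X Z) (i2 : hom Y Z) (p1 : hom Z X) (p2 : hom Z Y),
    [/\ p1 ∘ i1 = idm X, p2 ∘ i2 = idm Y, p1 ∘ i2 = 0, p2 ∘ i1 = 0 &
        i1 ∘ p1 + i2 ∘ p2 = idm Z].

Definition radical X Y : set (hom X Y) :=
  [set f | forall g : hom Y X, invertible (idm X - g ∘ f)].

End PreaddNotions.
Arguments radical {C} X Y.

Record additive_category := AdditiveCategory {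
  add_preadd :> preadd_category;
  has_zero : exists Z : add_preadd, zero_object Z;
  has_biproduct : forall X Y : add_preadd, exists Z, biproduct X Y Z }.

Record functor (C D : preadd_category) := Functor {
  fobj :> C -> D;
  fmap : forall X Y : C, hom X Y -> hom (fobj X) (fobj Y);
  fmap1 : forall X : C, fmap (idm X) = idm (fobj X);
  fmap_comp : forall (X Y Z : C) (g : hom Y Z) (f : hom X Y),
    fmap (g ∘ f) = fmap g ∘ fmap f }.

Record adjunction (C D : preadd_category) (F : functor C D) (G : functor D C) :=
  Adjunction {
    adj_unit : forall X : C, hom X (G (F X));
    adj_counit : forall Y : D, hom (F (G Y)) Y;
    adj_unit_nat : forall (X X' : C) (f : hom X X'),
      adj_unit X' ∘ f = fmap G (fmap F f) ∘ adj_unit X;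
    adj_counit_nat : forall (Y Y' : D) (g : hom Y Y'),
      adj_counit Y' ∘ fmap F (fmap G g) = g ∘ adj_counit Y;
    adj_triangle_l : forall X : C,
      adj_counit (F X) ∘ fmap F (adj_unit X) = idm (F X);
    adj_triangle_r : forall Y : D,
      fmap G (adj_counit Y) ∘ adj_unit (G Y) = idm (G Y) }.

(* Full subcategories closed under isomorphisms, (possibly empty) finite direct
   sums and direct summands. *)
Record subcategory (C : additive_category) := Subcategory {
  sub_mem :> C -> Prop;
  sub_iso : forall (X Y : C) (f : hom X Y),
    invertible f -> sub_mem X -> sub_mem Y;
  sub_zero : forall Z : C, zero_object Z -> sub_mem Z;
  sub_sum : forall X Y Z : C,
    biproduct X Y Z -> sub_mem X -> sub_mem Y -> sub_mem Z;
  sub_summand : forall X Y Z : C, biproduct X Y Z -> sub_mem Z -> sub_mem X }.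

Section FullSubcategory.
Variables (C : additive_category) (D : subcategory C).

Definition full_preadd : preadd_category :=
  @PreaddCategory {X : C | D X}
    (fun X Y => hom (sval X) (sval Y))
    (fun X => idm (sval X))
    (fun X Y Z g f => g ∘ f)
    (fun X Y Z T h g f => compA h g f)
    (fun X Y f => comp1m f)
    (fun X Y f => compm1 f)
    (fun X Y Z g g' f => compDl g g' f)
    (fun X Y Z g f f' => compDr g f f').

Fact full_has_zero : exists Z : full_preadd, zero_object Z.
Proof. by have [Z Z0] := has_zero C; exists (exist _ Z (sub_zero D Z0)). Qed.

Fact full_has_biproduct (X Y : full_preadd) : exists Z, biproduct X Y Z.
Proof.
case: X Y => [X DX] [Y DY]; have [Z XYZ] := has_biproduct X Y.
by exists (exist _ Z (sub_sum XYZ DX DY)).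
Qed.

Definition full : additive_category :=
  AdditiveCategory full_has_zero full_has_biproduct.

Definition inclusion : functor full C :=
  @Functor full C sval (fun X Y f => f) (fun X => erefl) (fun X Y Z g f => erefl).

(* The part of D' lying in D, as a subcategory of D. *)
Program Definition sub_in (D' : subcategory C) : subcategory full :=
  @Subcategory full (fun X => D' (sval X)) _ _ _ _.
Next Obligation. by move=> D' X Y f; exact: (@sub_iso _ D' (sval X) (sval Y) f). Qed.
Next Obligation. by move=> D' Z; apply: (sub_zero D'). Qed.
Next Obligation. by move=> D' X Y Z; exact: (@sub_sum _ D' (sval X) (sval Y) (sval Z)). Qed.
Next Obligation. by move=> D' X Y Z; exact: (@sub_summand _ D' (sval X) (sval Y) (sval Z)). Qed.

End FullSubcategory.

Section FactorCategory.
Variables (C : additive_category) (D : subcategory C).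

Lemma comp0l (X Y Z : C) (f : hom X Y) : (0 : hom Y Z) ∘ f = 0.
Proof. by apply: (addrI (0 ∘ f)); rewrite -compDl !addr0. Qed.

Lemma comp0r (X Y Z : C) (g : hom Y Z) : g ∘ (0 : hom X Y) = 0.
Proof. by apply: (addrI (g ∘ 0)); rewrite -compDr !addr0. Qed.

Lemma compNl (X Y Z : C) (g : hom Y Z) (f : hom X Y) : (- g) ∘ f = - (g ∘ f).
Proof. by apply: (addrI (g ∘ f)); rewrite -compDl !subrr comp0l. Qed.

Lemma compNr (X Y Z : C) (g : hom Y Z) (f : hom X Y) : g ∘ (- f) = - (g ∘ f).
Proof. by apply: (addrI (g ∘ f)); rewrite -compDr !subrr comp0r. Qed.

Definition factors (X Y : C) : set (hom X Y) :=
  [set f | exists (Z : C) (g : hom X Z) (h : hom Z Y), D Z /\ f = h ∘ g].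

Fact factors0 (X Y : C) : @factors X Y 0.
Proof.
have [Z Z0] := has_zero C; exists Z, 0, 0; split; first exact: (sub_zero D Z0).
by rewrite comp0l.
Qed.

Fact factorsB (X Y : C) (f f' : hom X Y) :
  factors f -> factors f' -> factors (f - f').
Proof.
move=> [Z [g [h [DZ ->]]]] [Z' [g' [h' [DZ' ->]]]].
have [T ZZ'T] := has_biproduct Z Z'; exists T; have DT := sub_sum ZZ'T DZ DZ'.
have [i1 [i2 [p1 [p2 [p1i1 p2i2 p1i2 p2i1 _]]]]] := ZZ'T.
exists (i1 ∘ g + i2 ∘ g'), (h ∘ p1 - h' ∘ p2); split=> //.
rewrite compDl !compDr !compNl.
rewrite -!compA !(compA p1) !(compA p2) p1i1 p2i2 p1i2 p2i1 !comp1m.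
by rewrite !comp0l !comp0r addr0 oppr0 add0r.
Qed.

Definition factor_ideal (X Y : C) : subgroup (hom X Y) :=
  Subgroup (@factors0 X Y) (@factorsB X Y).

Definition fhom (X Y : C) : zmodType := zquot (factor_ideal X Y).
Definition fproj (X Y : C) (f : hom X Y) : fhom X Y := zproj _ f.
Definition fcomp (X Y Z : C) (g : fhom Y Z) (f : fhom X Y) : fhom X Z :=
  fproj (zrepr g ∘ zrepr f).

Lemma fproj_comp (X Y Z : C) (g : hom Y Z) (f : hom X Y) :
  fcomp (fproj g) (fproj f) = fproj (g ∘ f).
Proof.
apply/esym/zprojP; set g' := zrepr _; set f' := zrepr _.
have Nf : subgroup_set (factor_ideal _ _) (f - f') by apply/zprojP; rewrite zreprK.
have Ng : subgroup_set (factor_ideal _ _) (g - g') by apply/zprojP; rewrite zreprK.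
have -> : g ∘ f - g' ∘ f' = (g - g') ∘ f + g' ∘ (f - f').
  by rewrite compDl compDr compNl compNr addrA subrK.
case: Nf Ng => [T [a [b [DT ->]]]] [T' [a' [b' [DT' ->]]]].
apply: subgroupD.
  by exists T', (a' ∘ f), b'; rewrite compA.
by exists T, a, (g' ∘ b); rewrite compA.
Qed.

Let fprojK (X Y : C) (f : fhom X Y) : fproj (zrepr f) = f.
Proof. exact: zreprK. Qed.
Let fprojD (X Y : C) (f g : hom X Y) : fproj (f + g) = fproj f + fproj g.
Proof. exact: zprojD. Qed.

Fact fcompA (X Y Z T : C) (h : fhom Z T) (g : fhom Y Z) (f : fhom X Y) :
  fcomp h (fcomp g f) = fcomp (fcomp h g) f.
Proof. by rewrite -[h]fprojK -[g]fprojK -[f]fprojK !fproj_comp compA. Qed.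
Fact fcomp1m (X Y : C) (f : fhom X Y) : fcomp (fproj (idm Y)) f = f.
Proof. by rewrite -[f]fprojK fproj_comp comp1m. Qed.
Fact fcompm1 (X Y : C) (f : fhom X Y) : fcomp f (fproj (idm X)) = f.
Proof. by rewrite -[f]fprojK fproj_comp compm1. Qed.
Fact fcompDl (X Y Z : C) (g g' : fhom Y Z) (f : fhom X Y) :
  fcomp (g + g') f = fcomp g f + fcomp g' f.
Proof.
by rewrite -[g]fprojK -[g']fprojK -[f]fprojK -fprojD !fproj_comp compDl fprojD.
Qed.
Fact fcompDr (X Y Z : C) (g : fhom Y Z) (f f' : fhom X Y) :
  fcomp g (f + f') = fcomp g f + fcomp g f'.
Proof.
by rewrite -[g]fprojK -[f]fprojK -[f']fprojK -fprojD !fproj_comp compDr fprojD.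
Qed.

Definition factor_category : preadd_category :=
  @PreaddCategory C fhom (fun X => fproj (idm X)) fcomp
    fcompA fcomp1m fcompm1 fcompDl fcompDr.

End FactorCategory.

Section Rejective.
Variables (C : additive_category) (D : subcategory C).

Definition right_rejective : Prop :=
  exists (G : functor C (full D)) (adj : adjunction (inclusion D) G),
    forall X : C, mono (adj_counit adj X).

Definition left_rejective : Prop :=
  exists (F : functor C (full D)) (adj : adjunction F (inclusion D)),
    forall X : C, epi (adj_unit adj X).

Definition rejective : Prop := right_rejective /\ left_rejective.

Definition cosemisimple : Prop :=
  forall X Y : factor_category D, radical X Y = [set 0].

End Rejective.

Definition rejective_chain (C : additive_category) (n : nat)
    (D : nat -> subcategory C) : Prop :=
  [/\ forall X : C, D 0%N X,
      forall X : C, D n X <-> zero_object X &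
      forall i, (i < n)%N ->
        [/\ forall X : C, D i.+1 X -> D i X,
            cosemisimple (sub_in (D i) (D i.+1)) &
            rejective (sub_in (D i) (D i.+1))]].

Definition has_rejective_chain (C : additive_category) : Prop :=
  exists (n : nat) (D : nat -> subcategory C), rejective_chain n D.

Section ModuleCategory.
Variable S : pzRingType.

Definition Mod_preadd : preadd_category.
refine (@PreaddCategory (lmodType S) (fun M N => Hom M N)
  (fun M => Hom_id M) (fun M N P g f => Hom_comp g f) _ _ _ _ _).
- by move=> *; apply: Hom_ext.
- by move=> *; apply: Hom_ext.
- by move=> *; apply: Hom_ext.
- by move=> *; apply: Hom_ext.
- by move=> *; apply: Hom_ext => x /=; apply: raddfD.
Defined.

Fact Mod_has_zero : exists Z : Mod_preadd, zero_object Z.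
Proof.
exists (@dsum S void (fun _ => S^o) : lmodType S); apply: Hom_ext => x.
by apply: functional_extensionality_dep; case.
Qed.

Section Pairing.
Variables X Y : lmodType S.

Definition pair_i1 (x : X) : (X * Y)%type := (x, 0).
Definition pair_i2 (y : Y) : (X * Y)%type := (0, y).

Fact pair_i1_linear : linear pair_i1.
Proof. by move=> a x y; congr pair; rewrite /= scaler0 addr0. Qed.
Fact pair_i2_linear : linear pair_i2.
Proof. by move=> a x y; congr pair; rewrite /= scaler0 addr0. Qed.
HB.instance Definition _ := GRing.isLinear.Build S X _ _ pair_i1 pair_i1_linear.
HB.instance Definition _ := GRing.isLinear.Build S Y _ _ pair_i2 pair_i2_linear.

Fact fst_linear : linear (@fst X Y). Proof. by []. Qed.
Fact snd_linear : linear (@snd X Y). Proof. by []. Qed.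
HB.instance Definition _ :=
  GRing.isLinear.Build S (X * Y)%type X _ (@fst X Y) fst_linear.
HB.instance Definition _ :=
  GRing.isLinear.Build S (X * Y)%type Y _ (@snd X Y) snd_linear.

Fact pair_biproduct : @biproduct Mod_preadd X Y (X * Y)%type.
Proof.
exists (pair_i1 : {linear _ -> _}), (pair_i2 : {linear _ -> _}).
exists (@fst X Y : {linear _ -> _}), (@snd X Y : {linear _ -> _}).
split; apply: Hom_ext => //.
by case=> x y; congr pair; rewrite /= ?addr0 ?add0r.
Qed.

End Pairing.

Fact Mod_has_biproduct (X Y : Mod_preadd) : exists Z, biproduct X Y Z.
Proof. by eexists; apply: pair_biproduct. Qed.

Definition Mod : additive_category :=
  AdditiveCategory Mod_has_zero Mod_has_biproduct.

Definition fg_projective (P : Mod) : Prop :=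
  finitely_generated (P : lmodType S) /\ projective (P : lmodType S).

Lemma HomE (X Y : Mod) (f g : hom X Y) (x : (X : lmodType S)) :
  f = g -> (f : Hom X Y) x = (g : Hom X Y) x.
Proof. by move=> ->. Qed.

Lemma fg_projective_retract (P Q : Mod) (i : hom P Q) (p : hom Q P) :
  p ∘ i = idm P -> fg_projective Q -> fg_projective P.
Proof.
move=> pi1 [[n [g gen]] lift]; split.
  exists n, (fun k => (p : Hom Q P) (g k)) => x.
  have [c e] := gen ((i : Hom P Q) x); exists c.
  rewrite -[LHS](HomE x pi1) /= e linear_sum.
  by apply: eq_bigr => k _; rewrite linearZ.
move=> M N g' f surj.
have [h hP] := lift M N g' (Hom_comp f p) surj.
exists (Hom_comp h i) => x /=; rewrite hP /=; congr (f _).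
exact: (HomE x pi1).
Qed.

Lemma fg_projective_sum (X Y Z : Mod) :
  biproduct X Y Z -> fg_projective X -> fg_projective Y -> fg_projective Z.
Proof.
move=> [i1 [i2 [p1 [p2 [_ _ _ _ e]]]]] [[n [g gen]] lift] [[n' [g' gen']] lift'].
have eZ z : z = (i1 : Hom X Z) ((p1 : Hom Z X) z)
              + (i2 : Hom Y Z) ((p2 : Hom Z Y) z) by rewrite -[LHS](HomE z e).
split.
  exists (n + n')%N, (fun k => match split k with
    | inl a => (i1 : Hom X Z) (g a) | inr b => (i2 : Hom Y Z) (g' b) end) => z.
  have [c ec] := gen ((p1 : Hom Z X) z); have [c' ec'] := gen' ((p2 : Hom Z Y) z).
  exists (fun k => match split k with inl a => c a | inr b => c' b end).
  rewrite [LHS]eZ ec ec' !linear_sum big_split_ord; congr (_ + _);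
    apply: eq_bigr => k _; rewrite linearZ.
    by rewrite (unsplitK (inl k)).
  by rewrite (unsplitK (inr k)).
move=> M N q f surj.
have [h hP] := lift M N q (Hom_comp f i1) surj.
have [h' hP'] := lift' M N q (Hom_comp f i2) surj.
exists (HomD (Hom_comp h p1) (Hom_comp h' p2)) => z.
by rewrite [in RHS](eZ z) [LHS]raddfD [RHS]raddfD; congr (_ + _);
  [apply: hP|apply: hP'].
Qed.

Lemma fg_projective_zero (Z : Mod) : zero_object Z -> fg_projective Z.
Proof.
move=> Z0; have zZ (z : (Z : lmodType S)) : z = 0 by exact: (HomE z Z0).
split.
  by exists 0%N, (fun=> 0) => z; exists (fun=> 0); rewrite big_ord0.
by move=> M N g f _; exists (Hom0 Z M) => z; rewrite (zZ z) !raddf0.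
Qed.

Program Definition proj_subcategory : subcategory Mod :=
  @Subcategory Mod fg_projective _ fg_projective_zero fg_projective_sum _.
Next Obligation.
by move=> X Y f [g [_ fg1]]; apply: (fg_projective_retract fg1).
Qed.
Next Obligation.
by move=> X Y Z [i1 [_ [p1 [_ [e _ _ _ _]]]]]; apply: (fg_projective_retract e).
Qed.

End ModuleCategory.

Definition proj (B : pzRingType) : additive_category :=
  full (proj_subcategory B^c).

(* Main.v *)
(**
 Write M for the sum of the X i, so B = End M and N |-> Hom (M, N) is an
 equivalence from finitely generated A-modules to proj B.  The implications are
 proved in the cycle (i) => (ii) => (iii) => (i).

 (i) => (ii).  For a heredity chain H i take the subcategories of those P with
 P H i = P.  The right approximation of P is P H, which is projective because H
 is right projective; the left approximation is the dual of H P^*, which is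
 projective because H is left projective.  The semisimple layers make the
 radical of the factor categories vanish.

 (ii) => (iii).  Transported to A-modules, the members C i of a rejective chain
 are closed under submodules and quotients, and an indecomposable N in C i
 outside C i.+1 has all its proper submodules and quotients in C i.+1.  Such an
 N is uniform and is not a sum of two proper submodules, so two proper
 submodules lie in an indecomposable proper submodule, which is uniserial by
 induction on the chain.

 (iii) => (i).  Remove the X k one by one, longest first.  As the X k are
 uniserial, the modules without a removed summand form a class C closed under
 submodules and quotients, and H = {f | im f in C}.  With M' the largest
 submodule of M in C and M'' the largest quotient of M in C, one has
 H = Hom (M, M') = Hom (M'', M), which is projective on both sides.
*)

From HB Require Import structures.
From mathcomp Require Import all_boot all_algebra.
From mathcomp Require Import boolp classical_sets.
Require Import Defs.

Set Implicit Arguments.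
Unset Strict Implicit.
Unset Printing Implicit Defensive.

Import GRing.Theory.
Local Open Scope classical_set_scope.
Local Open Scope ring_scope.
Local Obligation Tactic := idtac.

(** All finiteness comes from length. An artinian commutative ring [R] has finite length; hence so
    do an artin algebra over it, its finitely generated modules and, over [R], the ring [B]. So the
    ideals of [B] are finitely generated over [R], whose image in [B] is central. Projectivity can
    therefore be handled by finite dual bases, which make both approximations in (i) => (ii)
    explicit. The left one is only an epimorphism among projectives, so it is tested against
    functionals.

    In (ii) => (iii) closure goes by induction along the chain: an epimorphism of [C i] is known to
    be surjective once its cokernel lies in [C i], and dually for kernels. Proper submodules and
    quotients drop one level because a non-isomorphism between indecomposables is radical, so
    cosemisimplicity makes it factor through the next member.

    In (iii) => (i), removing longest modules first keeps all shorter ones in the class, so a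
    non-invertible endomorphism of the removed [X k] has its image in the smaller class. An
    invertible one passing through an element of the Jacobson radical would create a forbidden
    idempotent there. *)

Local Notation "g ∘ f" := (comp g f) (at level 40, left associativity).

(** * Submodules, quotients and length *)

Section LinearToolkit.
Variable S : pzRingType.
Implicit Types M N P Q : lmodType S.

Definition mkHom M N (f : M -> N) (lf : linear f) : Hom M N :=
  HB.pack f (GRing.isLinear.Build S M N _ f lf).

Lemma submodZ M (U : submod M) a x : submod_set U x -> submod_set U (a *: x).
Proof. by move=> Ux; rewrite -[_ *: _]addr0; apply: submodL => //; apply: submod0. Qed.

Lemma submodD M (U : submod M) x y :
  submod_set U x -> submod_set U y -> submod_set U (x + y).
Proof. by move=> Ux Uy; rewrite -[x]scale1r; apply: submodL. Qed.

Lemma submodN M (U : submod M) x : submod_set U x -> submod_set U (- x).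
Proof. by move=> Ux; rewrite -scaleN1r; apply: submodZ. Qed.

Lemma submodB M (U : submod M) x y :
  submod_set U x -> submod_set U y -> submod_set U (x - y).
Proof. by move=> Ux Uy; apply: submodD => //; apply: submodN. Qed.

Lemma submod_sum M (U : submod M) (J : finType) (F : J -> M) :
  (forall j, submod_set U (F j)) -> submod_set U (\sum_j F j).
Proof.
move=> UF; elim/big_ind: _ => //; [exact: submod0|exact: submodD].
Qed.

Definition submodT M : submod M :=
  @Submod S M setT I (fun _ _ _ _ _ => I).

Lemma zero_submod_linear M (a : S) (x y : M) :
  [set 0 : M] x -> [set 0 : M] y -> [set 0 : M] (a *: x + y).
Proof. by move=> /= -> ->; rewrite scaler0 addr0. Qed.

Definition submod0m M : submod M := Submod (erefl (0 : M)) (@zero_submod_linear M).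

Definition submodI M (U V : submod M) : submod M :=
  @Submod S M (U `&` V) (conj (submod0 U) (submod0 V))
    (fun a x y Hx Hy => conj (submodL a (proj1 Hx) (proj1 Hy))
                             (submodL a (proj2 Hx) (proj2 Hy))).

Program Definition submodA M (U V : submod M) : submod M :=
  @Submod S M [set x | exists u v, [/\ submod_set U u, submod_set V v & x = u + v]] _ _.
Next Obligation.
by move=> M U V; exists 0, 0; rewrite addr0; split=> //; apply: submod0.
Qed.
Next Obligation.
move=> M U V a _ _ [u [v [Uu Vv ->]]] [u' [v' [Uu' Vv' ->]]].
exists (a *: u + u'), (a *: v + v'); rewrite scalerDr addrACA.
by split=> //; apply: submodL.
Qed.

Program Definition submod_image M N (f : {linear M -> N}) (U : submod M) : submod N :=
  @Submod S N (f @` U) _ _.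
Next Obligation. by move=> M N f U; exists 0; [apply: submod0|apply: raddf0]. Qed.
Next Obligation.
move=> M N f U a _ _ [x Ux <-] [y Uy <-].
by exists (a *: x + y); [apply: submodL|rewrite linearP].
Qed.

Program Definition submod_preim M N (f : {linear M -> N}) (V : submod N) : submod M :=
  @Submod S M (f @^-1` V) _ _.
Next Obligation. by move=> M N f V; rewrite /preimage /= raddf0; apply: submod0. Qed.
Next Obligation.
by move=> M N f V a x y; rewrite /preimage /= linearP; apply: submodL.
Qed.

Definition submod_ker M N (f : {linear M -> N}) := submod_preim f (submod0m N).
Definition submod_range M N (f : {linear M -> N}) := submod_image f (submodT M).

Program Definition submod_span M (n : nat) (g : 'I_n -> M) : submod M :=
  @Submod S M [set x | exists c : 'I_n -> S, x = \sum_i c i *: g i] _ _.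
Next Obligation.
by move=> M n g; exists (fun=> 0); rewrite big1 // => i _; rewrite scale0r.
Qed.
Next Obligation.
move=> M n g a _ _ [c ->] [d ->]; exists (fun i => a * c i + d i); rewrite scaler_sumr -big_split /=.
by apply: eq_bigr => i _; rewrite scalerDl scalerA.
Qed.

Definition incl M (U : submod M) : Hom (submod_type U) M :=
  mkHom (fun a (x y : submod_type U) => erefl (\val (a *: x + y))).

Lemma inclP M (U : submod M) (x : submod_type U) : submod_set U (incl U x).
Proof. by case: x => x Ux; exact: (elimT (asboolP _) Ux). Qed.

Lemma incl_inj M (U : submod M) : injective (incl U).
Proof. by move=> x y; apply: val_inj. Qed.

Definition insubmod M (U : submod M) x (Ux : submod_set U x) : submod_type U :=
  SubmodType (introT (asboolP _) Ux : x \in submod_pred U).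

Definition corestr_fun M N (V : submod N) (f : {linear M -> N})
  (fV : forall x, submod_set V (f x)) (x : M) : submod_type V := insubmod (fV x).

Lemma corestr_linear M N (V : submod N) (f : {linear M -> N})
  (fV : forall x, submod_set V (f x)) : linear (corestr_fun fV).
Proof. by move=> a x y; apply: val_inj; rewrite /= linearP. Qed.

Definition corestr M N (V : submod N) (f : {linear M -> N})
  (fV : forall x, submod_set V (f x)) : Hom M (submod_type V) :=
  mkHom (corestr_linear fV).

Lemma corestrE M N (V : submod N) (f : {linear M -> N})
  (fV : forall x, submod_set V (f x)) x : incl V (corestr fV x) = f x.
Proof. by []. Qed.

End LinearToolkit.

Section QuotientModule.
Variables (S : pzRingType) (M : lmodType S) (U : submod M).

Definition submod_subgroup : subgroup M :=
  Subgroup (submod0 U) (@submodB S M U).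

Definition mquot := zquot submod_subgroup.
HB.instance Definition _ := GRing.Zmodule.on mquot.

Definition mquot_proj (x : M) : mquot := zproj submod_subgroup x.
Definition mquot_scale (a : S) (u : mquot) : mquot := mquot_proj (a *: zrepr u).

Lemma mquot_projK (u : mquot) : mquot_proj (zrepr u) = u.
Proof. exact: zreprK. Qed.

Lemma mquot_projE x y : mquot_proj x = mquot_proj y <-> submod_set U (x - y).
Proof. exact: zprojP. Qed.

Lemma mquot_projD x y : mquot_proj (x + y) = mquot_proj x + mquot_proj y.
Proof. exact: zprojD. Qed.

Lemma mquot_projZ a x : mquot_proj (a *: x) = mquot_scale a (mquot_proj x).
Proof.
apply/mquot_projE; rewrite -scalerBr; apply: submodZ.
by apply/mquot_projE; rewrite mquot_projK.
Qed.

Fact mquot_scaleA a b x : mquot_scale a (mquot_scale b x) = mquot_scale (a * b) x.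
Proof. by rewrite -[x]mquot_projK -!mquot_projZ scalerA. Qed.
Fact mquot_scale1 : left_id 1 mquot_scale.
Proof. by move=> x; rewrite -[x]mquot_projK -!mquot_projZ scale1r. Qed.
Fact mquot_scaleDr : right_distributive mquot_scale +%R.
Proof.
move=> a x y; rewrite -[x]mquot_projK -[y]mquot_projK -mquot_projD -!mquot_projZ.
by rewrite scalerDr mquot_projD.
Qed.
Fact mquot_scaleDl x : {morph mquot_scale^~ x : a b / a + b}.
Proof. by move=> a b; rewrite -[x]mquot_projK -!mquot_projZ scalerDl mquot_projD. Qed.

HB.instance Definition _ := GRing.Zmodule_isLmodule.Build S mquot
  mquot_scaleA mquot_scale1 mquot_scaleDr mquot_scaleDl.

Lemma mquot_proj_linear : linear mquot_proj.
Proof. by move=> a x y; rewrite mquot_projD mquot_projZ. Qed.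

Definition mproj : Hom M mquot := mkHom mquot_proj_linear.

Lemma mproj_surj u : exists x, mproj x = u.
Proof. by exists (zrepr u); apply: mquot_projK. Qed.

Lemma mproj_eq0 x : mproj x = 0 <-> submod_set U x.
Proof. by rewrite -(raddf0 mproj) /= mquot_projE subr0. Qed.

Variables (N : lmodType S) (f : {linear M -> N}).
Hypothesis fU : forall x, submod_set U x -> f x = 0.

Definition mfactor_fun (u : mquot) : N := f (zrepr u).

Lemma mfactor_funE x : mfactor_fun (mquot_proj x) = f x.
Proof.
rewrite /mfactor_fun; apply/eqP; rewrite -subr_eq0 -linearB; apply/eqP/fU.
by apply/mquot_projE; rewrite mquot_projK.
Qed.

Lemma mfactor_linear : linear mfactor_fun.
Proof.
move=> a x y; have [x' <-] := mproj_surj x; have [y' <-] := mproj_surj y.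
by rewrite -linearP /= !mfactor_funE linearP.
Qed.

Definition mfactor : Hom mquot N := mkHom mfactor_linear.

Lemma mfactorE x : mfactor (mproj x) = f x. Proof. exact: mfactor_funE. Qed.

End QuotientModule.

Section Length.
Variable S : pzRingType.
Implicit Types M N P : lmodType S.

Lemma submod_eq M (U V : submod M) x :
  U = V :> set M -> submod_set V x -> submod_set U x.
Proof. by move=> ->. Qed.

Definition strict_step M (N : nat -> submod M) (i : nat) : bool :=
  `[< (N i : set M) <> N i.+1 >].

(* [U] has length at most [n]; counting strict steps instead of bounding the
   length of strict chains makes extensions additive. *)
Definition length_le M (U : submod M) (n : nat) : Prop :=
  forall N : nat -> submod M, (forall i, N i `<=` N i.+1) ->
    (forall i, N i `<=` U) ->
    forall k, (count (strict_step N) (iota 0 k) <= n)%N.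

Lemma length_leS M (U V : submod M) n :
  U `<=` V -> length_le V n -> length_le U n.
Proof. by move=> UV hV N Nm NU k; apply: hV => // i x /NU /UV. Qed.

Lemma length_le_zero M : length_le (submod0m M) 0%N.
Proof.
move=> N Nm N0 k; rewrite leqn0; apply/eqP/eqP; rewrite -leqn0 leqNgt -has_count.
apply/hasPn => i _; apply/negP => /asboolP; apply.
by apply/seteqP; split=> x Nx; [exact: Nm|rewrite (N0 _ _ Nx); exact: submod0].
Qed.

(** A step that is an equality both on the intersections with the kernel and on the images is an
    equality. The strict steps of a chain are thus covered by those of the two derived chains. *)
Lemma length_le_ext M N (f : {linear M -> N}) (U : submod M) a b :
  length_le (submodI U (submod_ker f)) a -> length_le (submod_image f U) b ->
  length_le U (a + b).
Proof.
move=> ha hb C Cm CU k.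
have := ha (fun i => submodI (C i) (submod_ker f)) _ _ k; move/(_ _ _)/wrap.
have := hb (fun i => submod_image f (C i)) _ _ k; move/(_ _ _)/wrap.
case=> [i _ [x Cx <-]|i _ [x Cx <-]|le_b].
- by exists x => //; apply: Cm.
- by exists x => //; apply: CU Cx.
case=> [i x [/Cm]|i x [/CU]|le_a] //.
apply: leq_trans (leq_add le_a le_b); rewrite -count_predUI.
apply: leq_trans (leq_addr _ _); apply: sub_count => i; rewrite /strict_step /=.
move/asboolP=> neq; apply: contrapT => /negP; rewrite negb_or.
case/andP=> /asboolPn/contrapT e1 /asboolPn/contrapT e2; apply: neq.
apply/seteqP; split=> [|x Cx]; first exact: Cm.
have : (f @` C i) (f x) by rewrite e2; exists x.
case=> y Cy fyx.
have : (C i `&` f @^-1` [set 0]) (x - y).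
  rewrite e1; split; first by apply: submodB => //; apply: Cm.
  by rewrite /= /preimage /= linearB fyx subrr.
by case=> Cxy _; rewrite -[x](subrK y); apply: submodD.
Qed.

(** A chain inside the image is pulled back along [f] and cut with [U]; it is recovered from this
    pullback, so strict steps stay strict. *)
Lemma length_le_image M N (f : {linear M -> N}) (U : submod M) n :
  length_le U n -> length_le (submod_image f U) n.
Proof.
move=> hU C Cm CU k.
have := hU (fun i => submodI U (submod_preim f (C i))) _ _ k.
move/(_ _ _)/wrap; case=> [i x [Ux /Cm]|i x []|] //.
apply: leq_trans; apply: sub_count => i /asboolP neq; apply/asboolP => e.
apply: neq; apply/seteqP; split=> [|y Cy]; first exact: Cm.
have [x Ux fxy] := CU _ _ Cy.
have : submod_set (submodI U (submod_preim f (C i.+1))) x.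
  by split=> //; rewrite /= /preimage /= fxy.
by move=> /(submod_eq e)[_]; rewrite /= /preimage /= fxy.
Qed.

Lemma length_leA M (U V : submod M) m n :
  length_le U m -> length_le V n -> length_le (submodA U V) (m + n).
Proof.
move=> hU hV; apply: (@length_le_ext _ _ (mproj U)).
  by apply: length_leS hU => x [_ /mproj_eq0].
apply: length_leS (length_le_image (f := mproj U) hV).
move=> _ [_ [u [v [Uu Vv ->]]] <-].
by exists v => //; rewrite linearD (proj2 (mproj_eq0 U u) Uu) add0r.
Qed.

Definition finite_length M := exists n, length_le (submodT M) n.

Lemma length_le_inj M N (f : {linear M -> N}) n :
  injective f -> length_le (submodT N) n -> length_le (submodT M) n.
Proof.
move=> fI hN; apply: (@length_le_ext _ _ f _ 0%N); last exact: length_leS hN.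
apply: length_leS (@length_le_zero M) => x [_ fx0].
by apply: fI; rewrite linear0.
Qed.

Lemma length_le_surj M N (f : {linear M -> N}) n :
  (forall y, exists x, f x = y) ->
  length_le (submodT M) n -> length_le (submodT N) n.
Proof.
move=> fS hM; apply: length_leS (length_le_image (f := f) hM) => y _.
by have [x <-] := fS y; exists x.
Qed.

Lemma length_le_inj_strict M N (f : {linear M -> N}) n :
  injective f -> (submod_range f : set N) <> setT ->
  length_le (submodT N) n -> (0 < n)%N /\ length_le (submodT M) n.-1.
Proof.
move=> fI fNS hN.
suff h (C : nat -> submod M) k : (forall i, C i `<=` C i.+1) ->
    (count (strict_step C) (iota 0 k) < n)%N.
  have n0 : (0 < n)%N by apply: leq_ltn_trans (h (fun=> submodT M) 0%N _).
  by split=> // C Cm _ k; rewrite -ltnS prednK //; apply: h.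
(* The chain is pushed into [N] and [N] itself is appended. As [f] is not onto, this last step is
   one more strict step. *)
move=> Cm; pose D i := if (i <= k)%N then submod_image f (C i) else submodT N.
have := hN D _ _ k.+1; move/(_ _ _)/wrap; case=> [i x|//|].
  rewrite /D; case: (leqP i.+1 k) => [lik|//]; rewrite (ltnW lik).
  by move=> [y Cy <-]; exists y => //; apply: Cm.
apply: leq_trans; rewrite -[k.+1]addn1 iotaD count_cat add0n -addn1 /= addn0; apply: leq_add.
  rewrite -size_filter -(@size_filter _ (strict_step D)).
  rewrite (@eq_in_filter _ (strict_step C) (predI (strict_step C) (strict_step D))).
    rewrite !size_filter; apply: sub_count => i /andP[]//.
  move=> i; rewrite mem_iota add0n /= => lik; case: (boolP (strict_step C i)) => //=.
  move=> /asboolP neq; apply/esym/asboolP => e; apply: neq.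
  move: e; rewrite /D lik (ltnW lik) => e.
  apply/seteqP; split=> [|y Cy]; first exact: Cm.
  have : submod_set (submod_image f (C i.+1)) (f y) by exists y.
  by move=> /(submod_eq e)[z Cz /fI <-].
rewrite lt0b; apply/asboolP; rewrite /D leqnn ltnn => e; apply: fNS.
apply/seteqP; split=> // y _.
have : submod_set (submodT N) y by [].
by move=> /(submod_eq e)[x _ <-]; exists x.
Qed.

Lemma length_le_surj_strict M N (f : {linear M -> N}) n :
  (forall y, exists x, f x = y) -> ~ injective f ->
  length_le (submodT M) n -> (0 < n)%N /\ length_le (submodT N) n.-1.
Proof.
move=> fS fNI hM.
suff h (C : nat -> submod N) k : (forall i, C i `<=` C i.+1) ->
    (count (strict_step C) (iota 0 k) < n)%N.
  have n0 : (0 < n)%N by apply: leq_ltn_trans (h (fun=> submodT N) 0%N _).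
  by split=> // C Cm _ k; rewrite -ltnS prednK //; apply: h.
(* Preimages with the zero submodule put in front. As [f] is not injective, the step from 0 to the
   first preimage, which contains the kernel, is strict. *)
move=> Cm; pose D i := if i is j.+1 then submod_preim f (C j) else submod0m M.
have := hM D _ _ k.+1; move/(_ _ _)/wrap; case=> [[|i] x|//|].
- by move=> /= ->; rewrite /preimage /= linear0; apply: submod0.
- exact: Cm.
apply: leq_trans; rewrite /= -add1n; apply: leq_add.
  rewrite lt0b; apply/asboolP => e; apply: fNI => x y fxy.
  have : submod_set (submod_preim f (C 0%N)) (x - y).
    by rewrite /= /preimage /= linearB fxy subrr; apply: submod0.
  by move=> /(submod_eq e) /eqP; rewrite subr_eq0 => /eqP.
rewrite (iotaDl 1 0) count_map; apply: sub_count => i /asboolP neq.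
rewrite /= add1n; apply/asboolP => e; apply: neq.
apply/seteqP; split=> [|y Cy]; first exact: Cm.
have [x fxy] := fS y.
have : submod_set (submod_preim f (C i.+1)) x by rewrite /= /preimage /= fxy.
by move=> /(submod_eq e); rewrite /= /preimage /= fxy.
Qed.

(** The default 0 is taken when no bound exists, so the value is meaningful only for modules of
    finite length. *)
Definition len M : nat :=
  xget 0%N [set n | length_le (submodT M) n /\
                    forall m, length_le (submodT M) m -> (n <= m)%N].

Lemma lenP M : finite_length M -> length_le (submodT M) (len M).
Proof.
move=> [n0 hn0]; have ex : exists n, `[< length_le (submodT M) n >].
  by exists n0; apply/asboolP.
have [n /asboolP hn minn] := ex_minnP ex.
rewrite /len; case: xgetP => [k _ []//|/(_ n) /=]; case; split=> // m hm.
by apply: minn; apply/asboolP.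
Qed.

Lemma len_min M n : length_le (submodT M) n -> (len M <= n)%N.
Proof.
move=> hn; have ex : exists n, `[< length_le (submodT M) n >].
  by exists n; apply/asboolP.
have [m /asboolP hm minm] := ex_minnP ex.
rewrite /len; case: xgetP => [k _ [_]|//]; exact.
Qed.

Lemma finite_length_inj M N (f : {linear M -> N}) :
  injective f -> finite_length N -> finite_length M.
Proof. by move=> fI [n hn]; exists n; apply: length_le_inj fI hn. Qed.

Lemma finite_length_surj M N (f : {linear M -> N}) :
  (forall y, exists x, f x = y) -> finite_length M -> finite_length N.
Proof. by move=> fS [n hn]; exists n; apply: length_le_surj fS hn. Qed.

Lemma len_inj M N (f : {linear M -> N}) :
  injective f -> finite_length N -> (len M <= len N)%N.
Proof. by move=> fI /lenP hN; apply: len_min; apply: length_le_inj fI hN. Qed.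

Lemma len_surj M N (f : {linear M -> N}) :
  (forall y, exists x, f x = y) -> finite_length M -> (len N <= len M)%N.
Proof. by move=> fS /lenP hM; apply: len_min; apply: length_le_surj fS hM. Qed.

Lemma len_inj_eq M N (f : {linear M -> N}) : injective f -> finite_length N ->
  (len N <= len M)%N -> forall y, exists x, f x = y.
Proof.
move=> fI /lenP hN; rewrite leqNgt => /negP lt y.
apply: contrapT => nex; apply: lt.
have [|n0 h] := length_le_inj_strict fI _ hN; last first.
  by rewrite -(prednK n0) ltnS; apply: len_min.
move=> e; apply: nex; have : (submod_range f : set N) y by rewrite e.
by case=> x _ <-; exists x.
Qed.

Lemma len_surj_eq M N (f : {linear M -> N}) : (forall y, exists x, f x = y) ->
  finite_length M -> (len M <= len N)%N -> injective f.
Proof.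
move=> fS /lenP hM; rewrite leqNgt => /negP lt; apply: contrapT => fNI; apply: lt.
have [n0 h] := length_le_surj_strict fS fNI hM.
by rewrite -(prednK n0) ltnS; apply: len_min.
Qed.

(** Otherwise an element of [U] outside the span of those already chosen could be added forever, and
    the spans would form a chain with [n.+1] strict steps. *)
Lemma length_le_fg M (U : submod M) n : length_le U n ->
  exists k (g : 'I_k -> M), (forall i, submod_set U (g i)) /\
    forall x, submod_set U x -> exists c : 'I_k -> S, x = \sum_i c i *: g i.
Proof.
move=> hU; apply: contrapT => nfg.
pose sp (s : seq M) := submod_span (fun i : 'I_(size s) => s`_i).
have /choice[nxt nxtP] : forall s : seq M, exists x : M,
    (forall i : 'I_(size s), submod_set U s`_i) ->
    submod_set U x /\ ~ submod_set (sp s) x.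
  move=> s; apply: contrapT => nex; apply: nfg.
  exists (size s), (fun i => s`_i).
  have Us : forall i : 'I_(size s), submod_set U s`_i.
    by apply: contrapT => nU; apply: nex; exists 0 => /nU.
  split=> // x Ux; apply: contrapT => nx; apply: nex; exists x => _; split=> //.
pose s k := iter k (fun s => nxt s :: s) [::].
have Us k (i : 'I_(size (s k))) : submod_set U (s k)`_i.
  elim: k i => [[]//|k IH [[|i] Hi]] /=; first by have [] := nxtP (s k) (IH).
  exact: (IH (Ordinal (Hi : (i < size (s k))%N))).
have spS k : sp (s k) `<=` sp (s k.+1).
  move=> x [c ->]; exists (fun i => if unlift ord0 i is Some j then c j else 0).
  rewrite big_ord_recl unlift_none scale0r add0r.
  by apply: eq_bigr => i _; rewrite liftK.
have := hU (fun k => sp (s k)) spS _ n.+1; move/(_ _)/wrap; case.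
  by move=> k x [c ->]; apply: submod_sum => i; apply: submodZ.
apply/negP; rewrite -ltnNge.
suff -> : count (strict_step (fun k => sp (s k))) (iota 0 n.+1) = n.+1 by [].
rewrite -[RHS](size_iota 0); apply/eqP; rewrite -all_count; apply/allP => k _.
apply/asboolP => e; have [_] := nxtP (s k) (Us k); apply.
have : submod_set (sp (s k.+1)) (nxt (s k)).
  exists (fun i => if i == ord0 then 1 else 0).
  rewrite big_ord_recl eqxx scale1r big1 ?addr0 // => i _.
  by rewrite eq_sym (negbTE (neq_lift _ _)) scale0r.
by move=> /(submod_eq e).
Qed.

End Length.

Lemma max_submod_avoiding (S : pzRingType) (M : lmodType S) (U : submod M) x :
  ~ submod_set U x -> exists W : submod M,
    [/\ U `<=` W, ~ submod_set W x & forall W' : submod M, W `<=` W' ->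
        ~ submod_set W' x -> W' `<=` W].
Proof.
move=> Ux; pose T := {W : submod M | U `<=` W /\ ~ submod_set W x}.
have t0 : T by exists U; split.
pose R (W W' : T) := `[< (sval W : set M) `<=` sval W' >].
have [||A Atot|t tmax] := @ZL_preorder T t0 R.
- by move=> t; apply/asboolP.
- by move=> r s t /asboolP rs /asboolP st; apply/asboolP => y /rs /st.
(* [U] is joined to the union so that the empty chain also gets an upper bound. *)
- pose V : set M := [set y | submod_set U y \/
                     exists2 W : T, A W & submod_set (sval W) y].
  have V0 : V 0 by left; apply: submod0.
  have VL a y z : V y -> V z -> V (a *: y + z).
    move=> [Uy|[Y AY Yy]] [Uz|[Z AZ Zz]].
    + by left; apply: submodL.
    + by right; exists Z => //; apply: submodL => //; case: (svalP Z) => + _; apply.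
    + by right; exists Y => //; apply: submodL => //; case: (svalP Y) => + _; apply.
    + have [/asboolP YZ|/asboolP ZY] := Atot _ _ AY AZ.
        by right; exists Z => //; apply: submodL => //; apply: YZ.
      by right; exists Y => //; apply: submodL => //; apply: ZY.
  have VP : U `<=` Submod V0 VL /\ ~ submod_set (Submod V0 VL) x.
    split=> [y Uy|]; first by left.
    by case=> [//|[W _ Wx]]; case: (svalP W).
  by exists (exist _ (Submod V0 VL) VP) => s As; apply/asboolP => y sy; right; exists s.
exists (sval t); case: (svalP t) => Ut tx; split=> // W' tW' W'x.
have PW' : U `<=` W' /\ ~ submod_set W' x by split=> // y /Ut /tW'.
by apply/asboolP/(tmax (exist _ W' PW')); apply/asboolP.
Qed.

Lemma artinian_min (S : pzRingType) (M : lmodType S) (P : submod M -> Prop) U0 :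
  artinian M -> P U0 -> exists U : submod M,
    P U /\ forall V : submod M, V `<=` U -> P V -> U `<=` V.
Proof.
move=> art P0; apply: contrapT => nex.
have /choice[nxt nxtP] : forall U : submod M, exists V : submod M, P U ->
    [/\ V `<=` U, P V & ~ U `<=` V].
  move=> U; apply: contrapT => nV; apply: nex; exists U; split.
    by apply: contrapT => nPU; apply: nV; exists U.
  by move=> V VU PV; apply: contrapT => nUV; apply: nV; exists V.
pose N k := iter k nxt U0.
have PN k : P (N k) by elim: k => //= k /nxtP[].
have [k|n /(_ n.+1 (leqnSn _)) e] := art N; first by have [] := nxtP _ (PN k).
by have [_ _] := nxtP _ (PN n); apply; rewrite -e.
Qed.

(** The element [x] is a marker: a term of the chain is 0 before [x] enters and all of [U]
    afterwards, so the only possible strict step is the one where it enters. *)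
Lemma length_le_simple (S : pzRingType) (M : lmodType S) (U : submod M) x :
  submod_set U x ->
  (forall N : submod M, N `<=` U -> submod_set N x -> U `<=` N) ->
  (forall N : submod M, N `<=` U -> ~ submod_set N x -> N `<=` [set 0]) ->
  length_le U 1.
Proof.
move=> Ux full triv C Cm CU k.
suff : (count (strict_step C) (iota 0 k) <= `[< submod_set (C k) x >])%N.
  by move=> h; apply: leq_trans h (leq_b1 _).
elim: k => // k IHk; rewrite -addn1 iotaD count_cat /= addn0 add0n addn1.
case: (boolP (strict_step C k)) => [/asboolP neq|_]; last first.
  rewrite addn0; apply: leq_trans IHk _; case: (asboolP (submod_set (C k) x)) => //.
  by move=> /Cm h; rewrite asboolT.
have nCk : ~ submod_set (C k) x.
  move=> Ckx; apply: neq; apply/seteqP; split=> [|y Cy]; first exact: Cm.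
  by apply: (full _ (CU k) Ckx); apply: CU Cy.
have Ck1 : submod_set (C k.+1) x.
  apply: contrapT => nCk1; apply: neq; apply/seteqP; split=> [|y Cy]; first exact: Cm.
  by rewrite (triv _ (CU k.+1) nCk1 y Cy); apply: submod0.
by move: IHk; rewrite (asboolF nCk) (asboolT Ck1) leqn0 => /eqP ->.
Qed.

(** * Finite length over artinian commutative rings and artin algebras *)

Section ArtinianLength.
Variable R : comPzRingType.
Implicit Types (I : submod (R^o : lmodType R)) (r s x y : R).

Lemma homothety_linear r : linear (fun x : R^o => (r * x : R^o)).
Proof. by move=> a x y; rewrite mulrDr; congr (_ + _); apply: mulrCA. Qed.
Definition homothety r : Hom (R^o : lmodType R) R^o := mkHom (homothety_linear r).

(* An ideal of infinite length that is minimal with this property is killed by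
   a maximal ideal, hence is a vector space; a hyperplane in it has finite
   length, and so has the ideal itself. *)
Lemma artinian_finite_length :
  artinian (R^o : lmodType R) -> finite_length (R^o : lmodType R).
Proof.
move=> art; apply: contrapT => ninf.
pose P I := ~ exists n, length_le I n.
have [I [PI Imin]] := artinian_min (P := P) art ninf.
have fin (V : submod (R^o : lmodType R)) : V `<=` I -> ~ I `<=` V -> exists n, length_le V n.
  by move=> VI nIV; apply: contrapT => /(Imin _ VI).
pose Q r := forall x, submod_set I x -> r * x = 0.
(* If [r] neither kills [I] nor maps it onto itself, then the image and the kernel of [r] on [I] are
   both proper, hence of finite length by minimality, and so is [I]. *)
have dich r : Q r \/ forall x, submod_set I x -> exists2 y, submod_set I y & x = r * y.
  have [Qr|nQr] := pselect (Q r); [by left|right].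
  move=> x Ix; apply: contrapT => nx; apply: PI.
  have [||m hm] := fin (submod_image (homothety r) I).
  - by move=> _ [y Iy <-]; apply: (submodZ r Iy).
  - by move=> /(_ x Ix)[y Iy e]; apply: nx; exists y.
  have [||n hn] := fin (submodI I (submod_ker (homothety r))); first by move=> y [].
    by move=> h; apply: nQr => y /h[].
  by exists (n + m)%N; apply: length_le_ext hn hm.
(* The ideals generated by [r ^+ k] and the annihilator of [I] descend, so
   [r ^+ n = r ^+ n.+1 * s + q] for some [n], with [q] killing [I]. As [r ^+ n] maps [I] onto
   itself, [1 - r * s] kills [I]: modulo the annihilator every nonzero element is invertible. *)
have inv r : ~ Q r -> exists s, Q (1 - r * s).
  move=> nQr; have surj x : submod_set I x -> exists2 y, submod_set I y & x = r * y.
    by case: (dich r) => // h; apply: h.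
  have surjX k x : submod_set I x -> exists2 y, submod_set I y & x = r ^+ k * y.
    elim: k x => [|k IHk] x Ix; first by exists x => //; rewrite mul1r.
    have [y Iy ->] := surj x Ix; have [z Iz ->] := IHk y Iy.
    by exists z => //; rewrite mulrA -exprS.
  pose Ns k : set R := [set y | exists s q, Q q /\ y = r ^+ k * s + q].
  have N0 k : Ns k 0 by exists 0, 0; split=> [x _|]; rewrite ?mul0r ?mulr0 ?addr0.
  have NL k a x y : Ns k x -> Ns k y -> Ns k (a * x + y).
    move=> [s [q [Qq ->]]] [s' [q' [Qq' ->]]]; exists (a * s + s'), (a * q + q').
    split=> [z Iz|]; first by rewrite mulrDl -mulrA Qq // Qq' // mulr0 addr0.
    by rewrite !mulrDr addrACA mulrCA.
  have [k|n /(_ n.+1 (leqnSn _)) e] := art (fun k => @Submod _ (R^o : lmodType R) (Ns k) (N0 k) (NL k)).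
    by move=> x [s [q [Qq ->]]]; exists (r * s), q; rewrite mulrA -exprSr.
  have : Ns n (r ^+ n) by exists 1, 0; split=> [x _|]; rewrite ?mul0r ?mulr1 ?addr0.
  rewrite [Ns n](esym e) => -[s [q [Qq eq]]]; exists s => x Ix.
  have [y Iy ->] := surjX n x Ix.
  by rewrite mulrA mulrBl mul1r mulrAC -exprS {1}eq [_ + q]addrC addrK Qq.
have [x0 Ix0 nx0] : exists2 x0, submod_set I x0 & x0 <> 0.
  apply: contrapT => nx; apply: PI; exists 0%N.
  apply: length_leS (@length_le_zero _ (R^o : lmodType R)) => x Ix.
  by apply: contrapT => nx0; apply: nx; exists x.
(* The intersection of [I] with [W] is the hyperplane: it misses [x0], so it has finite length by
   minimality, and [x0] spans a complement of length at most 1. *)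
have [W [_ Wx0 Wmax]] := max_submod_avoiding (U := submod0m (R^o : lmodType R)) nx0.
have [||m hm] := fin (submodI I W); first by move=> x [].
  by move=> /(_ _ Ix0)[].
pose L := submod_span (fun _ : 'I_1 => (x0 : R^o)).
have LE r : submod_set L (r * x0) by exists (fun=> r); rewrite big_ord1.
have hL : length_le L 1.
  apply: (@length_le_simple _ _ _ x0).
  - by rewrite -[x0]mul1r.
  - by move=> N _ Nx0 _ [c ->]; rewrite big_ord1; apply: submodZ.
  - move=> N NL Nx0 y Ny; have [c yE] := NL _ Ny; rewrite big_ord1 in yE.
    have [Qc|/inv[s Qs]] := pselect (Q (c ord0)); first by rewrite yE; apply: Qc.
    case: Nx0; suff -> : x0 = s *: y by apply: submodZ.
    have /eqP := Qs _ Ix0; rewrite mulrBl mul1r subr_eq0 => /eqP {1}->.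
    by rewrite yE [c _ * s]mulrC -mulrA.
apply: PI; exists (m + 1)%N; apply: length_leS (length_leA hm hL) => y Iy.
have [Wy|nWy] := pselect (submod_set W y).
  by exists y, 0; split=> //; [exact: submod0|rewrite addr0].
pose Y := submod_span (fun _ : 'I_1 => (y : R^o)).
have : submod_set (submodA W Y) x0.
  apply: contrapT => /(Wmax (submodA W Y)) h; apply: nWy; apply: h.
    by move=> w Ww; exists w, 0; split=> //; [exact: submod0|rewrite addr0].
  exists 0, y; split; [exact: submod0| |by rewrite add0r].
  by exists (fun=> 1); rewrite big_ord1 scale1r.
(* Now [x0 = w + r *: y]. The scalar [r] cannot kill [I], otherwise [x0] would lie in [W]; inverting
   it modulo the annihilator solves for [y]. *)
case=> w [_ [Ww [c ->] x0E]]; rewrite big_ord1 in x0E; set r := c ord0 in x0E.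
have Iw : submod_set I w.
  by rewrite -[w](addrK (r *: y)) -x0E; apply: submodB => //; apply: submodZ.
have [Qr|/inv[s Qs]] := pselect (Q r).
  by case: Wx0; rewrite x0E [r *: y](Qr y Iy) addr0.
exists (- (s *: w)), (s * x0); split=> //.
  by split; apply/submodN/submodZ.
have /eqP := Qs _ Iy; rewrite mulrBl mul1r subr_eq0 => /eqP {1}->.
by rewrite x0E [in RHS]mulrDr [X in _ = - X + _](_ : _ = s * w) // addKr mulrA [r * s]mulrC.
Qed.

End ArtinianLength.

(** A copy of the carrier, so that the restricted module structure can be declared beside the
    original one. *)
Definition restr (R S : pzRingType) (phi : {rmorphism R -> S}) (M : lmodType S) : Type := M.

Section RestrictionOfScalars.
Variables (R S : pzRingType) (phi : {rmorphism R -> S}) (M : lmodType S).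

HB.instance Definition _ := GRing.Zmodule.on (restr phi M).
Definition restr_scale (r : R) (x : restr phi M) : restr phi M := phi r *: (x : M).
Fact restr_scaleA a b x : restr_scale a (restr_scale b x) = restr_scale (a * b) x.
Proof. by rewrite /restr_scale scalerA rmorphM. Qed.
Fact restr_scale1 : left_id 1 restr_scale.
Proof. by move=> x; rewrite /restr_scale rmorph1 scale1r. Qed.
Fact restr_scaleDr : right_distributive restr_scale +%R.
Proof. by move=> a x y; apply: scalerDr. Qed.
Fact restr_scaleDl x : {morph restr_scale^~ x : a b / a + b}.
Proof. by move=> a b; rewrite /restr_scale rmorphD scalerDl. Qed.
HB.instance Definition _ := GRing.Zmodule_isLmodule.Build R (restr phi M)
  restr_scaleA restr_scale1 restr_scaleDr restr_scaleDl.

Definition restr_submod (U : submod M) : submod (restr phi M : lmodType R) :=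
  @Submod R (restr phi M) U (submod0 U) (fun a x y Ux Uy => @submodL S M U (phi a) x y Ux Uy).

Lemma length_le_restr (U : submod M) n :
  length_le (restr_submod U) n -> length_le U n.
Proof. by move=> h C Cm CU k; apply: (h (fun i => restr_submod (C i))). Qed.

End RestrictionOfScalars.

Lemma finite_length_sum (S : pzRingType) (M L : lmodType S) n
    (f : 'I_n -> {linear L -> M}) :
  finite_length L -> (forall x, exists y : 'I_n -> L, x = \sum_i f i (y i)) ->
  finite_length M.
Proof.
move=> [l hl] gen.
(* Dropping one map leaves only part of [M] generated, so the induction produces a submodule of
   finite length containing all the sums. *)
suff [m [U [hU UE]]] : exists m (U : submod M),
    length_le U m /\ forall y : 'I_n -> L, submod_set U (\sum_i f i (y i)).
  by exists m; apply: length_leS hU => x _; have [y ->] := gen x; apply: UE.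
elim: n f {gen} => [|n IHn] f.
  exists 0%N, (submod0m M); split=> [|y]; first exact: length_le_zero.
  by rewrite big_ord0; apply: submod0.
have [m [U [hU UE]]] := IHn (fun i => f (lift ord0 i)).
have hi := length_le_image (f := f ord0) hl.
exists (l + m)%N; eexists; split; first exact: length_leA hi hU.
move=> y; rewrite big_ord_recl; exists (f ord0 (y ord0)), (\sum_i f (lift ord0 i) (y (lift ord0 i))).
by split=> //; exists (y ord0).
Qed.

Lemma finite_length_joint_inj (S : pzRingType) (M : lmodType S) n
    (L : 'I_n -> lmodType S) (f : forall i, {linear M -> L i}) :
  (forall i, finite_length (L i)) -> (forall x, (forall i, f i x = 0) -> x = 0) ->
  finite_length M.
Proof.
move=> hL inj.
(* Injectivity is relaxed to a submodule [U], so that the induction can pass to the kernel of the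
   first map. *)
have : forall x, submod_set (submodT M) x -> (forall i, f i x = 0) -> x = 0 by auto.
rewrite /finite_length; move: (submodT M) => U.
elim: n L f hL U {inj} => [|n IHn] L f hL U inj.
  exists 0%N; apply: length_leS (@length_le_zero _ M) => x Ux.
  by apply: inj => // -[].
have [||m hm] := IHn _ (fun i => f (lift ord0 i)) _ (submodI U (submod_ker (f ord0))).
- by move=> i; apply: hL.
- move=> x [Ux fx0] fx; apply: inj => // i; case: (unliftP ord0 i) => [j|] -> //.
have [l hl] := hL ord0; exists (m + l)%N; apply: length_le_ext hm _.
exact: length_leS hl.
Qed.

Lemma scale_linear (S : pzRingType) (M : lmodType S) (x : M) :
  linear (fun a : S^o => (a : S) *: x).
Proof. by move=> a b c; rewrite scalerDl scalerA. Qed.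

Definition scale_hom (S : pzRingType) (M : lmodType S) (x : M) : Hom (S^o : lmodType S) M :=
  mkHom (scale_linear x).

Lemma fg_finite_length (S : pzRingType) (M : lmodType S) :
  finite_length (S^o : lmodType S) -> finitely_generated M -> finite_length M.
Proof.
move=> hS [n [g gen]]; apply: (finite_length_sum (f := fun i => scale_hom (g i)) hS).
by move=> x; have [c ->] := gen x; exists c.
Qed.

Section ArtinAlgebraLength.
Variables (A : pzRingType) (R : comPzRingType) (phi : {rmorphism R -> A}).
Hypothesis Rart : artinian (R^o : lmodType R).
Hypothesis phiC : forall r a, phi r * a = a * phi r.
Variables (n : nat) (g : 'I_n -> A).
Hypothesis gen : forall a, exists c : 'I_n -> R, a = \sum_i phi (c i) * g i.

Fact phic_additive : zmod_morphism (phi : R -> A^c).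
Proof. by move=> x y; rewrite raddfB. Qed.
Fact phic_mult : monoid_morphism (phi : R -> A^c).
Proof. by split=> [|x y]; [exact: (rmorph1 phi)|rewrite mulrC; apply: (rmorphM phi)]. Qed.

Definition phic : {rmorphism R -> A^c} :=
  HB.pack (phi : R -> A^c) (GRing.isZmodMorphism.Build R A^c phi phic_additive)
    (GRing.isMonoidMorphism.Build R A^c phi phic_mult).

Lemma algebra_finite_length : finite_length (restr phic (A^c^o : rmodType A)).
Proof.
apply: (finite_length_sum (f := fun i => scale_hom (g i : restr phic (A^c^o : rmodType A)))).
  exact: artinian_finite_length.
move=> a; have [c ->] := gen a; exists c; apply: eq_bigr => i _.
exact: phiC.
Qed.

Lemma algebra_finite_length_self : finite_length (A^c^o : rmodType A).
Proof.
have [m hm] := algebra_finite_length.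
by exists m; apply: (@length_le_restr _ _ phic); apply: length_leS hm.
Qed.

Variable M : rmodType A.
Hypothesis Mfg : finitely_generated M.

Lemma fg_restr_finite_length : finite_length (restr phic M).
Proof.
have [m [h hgen]] := Mfg.
have lin i : linear ((fun a : A^c => a *: h i) : restr phic (A^c^o : rmodType A) -> restr phic M).
  move=> r x y; rewrite scalerDl; congr (_ + _); exact: (esym (scalerA (phi r : A^c) (x : A^c) (h i))).
apply: (finite_length_sum (f := fun i => mkHom (lin i))) algebra_finite_length _ => x.
by have [c ->] := hgen x; exists c.
Qed.

Lemma center_linear r : linear (fun x : M => (phi r : A^c) *: x).
Proof.
move=> a x y; rewrite scalerDr !scalerA; congr (_ *: _ + _); exact: (esym (phiC r a)).
Qed.
Definition center_endo r : Endo M := mkHom (center_linear r).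

Fact center_endo_additive : zmod_morphism center_endo.
Proof. by move=> r s; apply: Hom_ext => x /=; rewrite raddfB scalerBl. Qed.
Fact center_endo_mult : monoid_morphism center_endo.
Proof.
split=> [|r s]; apply: Hom_ext => x /=; first by rewrite rmorph1; apply: scale1r.
by rewrite scalerA mulrC; congr (_ *: _); apply: (rmorphM phi).
Qed.
Definition center_rmorph : {rmorphism R -> Endo M} :=
  HB.pack center_endo (GRing.isZmodMorphism.Build R (Endo M) _ center_endo_additive)
    (GRing.isMonoidMorphism.Build R (Endo M) _ center_endo_mult).

Lemma center_endoC r (f : Endo M) : center_endo r * f = f * center_endo r.
Proof. by apply: Hom_ext => x /=; rewrite linearZ. Qed.

(** An endomorphism is determined by its values on the generators of [M], and evaluation at a
    generator is linear over [R]; this embeds the endomorphism ring in a power of [M]. *)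
Lemma endo_finite_length : finite_length (restr center_rmorph ((Endo M)^o : lmodType (Endo M))).
Proof.
have [m [h hgen]] := Mfg.
have lin i : linear ((fun f : Endo M => f (h i)) :
    restr center_rmorph ((Endo M)^o : lmodType (Endo M)) -> restr phic M) by [].
apply: (finite_length_joint_inj (f := fun i => mkHom (lin i))) (fun=> fg_restr_finite_length) _.
move=> f fh; apply: Hom_ext => x; have [c ->] := hgen x; rewrite linear_sum big1 // => i _.
by rewrite linearZ (fh i : f (h i) = 0 :> M); apply: scaler0.
Qed.

End ArtinAlgebraLength.

Lemma artin_algebra_finite_length (A : pzRingType) :
  artin_algebra A -> finite_length (A^c^o : rmodType A).
Proof.
by move=> [R [phi [art phiC [n [g gen]]]]]; exact: (algebra_finite_length_self art phiC gen).
Qed.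

Definition ideal_fg (B : pzRingType) (H : ideal B) :=
  exists n (g : 'I_n -> B), (forall i, subgroup_set H (g i)) /\
    forall x, subgroup_set H x ->
      (exists c : 'I_n -> B, x = \sum_i c i * g i) /\
      (exists d : 'I_n -> B, x = \sum_i g i * d i).

(** Over [R] the ideal has finite length, hence finitely many generators. Scalars from [R] act by
    central elements, so the same generators serve on the left and on the right. *)
Lemma endo_ideal_fg (A : pzRingType) (M : rmodType A) (H : ideal (Endo M)) :
  artin_algebra A -> finitely_generated M -> ideal_fg H.
Proof.
move=> [R [phi [art phiC [n [g gen]]]]] Mfg.
have [m hm] := endo_finite_length art phiC gen Mfg.
pose HR := restr_submod (center_rmorph phiC M) (left_submod H).
have [|k [h [Hh hgen]]] := length_le_fg (U := HR) (n := m); first exact: length_leS hm.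
exists k, h; split=> // x /hgen[c ->]; split; exists (fun i => center_endo phiC M (c i)) => //.
by apply: eq_bigr => i _; apply: center_endoC.
Qed.

(** * Indecomposable modules *)

Section ModuleLemmas.
Variable S : pzRingType.
Implicit Types M N P Q X Y Z : lmodType S.

Definition surj M N (f : M -> N) := forall y, exists x, f x = y.

Lemma hom_inv M N (f : {linear M -> N}) : injective f -> surj f ->
  exists g : {linear N -> M}, cancel f g /\ cancel g f.
Proof.
move=> fI /choice[g gK].
have lin : linear g by move=> a x y; apply: fI; rewrite linearP !gK.
by exists (mkHom lin); split=> x /=; [apply: fI|]; rewrite gK.
Qed.

Lemma hom_inj0 M N (f : {linear M -> N}) : (forall x, f x = 0 -> x = 0) -> injective f.
Proof.
move=> f0 x y fxy; apply/eqP; rewrite -subr_eq0; apply/eqP/f0.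
by rewrite linearB fxy subrr.
Qed.

Lemma bij_surj M N (f : {linear M -> N}) : bijective f -> surj f.
Proof. by move=> [g _ gK] y; exists (g y). Qed.

Lemma inj_surj_bij M N (f : {linear M -> N}) : injective f -> surj f -> bijective f.
Proof. by move=> fI fS; have [g [? ?]] := hom_inv fI fS; exists g. Qed.

Lemma isomorphicP M N : isomorphic M N <->
  exists (f : {linear M -> N}) (g : {linear N -> M}), cancel f g /\ cancel g f.
Proof.
split=> [[f fb]|[f [g [fK gK]]]]; last by exists f, g.
by exists f; apply: hom_inv; [exact: bij_inj|exact: bij_surj].
Qed.

Lemma isomorphic_sym M N : isomorphic M N -> isomorphic N M.
Proof. by move=> /isomorphicP[f [g [fK gK]]]; exists g, f. Qed.

Lemma copair_linear X Y N (f : {linear X -> N}) (g : {linear Y -> N}) :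
  linear (fun z : (X * Y)%type => f z.1 + g z.2).
Proof. by move=> a [x y] [x' y'] /=; rewrite !linearP scalerDr addrACA. Qed.

Definition copair X Y N (f : {linear X -> N}) (g : {linear Y -> N}) :
  Hom (X * Y)%type N := mkHom (copair_linear f g).

Lemma pairing_linear X Y N (f : {linear N -> X}) (g : {linear N -> Y}) :
  linear (fun z : N => (f z, g z) : (X * Y)%type).
Proof. by move=> a x y; congr pair; rewrite linearP. Qed.

Definition pairing X Y N (f : {linear N -> X}) (g : {linear N -> Y}) :
  Hom N (X * Y)%type := mkHom (pairing_linear f g).

Lemma indecomposable_sum M (U V : submod M) : indecomposable M ->
  (forall x, submod_set U x -> submod_set V x -> x = 0) ->
  (forall x, exists u v, [/\ submod_set U u, submod_set V v & x = u + v]) ->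
  (forall x, submod_set U x -> x = 0) \/ (forall x, submod_set V x -> x = 0).
Proof.
move=> [_ dec] UV0 UVT.
have : isomorphic M (submod_type U * submod_type V)%type.
  apply: isomorphic_sym; exists (copair (incl U) (incl V)); apply: inj_surj_bij.
    apply: hom_inj0 => -[u v] /= e.
    have ev : incl U u = - incl V v by apply/eqP; rewrite -addr_eq0; apply/eqP.
    have u0 : incl U u = 0.
      by apply: UV0; [exact: inclP|rewrite ev; apply/submodN/inclP].
    have v0 : incl V v = 0 by rewrite -[LHS]opprK -ev u0 oppr0.
    by congr pair; apply: incl_inj; rewrite ?u0 ?v0 linear0.
  move=> x; have [u [v [Uu Vv ->]]] := UVT x.
  by exists (insubmod Uu, insubmod Vv).
case/dec=> z0; [left|right] => x Ux.
  by have /(congr1 (incl U)) := z0 (insubmod Ux); rewrite linear0.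
by have /(congr1 (incl V)) := z0 (insubmod Ux); rewrite linear0.
Qed.

(** [Y] is the direct sum of the image of [q], which is nonzero, and the kernel of [p], which must
    therefore vanish. *)
Lemma indecomposable_split Y Z (p : {linear Y -> Z}) (q : {linear Z -> Y}) :
  indecomposable Y -> ~ zero_module Z -> cancel q p -> cancel p q.
Proof.
move=> Yi Z0 qK.
have [||h|h] := indecomposable_sum (U := submod_range q) (V := submod_ker p) Yi.
- by move=> _ [z _ <-]; rewrite /= /preimage /= qK => ->; rewrite linear0.
- move=> y; exists (q (p y)), (y - q (p y)); split.
  + by exists (p y).
  + by rewrite /= /preimage /= linearB qK subrr.
  + by rewrite addrC subrK.
- case: Z0 => z; rewrite -[z]qK (h (q z)) ?linear0 //; by exists z.
move=> y; apply/eqP; rewrite -subr_eq0; apply/eqP/h.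
by rewrite /= /preimage /= linearB qK subrr.
Qed.

Definition hom_iter M (f : Endo M) (n : nat) : Hom M M := f ^+ n.

Lemma hom_iterD M (f : Endo M) m n x : hom_iter f (m + n) x = hom_iter f m (hom_iter f n x).
Proof. by rewrite /hom_iter exprD. Qed.

(** Take a power [g] of [f] whose image has least length. It maps this image bijectively onto
    itself, so [M] is the direct sum of the image and the kernel of [g]. *)
Lemma fitting M (f : Endo M) : finite_length M -> indecomposable M ->
  bijective f \/ exists n, forall x, hom_iter f n x = 0.
Proof.
(* Exponents start at 1, so that the kernel of [f] is contained in that of the chosen power. *)
move=> fl Mi; pose R n := submod_type (submod_range (hom_iter f n.+1)).
have flR n : finite_length (R n) by apply: (finite_length_inj (@incl_inj _ _ _)).
have ex : exists l, `[< exists n, len (R n) = l >].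
  by exists (len (R 0%N)); apply/asboolP; exists 0%N.
have [l /asboolP[n nl] lmin] := ex_minnP ex.
have le_len m : (len (R n) <= len (R m))%N.
  by rewrite nl; apply: lmin; apply/asboolP; exists m.
pose g := hom_iter f n.+1.
have gP (x : R n) : submod_set (submod_range g) (Hom_comp g (incl _) x).
  by exists (incl _ x).
pose gR : Hom (R n) (R n) := corestr gP.
have RE m (x : R m) : exists y, incl _ x = hom_iter f m.+1 y.
  by case: (inclP x) => y _ <-; exists y.
have i2n x : submod_set (submod_range g) (incl _ (x : R (n + n.+1)%N)).
  by have [y ->] := RE _ x; exists (g y) => //; rewrite -addSn hom_iterD.
(* The image of [g] applied twice lies in the image of [g] and, by minimality, is not shorter. *)
have surj2 : surj (corestr i2n).
  apply: len_inj_eq (flR n) (le_len _) => x y /(congr1 (incl _)).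
  by rewrite !corestrE; apply: incl_inj.
have gRS : surj gR.
  move=> x; have [z <-] := surj2 x; have [y yE] := RE _ z.
  have gy : submod_set (submod_range g) (g y) by exists y.
  by exists (insubmod gy); apply: incl_inj; rewrite !corestrE yE -addSn hom_iterD.
have gRI : injective gR by apply: len_surj_eq gRS (flR n) _.
have [||h|h] := indecomposable_sum (U := submod_range g) (V := submod_ker g) Mi.
- move=> x gx gx0; have : gR (insubmod gx) = 0 by apply: incl_inj; rewrite linear0 -[RHS]gx0.
  by rewrite -(linear0 gR) => /gRI /(congr1 (incl _)); rewrite linear0.
- move=> x; have gx : submod_set (submod_range g) (g x) by exists x.
  have [y yE] := gRS (insubmod gx); have gyE : g (incl _ y) = g x := congr1 (incl _) yE.
  exists (incl _ y), (x - incl _ y); split; first exact: inclP.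
    by rewrite /= /preimage /= linearB gyE subrr.
  by rewrite addrC subrK.
- by right; exists n.+1 => x; apply: h; exists x.
left; have fI : injective f.
  apply: hom_inj0 => x fx; apply: h; rewrite /= /preimage /= /g -addn1.
  by rewrite hom_iterD [hom_iter f 1 x]fx linear0.
by apply: inj_surj_bij => //; apply: len_inj_eq.
Qed.

Lemma endo_local M (f g : Endo M) : finite_length M -> indecomposable M ->
  (forall x, f x + g x = x) -> bijective f \/ bijective g.
Proof.
move=> fl Mi fg1; have [|[n fn]] := fitting f fl Mi; [by left|right].
have gI : injective g.
  (* An element killed by [g] is fixed by [f], and [f] is nilpotent. *)
  apply: hom_inj0 => x gx; have fx : f x = x by rewrite -[RHS]fg1 gx addr0.
  rewrite -(fn x); elim: n {fn} => // n IHn.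
  by rewrite -addn1 hom_iterD [hom_iter f 1 x]fx.
by apply: inj_surj_bij => //; apply: len_inj_eq.
Qed.

End ModuleLemmas.

Section FgModules.
Variable S : pzRingType.
Hypothesis hS : finite_length (S^o : lmodType S).
Implicit Types M N P Q Y Z : lmodType S.

Lemma fg_surj M N (f : {linear M -> N}) : surj f ->
  finitely_generated M -> finitely_generated N.
Proof.
move=> fS [n [g gen]]; exists n, (f \o g) => y; have [x <-] := fS y.
have [c ->] := gen x; exists c; rewrite linear_sum.
by apply: eq_bigr => i _; rewrite linearZ.
Qed.

Lemma finite_length_fg M : finite_length M -> finitely_generated M.
Proof.
move=> [n hn]; have [k [g [_ gen]]] := length_le_fg hn.
by exists k, g => x; apply: gen.
Qed.

Lemma fg_inj M N (f : {linear M -> N}) : injective f ->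
  finitely_generated N -> finitely_generated M.
Proof.
move=> fI /(fg_finite_length hS) flN; apply: finite_length_fg.
exact: finite_length_inj fI flN.
Qed.

Lemma fg_pair Y Z : finitely_generated Y -> finitely_generated Z ->
  finitely_generated (Y * Z)%type.
Proof.
move=> [m [g gen]] [n [h genh]]; exists (m + n)%N.
exists (fun k => match split k with inl a => pair_i1 Z (g a) | inr b => pair_i2 Y (h b) end).
move=> [y z]; have [c cE] := gen y; have [d dE] := genh z.
exists (fun k => match split k with inl a => c a | inr b => d b end).
rewrite big_split_ord /=.
have -> : (y, z) = pair_i1 Z y + pair_i2 Y z by congr pair; rewrite /= ?addr0 ?add0r.
rewrite cE dE !linear_sum; congr (_ + _); apply: eq_bigr => i _; rewrite linearZ.
  by rewrite (unsplitK (inl i)).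
by rewrite (unsplitK (inr i)).
Qed.

Lemma fg_submod M (U : submod M) : finitely_generated M -> finitely_generated (submod_type U).
Proof. exact/fg_inj/incl_inj. Qed.

Lemma fg_mquot M (U : submod M) : finitely_generated M -> finitely_generated (mquot U).
Proof. exact/fg_surj/mproj_surj. Qed.

Variables (I : finType) (X : I -> lmodType S).

Definition decomposition N := exists (J : finType) (k : J -> I)
    (p : forall a, {linear X (k a) -> N}) (q : forall a, {linear N -> X (k a)}),
  (forall a, cancel (p a) (q a)) /\ forall x, x = \sum_a p a (q a x).

Hypothesis Xall : forall N, finitely_generated N -> indecomposable N ->
  exists i, isomorphic N (X i).

Lemma decomposition_exists N : finitely_generated N -> decomposition N.
Proof.
have [n] := ubnP (len N); elim: n N => // n IHn N ltn Nfg.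
have [Nz|Nnz] := pselect (zero_module N).
  have p (a : void) : {linear X (of_void I a) -> N} by case: a.
  have q (a : void) : {linear N -> X (of_void I a)} by case: a.
  by exists void, (of_void I), p, q; split=> [[]|x]; rewrite big1 => [|[]]; apply: Nz.
have [Ni|Nni] := pselect (indecomposable N).
  have [i /isomorphicP[f [g [fK gK]]]] := Xall Nfg Ni.
  exists unit, (fun=> i), (fun=> g), (fun=> f); split=> // x.
  by rewrite (big_pred1 tt) ?fK // => -[].
have [Y [Z [NYZ Ynz Znz]]] : exists Y Z, [/\ isomorphic N (Y * Z)%type,
    ~ zero_module Y & ~ zero_module Z].
  apply: contrapT => nex; apply: Nni; split=> // Y Z NYZ; apply: contrapT => nz.
  by apply: nex; exists Y, Z; split=> // z; apply: nz; [left|right].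
have /isomorphicP[f [g [fK gK]]] := NYZ.
have flN := fg_finite_length hS Nfg.
pose i1 : Hom Y N := Hom_comp g (pair_i1 (X:=Y) Z : {linear _ -> _}).
pose i2 : Hom Z N := Hom_comp g (pair_i2 Y (Y:=Z) : {linear _ -> _}).
pose p1 : Hom N Y := Hom_comp (fst : {linear (Y * Z)%type -> Y}) f.
pose p2 : Hom N Z := Hom_comp (snd : {linear (Y * Z)%type -> Z}) f.
have i1K : cancel i1 p1 by move=> y; rewrite /= gK.
have i2K : cancel i2 p2 by move=> y; rewrite /= gK.
have p12 x : x = i1 (p1 x) + i2 (p2 x).
  rewrite /= -linearD -[LHS]fK; congr (g _); case: (f x) => y z.
  by congr pair; rewrite /= ?addr0 ?add0r.
have p1i2 z : p1 (i2 z) = 0 by rewrite /= gK.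
have p2i1 y : p2 (i1 y) = 0 by rewrite /= gK.
have [||J1 [k1 [P1 [Q1 [PQ1 e1]]]]] := IHn Y.
(* If [Y] were as long as [N], the injection [i1] would be onto and [Z] would vanish. *)
- rewrite -ltnS; apply: leq_trans ltn; rewrite ltnS ltnNge; apply/negP => le.
  have h := len_inj_eq (can_inj i1K) flN le.
  by apply: Znz => z; have [y yE] := h (i2 z); rewrite -[z]i2K -yE p2i1.
- exact: fg_inj (can_inj i1K) Nfg.
have [||J2 [k2 [P2 [Q2 [PQ2 e2]]]]] := IHn Z.
- rewrite -ltnS; apply: leq_trans ltn; rewrite ltnS ltnNge; apply/negP => le.
  have h := len_inj_eq (can_inj i2K) flN le.
  by apply: Ynz => y; have [z zE] := h (i1 y); rewrite -[y]i1K -zE p1i2.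
- exact: fg_inj (can_inj i2K) Nfg.
pose k (a : J1 + J2) := match a with inl b => k1 b | inr b => k2 b end.
pose p a : {linear X (k a) -> N} := match a with
  | inl b => Hom_comp i1 (P1 b) | inr b => Hom_comp i2 (P2 b) end.
pose q a : {linear N -> X (k a)} := match a with
  | inl b => Hom_comp (Q1 b) p1 | inr b => Hom_comp (Q2 b) p2 end.
exists (J1 + J2)%type, k, p, q; split=> [[b|b] x|x].
- by rewrite /p /q; change (Q1 b (p1 (i1 (P1 b x))) = x); rewrite i1K PQ1.
- by rewrite /p /q; change (Q2 b (p2 (i2 (P2 b x))) = x); rewrite i2K PQ2.
rewrite big_sumType /= [LHS]p12 [in LHS](e1 (p1 x)) [in LHS](e2 (p2 x)).
by rewrite !linear_sum.
Qed.

End FgModules.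

(** * Dual bases *)

Lemma sum_enum_val (V : nmodType) (J : finType) (F : J -> V) :
  \sum_j F j = \sum_(i < #|J|) F (enum_val i).
Proof.
by rewrite (reindex_onto enum_val enum_rank) => [|j _]; [apply: eq_bigl => i|];
  rewrite ?enum_rankK ?enum_valK ?eqxx.
Qed.

Section DualBasis.
Variable S : pzRingType.
Implicit Types P M : lmodType S.

(** By the dual basis lemma such data exist exactly for finitely generated projective modules; they
    turn projectivity into an identity between elements. *)
Definition dual_basis P := exists (J : finType) (x : J -> P)
  (xi : J -> {linear P -> (S^o : lmodType S)}),
  forall p, p = \sum_j (xi j p : S) *: x j.

Lemma dual_basis_fg P : dual_basis P -> finitely_generated P.
Proof.
move=> [J [x [xi gen]]]; exists #|J|, (x \o enum_val) => p.
by exists (fun i => xi (enum_val i) p); rewrite [LHS]gen sum_enum_val.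
Qed.

Lemma dual_basis_projective P : dual_basis P -> projective P.
Proof.
move=> [J [x [xi gen]]] M N g f gS.
have /choice[m mE] : forall j, exists m, g m = f (x j) by move=> j; apply: gS.
have lin : linear (fun p => \sum_j (xi j p : S) *: m j).
  move=> a p q; rewrite scaler_sumr -big_split /=; apply: eq_bigr => j _.
  by rewrite linearP scalerDl scalerA.
exists (mkHom lin) => p /=; rewrite [in RHS](gen p) !linear_sum.
by apply: eq_bigr => j _; rewrite !linearZ mE.
Qed.

Lemma dsum_comb_linear P n (x : 'I_n -> P) :
  linear (fun c : dsum (fun _ : 'I_n => (S^o : lmodType S)) => \sum_i (c i : S) *: x i).
Proof.
move=> a c d; rewrite scaler_sumr -big_split /=; apply: eq_bigr => i _.
by rewrite scalerA -scalerDl.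
Qed.

Lemma dsum_proj_linear (J : finType) (X : J -> lmodType S) j :
  linear (fun c : dsum X => c j).
Proof. by []. Qed.

Definition dsum_proj (J : finType) (X : J -> lmodType S) j : Hom (dsum X) (X j) :=
  mkHom (@dsum_proj_linear J X j).

Lemma fg_projective_dual_basis P :
  finitely_generated P -> projective P -> dual_basis P.
Proof.
move=> [n [x gen]] Pproj.
have [|h hE] := Pproj _ _ (mkHom (dsum_comb_linear x)) (Hom_id P).
  by move=> y; have [c ->] := gen y; exists c.
exists 'I_n, x, (fun i => Hom_comp (dsum_proj _ i) h) => p.
by rewrite [LHS](esym (hE p)).
Qed.

End DualBasis.

(** An inverse of [incl] with junk value 0 outside [U]; it is linear only on [U]. *)
Definition extend_sub (S : pzRingType) (M : lmodType S) (U : submod M) (x : M) :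
  submod_type U := if pselect (submod_set U x) is left Ux then insubmod Ux else 0.

Lemma extend_subK (S : pzRingType) (M : lmodType S) (U : submod M) x :
  submod_set U x -> incl U (extend_sub U x) = x.
Proof. by move=> Ux; rewrite /extend_sub; case: pselect. Qed.

Lemma extend_incl (S : pzRingType) (M : lmodType S) (U : submod M) (x : submod_type U) :
  extend_sub U (incl U x) = x.
Proof. by apply: incl_inj; rewrite extend_subK //; apply: inclP. Qed.

Lemma extend_subL (S : pzRingType) (M : lmodType S) (U : submod M) a x y :
  submod_set U x -> submod_set U y ->
  extend_sub U (a *: x + y) = a *: extend_sub U x + extend_sub U y.
Proof.
by move=> Ux Uy; apply: incl_inj; rewrite linearP !extend_subK //; apply: submodL.
Qed.

Section IdealDualBasis.
Variables (B : pzRingType) (H : ideal B).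

(** The functionals are total functions on [B], constrained only on [H], so that computations with
    them stay in [B] rather than in the type of the submodule. *)
Definition right_dual_basis := exists (J : finType) (h : J -> B) (phi : J -> B -> B),
  [/\ forall j, subgroup_set H (h j),
      forall j x b y, subgroup_set H x -> subgroup_set H y ->
        phi j (x * b + y) = phi j x * b + phi j y &
      forall x, subgroup_set H x -> x = \sum_j h j * phi j x].

Definition left_dual_basis := exists (J : finType) (h : J -> B) (phi : J -> B -> B),
  [/\ forall j, subgroup_set H (h j),
      forall j x b y, subgroup_set H x -> subgroup_set H y ->
        phi j (b * x + y) = b * phi j x + phi j y &
      forall x, subgroup_set H x -> x = \sum_j phi j x * h j].

Lemma right_projective_dual_basis :
  ideal_fg H -> right_projective H -> right_dual_basis.
Proof.
move=> [n [g [Hg gen]]]; pose U := right_submod H; move=> Hproj.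
have [|J [x [xi xiE]]] := fg_projective_dual_basis _ Hproj.
  exists n, (fun i => insubmod (Hg i : submod_set U (g i))) => x.
  have [_ [d dE]] := gen _ (inclP x); exists d.
  apply: incl_inj; rewrite linear_sum [LHS]dE; apply: eq_bigr => i _.
  by rewrite linearZ.
exists J, (fun j => incl _ (x j)), (fun j y => xi j (extend_sub U y)); split.
- by move=> j; apply: (inclP (x j)).
- move=> j y b z Hy Hz; have := extend_subL (U := U) b Hy Hz => /(congr1 (xi j)).
  by rewrite linearP.
- move=> y Hy; have /(congr1 (incl _)) := xiE (extend_sub U y).
  rewrite (extend_subK (U := U)) // linear_sum => {1}->.
  by apply: eq_bigr => j _; rewrite linearZ.
Qed.

Lemma left_projective_dual_basis :
  ideal_fg H -> left_projective H -> left_dual_basis.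
Proof.
move=> [n [g [Hg gen]]]; pose U := left_submod H; move=> Hproj.
have [|J [x [xi xiE]]] := fg_projective_dual_basis _ Hproj.
  exists n, (fun i => insubmod (Hg i : submod_set U (g i))) => x.
  have [[d dE] _] := gen _ (inclP x); exists d.
  apply: incl_inj; rewrite linear_sum [LHS]dE; apply: eq_bigr => i _.
  by rewrite linearZ.
exists J, (fun j => incl _ (x j)), (fun j y => xi j (extend_sub U y)); split.
- by move=> j; apply: (inclP (x j)).
- move=> j y b z Hy Hz; have := extend_subL (U := U) b Hy Hz => /(congr1 (xi j)).
  by rewrite linearP.
- move=> y Hy; have /(congr1 (incl _)) := xiE (extend_sub U y).
  rewrite (extend_subK (U := U)) // linear_sum => {1}->.
  by apply: eq_bigr => j _; rewrite linearZ.
Qed.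

Lemma right_dual_basis_projective : right_dual_basis -> right_projective H.
Proof.
pose U := right_submod H.
move=> [J [h [phi [Hh phiL gen]]]]; apply: dual_basis_projective.
have lin j : linear ((fun x => phi j (incl U x)) : submod_type U -> (B^c^o : rmodType B)).
  by move=> a x y; rewrite linearP; apply: phiL; apply: (inclP (U := U)).
exists J, (fun j => insubmod (Hh j : submod_set U (h j))), (fun j => mkHom (lin j)).
move=> p; apply: incl_inj; rewrite linear_sum [LHS](gen _ (inclP p)).
by apply: eq_bigr => j _; rewrite linearZ.
Qed.

Lemma left_dual_basis_projective : left_dual_basis -> left_projective H.
Proof.
pose U := left_submod H.
move=> [J [h [phi [Hh phiL gen]]]]; apply: dual_basis_projective.
have lin j : linear ((fun x => phi j (incl U x)) : submod_type U -> (B^o : lmodType B)).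
  by move=> a x y; rewrite linearP; apply: phiL; apply: (inclP (U := U)).
exists J, (fun j => insubmod (Hh j : submod_set U (h j))), (fun j => mkHom (lin j)).
move=> p; apply: incl_inj; rewrite linear_sum [LHS](gen _ (inclP p)).
by apply: eq_bigr => j _; rewrite linearZ.
Qed.

End IdealDualBasis.

(** * Rejective subcategories *)

Section Rejective.
Variables (C : additive_category) (D : subcategory C).

Definition has_right_approx (X : C) := exists (X' : C) (e : hom X' X),
  [/\ D X', mono e & forall Y (h : hom Y X), D Y -> exists h', h = e ∘ h'].

Definition has_left_approx (X : C) := exists (X' : C) (e : hom X X'),
  [/\ D X', epi e & forall Y (h : hom X Y), D Y -> exists h', h = h' ∘ e].

(** Chosen factorizations are unique because [e] is mono. Functor laws, naturality and the triangle
    identities therefore only need to be checked after composing with [e]. *)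
Lemma right_rejective_of_approx : (forall X, has_right_approx X) -> right_rejective D.
Proof.
move=> ap.
have A X : {X' : full D & {e : hom (sval X') X | mono e /\
    forall Y (h : hom Y X), D Y -> exists h', h = e ∘ h'}}.
  have /cid[X' /cid[e [DX' me le]]] := ap X.
  by exists (exist _ X' DX'), e.
pose r X := projT1 (A X); pose e X : hom (sval (r X)) X := sval (projT2 (A X)).
have me X : mono (e X) by case: (svalP (projT2 (A X))).
have L X (Y : full D) (h : hom (sval Y) X) : {h' | h = e X ∘ h'}.
  by apply: cid; case: (svalP (projT2 (A X))) => _; apply; apply: svalP.
have LE X Y h : e X ∘ sval (@L X Y h) = h by case: (L X Y h).
pose gm X Y (f : hom X Y) := sval (L Y (r X) (f ∘ e X)).
have gmE X Y (f : hom X Y) : e Y ∘ gm X Y f = f ∘ e X by apply: LE.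
have gm1 X : gm X X (idm X) = idm (sval (r X)).
  by apply: me; rewrite gmE comp1m compm1.
have gmM X Y Z (g : hom Y Z) (f : hom X Y) : gm X Z (g ∘ f) = gm Y Z g ∘ gm X Y f.
  by apply: me; rewrite gmE compA gmE -!compA gmE.
pose G : functor C (full D) := @Functor C (full D) r gm gm1 gmM.
pose un (X : full D) : hom (sval X) (sval (r (sval X))) := sval (L _ X (idm (sval X))).
have unE (X : full D) : e (sval X) ∘ un X = idm (sval X) by apply: LE.
have un_nat (X X' : full D) (f : hom (sval X) (sval X')) :
    un X' ∘ f = gm _ _ f ∘ un X.
  apply: me.
  by rewrite compA unE comp1m compA gmE -compA unE compm1.
have tri_r (Y : C) : gm _ _ (e Y) ∘ un (r Y) = idm (sval (r Y)).
  apply: me.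
  by rewrite compA gmE -compA unE.
exists G, (@Adjunction (full D) C (inclusion D) G un e un_nat gmE unE tri_r).
exact: me.
Qed.

Lemma left_rejective_of_approx : (forall X, has_left_approx X) -> left_rejective D.
Proof.
move=> ap.
have A X : {X' : full D & {e : hom X (sval X') | epi e /\
    forall Y (h : hom X Y), D Y -> exists h', h = h' ∘ e}}.
  have /cid[X' /cid[e [DX' me le]]] := ap X.
  by exists (exist _ X' DX'), e.
pose r X := projT1 (A X); pose e X : hom X (sval (r X)) := sval (projT2 (A X)).
have me X : epi (e X) by case: (svalP (projT2 (A X))).
have L X (Y : full D) (h : hom X (sval Y)) : {h' | h = h' ∘ e X}.
  by apply: cid; case: (svalP (projT2 (A X))) => _; apply; apply: svalP.
have LE X Y h : sval (@L X Y h) ∘ e X = h by case: (L X Y h).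
pose gm X Y (f : hom X Y) := sval (L X (r Y) (e Y ∘ f)).
have gmE X Y (f : hom X Y) : gm X Y f ∘ e X = e Y ∘ f by apply: LE.
have gm1 X : gm X X (idm X) = idm (sval (r X)).
  by apply: me; rewrite gmE comp1m compm1.
have gmM X Y Z (g : hom Y Z) (f : hom X Y) : gm X Z (g ∘ f) = gm Y Z g ∘ gm X Y f.
  by apply: me; rewrite gmE compA -gmE -!compA gmE.
pose F : functor C (full D) := @Functor C (full D) r gm gm1 gmM.
pose co (Y : full D) : hom (sval (r (sval Y))) (sval Y) := sval (L _ Y (idm (sval Y))).
have coE (Y : full D) : co Y ∘ e (sval Y) = idm (sval Y) by apply: LE.
have co_nat (Y Y' : full D) (g : hom (sval Y) (sval Y')) :
    co Y' ∘ gm (sval Y) (sval Y') g = g ∘ co Y.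
  apply: me.
  by rewrite -[LHS]compA gmE -[RHS]compA coE compA coE comp1m compm1.
have tri_l (X : C) : co (r X) ∘ gm _ _ (e X) = idm (sval (r X)).
  apply: me.
  by rewrite -compA gmE compA coE.
exists F, (@Adjunction C (full D) F (inclusion D) e co (fun X X' f => esym (gmE X X' f)) co_nat tri_l coE).
exact: me.
Qed.

Lemma right_rejective_approx X : right_rejective D -> has_right_approx X.
Proof.
move=> [G [adj me]]; exists (sval (G X)), (adj_counit adj X); split.
- exact: svalP.
- exact: me.
move=> Y h DY; pose Y' : full D := exist _ Y DY.
pose Gh : hom (sval (G Y)) (sval (G X)) := fmap G h.
pose u : hom Y (sval (G Y)) := adj_unit adj Y'.
have nat : adj_counit adj X ∘ Gh = h ∘ adj_counit adj Y := adj_counit_nat adj h.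
have tri : adj_counit adj Y ∘ u = idm Y := adj_triangle_l adj Y'.
by exists (Gh ∘ u); rewrite compA nat -compA tri compm1.
Qed.

Lemma left_rejective_approx X : left_rejective D -> has_left_approx X.
Proof.
move=> [F [adj me]]; exists (sval (F X)), (adj_unit adj X); split.
- exact: svalP.
- exact: me.
move=> Y h DY; pose Y' : full D := exist _ Y DY.
pose Fh : hom (sval (F X)) (sval (F Y)) := fmap F h.
pose c : hom (sval (F Y)) Y := adj_counit adj Y'.
have nat : adj_unit adj Y ∘ h = Fh ∘ adj_unit adj X := adj_unit_nat adj h.
have tri : c ∘ adj_unit adj Y = idm Y := adj_triangle_r adj Y'.
by exists (c ∘ Fh); rewrite -compA -nat compA tri comp1m.
Qed.

End Rejective.

(** * The Jacobson radical through right inverses *)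

Section Jacobson.
Variable B : pzRingType.

(** If the right ideal generated by [1 - r] were proper, a maximal right ideal above it would also
    contain [r], hence 1. Being maximal among those avoiding 1 is being a maximal right ideal. *)
Lemma jacobson_right_inv (r : B) : jacobson B r -> exists c, (1 - r) * c = 1.
Proof.
move=> Jr; apply: contrapT => ninv.
pose U := submod_range (scale_hom (1 - r : (B^c^o : rmodType B))).
have [|W [UW W1 Wmax]] := @max_submod_avoiding _ _ U (1 : B).
  by move=> [c _ cE]; apply: ninv; exists c.
have Wm : maximal_submod W.
  split=> [e|W' WW']; first by apply: W1; rewrite e.
  have [W'1|W'1] := pselect (submod_set W' (1 : B)); [right|left]; apply/seteqP; split=> //.
    move=> x _; rewrite -[x](mul1r (x : B)).
    exact: (@submodZ _ (B^c^o : rmodType B) W' (x : B^c) (1 : B)).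
  exact: Wmax.
apply: W1; rewrite -[1](subrK r); apply: (submodD (U := W)); last exact: Jr.
by apply: UW; exists (1 : B) => //; exact: (mulr1 (1 - r : B)).
Qed.

(** If a maximal right ideal [m] misses [r], then 1 is the sum of an element of [m] and some
    [r * b], so [m] contains the right invertible element [1 - r * b]. *)
Lemma jacobson_intro (r : B) :
  (forall b, exists c, (1 - r * b) * c = 1) -> jacobson B r.
Proof.
move=> inv m [mT mmax]; apply: contrapT => nmr.
pose L := submod_range (scale_hom (r : (B^c^o : rmodType B))).
have [||e] := mmax (submodA m L).
- by move=> x mx; exists x, 0; split=> //; [exact: submod0|rewrite addr0].
- move=> e; apply: nmr; rewrite -e; exists 0, r; split; first exact: submod0.
    by exists (1 : B) => //; exact: (mulr1 r).
  by rewrite add0r.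
have : (submodA m L : set _) (1 : B) by rewrite e.
case=> x [_ [mx [b _ <-]] eq1]; have [c cE] := inv b.
apply: mT; apply/seteqP; split=> // y _.
have {eq1} xE : x = 1 - r * b by rewrite eq1 addrK.
rewrite -[y](mul1r (y : B)) -cE -xE -mulrA.
exact: (@submodZ _ (B^c^o : rmodType B) m ((c * y) : B^c) x mx).
Qed.

End Jacobson.

Lemma ideal_sum (B : pzRingType) (H : ideal B) (J : finType) (F : J -> B) :
  (forall j, subgroup_set H (F j)) -> subgroup_set H (\sum_j F j).
Proof.
by move=> HF; elim/big_ind: _ => //; [exact: subgroup0|exact: subgroupD].
Qed.

(** * Traces and rejects of projectives with respect to an idempotent ideal *)

Section DualBasisIdeal.
Variables (B : pzRingType) (H : ideal B).
Hypothesis idem : idempotent_ideal H.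

Lemma idempotent_idealP x : subgroup_set H x -> exists (n : nat) (u v : 'I_n -> B),
  [/\ forall i, subgroup_set H (u i), forall i, subgroup_set H (v i) & x = \sum_i u i * v i].
Proof. by rewrite -[in X in X -> _]idem. Qed.

Lemma left_map0 (f : B -> B) : (forall x b y, subgroup_set H x -> subgroup_set H y ->
  f (b * x + y) = b * f x + f y) -> f 0 = 0.
Proof.
move=> fL; have H0 := subgroup0 H; have := fL 0 1 0 H0 H0.
by rewrite !mul1r addr0 -[X in X = _]addr0 => /addrI.
Qed.

Lemma left_map_sum (f : B -> B) (J : finType) (b x : J -> B) :
  (forall x b y, subgroup_set H x -> subgroup_set H y -> f (b * x + y) = b * f x + f y) ->
  (forall j, subgroup_set H (x j)) -> f (\sum_j b j * x j) = \sum_j b j * f (x j).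
Proof.
move=> fL Hx; pose K u v := subgroup_set H u /\ f u = v.
suff [] : K (\sum_j b j * x j) (\sum_j b j * f (x j)) by [].
apply: big_rec2 => [|j u v _ [Hv <-]].
  by split; [exact: subgroup0|exact: left_map0].
by split; [apply: subgroupD => //; apply: idealMl|rewrite fL].
Qed.

Lemma right_map0 (f : B -> B) : (forall x b y, subgroup_set H x -> subgroup_set H y ->
  f (x * b + y) = f x * b + f y) -> f 0 = 0.
Proof.
move=> fL; have H0 := subgroup0 H; have := fL 0 1 0 H0 H0.
by rewrite !mulr1 addr0 -[X in X = _]addr0 => /addrI.
Qed.

Lemma right_map_sum (f : B -> B) (J : finType) (b x : J -> B) :
  (forall x b y, subgroup_set H x -> subgroup_set H y -> f (x * b + y) = f x * b + f y) ->
  (forall j, subgroup_set H (x j)) -> f (\sum_j x j * b j) = \sum_j f (x j) * b j.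
Proof.
move=> fL Hx; pose K u v := subgroup_set H u /\ f u = v.
suff [] : K (\sum_j x j * b j) (\sum_j f (x j) * b j) by [].
apply: big_rec2 => [|j u v _ [Hv <-]].
  by split; [exact: subgroup0|exact: right_map0].
by split; [apply: subgroupD => //; apply: idealMr|rewrite fL].
Qed.

(** Elements of [H] are sums of products [u * v] with both factors in [H], and
    [f (u * v) = u * f v]. *)
Lemma left_map_ideal (f : B -> B) x :
  (forall x b y, subgroup_set H x -> subgroup_set H y -> f (b * x + y) = b * f x + f y) ->
  subgroup_set H x -> subgroup_set H (f x).
Proof.
move=> fL /idempotent_idealP[n [u [v [Hu Hv ->]]]]; rewrite left_map_sum //.
by apply: ideal_sum => i; apply: idealMr.
Qed.

End DualBasisIdeal.

Section IdealTrace.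
Variables (B : pzRingType) (H : ideal B).
Implicit Types P Q : rmodType B.
Local Notation "P ^*" := {linear P -> (B^c^o : rmodType B)}.

Lemma functionalZ P (xi : P^*) b x : xi (b *: x) = (xi x : B) * (b : B).
Proof. by rewrite linearZ. Qed.

Lemma functional_sum P (xi : P^*) (J : finType) (b : J -> B) (x : J -> P) :
  xi (\sum_j (b j : B^c) *: x j) = \sum_j (xi (x j) : B) * b j.
Proof. by rewrite linear_sum; apply: eq_bigr => j _; rewrite linearZ. Qed.

(* For a finitely generated projective P this is the submodule P H. *)
Program Definition trace_sub P : submod P :=
  @Submod _ P [set y | forall xi : P^*, subgroup_set H (xi y)] _ _.
Next Obligation. by move=> P xi; rewrite linear0; apply: subgroup0. Qed.
Next Obligation.
move=> P a x y Hx Hy xi; rewrite linearD functionalZ.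
by apply: subgroupD => //; apply: idealMr.
Qed.

(** For [P] with a dual basis this is the condition [P H = P]; in terms of functionals it passes to
    retracts at once. *)
Definition traced P := forall y (xi : P^*), subgroup_set H (xi y).

Lemma traced_retract P Q (i : {linear P -> Q}) (p : {linear Q -> P}) :
  cancel i p -> traced Q -> traced P.
Proof. by move=> iK tQ y xi; rewrite -[y]iK; apply: (tQ (i y) (Hom_comp xi p)). Qed.

Lemma trace_sub_map P Q (f : {linear P -> Q}) : traced P ->
  forall x, submod_set (trace_sub Q) (f x).
Proof. by move=> tP x xi; apply: (tP x (Hom_comp xi f)). Qed.

Lemma traced_comb P (J : finType) (b : J -> B) (x : J -> P) y :
  (forall j, subgroup_set H (b j)) -> y = \sum_j (b j : B^c) *: x j ->
  forall xi : P^*, subgroup_set H (xi y).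
Proof.
move=> Hb -> xi; rewrite functional_sum; apply: ideal_sum => j; exact: idealMl.
Qed.

Hypothesis idem : idempotent_ideal H.

(** A functional [eta] on [P H] need not extend to [P]. Idempotence replaces extension: a
    coefficient in [H] is a sum of products [u * v], the element [x j] times [u] already lies in
    [P H], and [eta] of it times [v] lies in [H]. *)
Lemma trace_sub_traced P : dual_basis P -> traced (submod_type (trace_sub P)).
Proof.
move=> [J [x [xi gen]]] y eta.
have Hy j : subgroup_set H (xi j (incl _ y)) := inclP y (xi j).
rewrite -[y]extend_incl; move: (incl _ y) Hy => {}y Hy.
rewrite (gen y).
have st b z : subgroup_set H b -> submod_set (trace_sub P) ((b : B^c) *: z).
  by move=> Hb zeta; rewrite functionalZ; apply: idealMl.
have -> : eta (extend_sub (trace_sub P) (\sum_j (xi j y : B^c) *: x j)) =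
    \sum_j (eta (extend_sub (trace_sub P) ((xi j y : B^c) *: x j)) : B).
  rewrite -linear_sum; congr (eta _); apply: incl_inj.
  rewrite linear_sum extend_subK.
    by apply: eq_bigr => j _; rewrite extend_subK //; apply: st.
  by apply: submod_sum => j; apply: st.
apply: ideal_sum => j; have [n [u [v [Hu Hv uvE]]]] := idempotent_idealP idem (Hy j).
have -> : extend_sub (trace_sub P) ((xi j y : B^c) *: x j) =
    \sum_i (v i : B^c) *: extend_sub (trace_sub P) ((u i : B^c) *: x j).
  apply: incl_inj; rewrite extend_subK; last exact: st.
  rewrite linear_sum uvE scaler_suml; apply: eq_bigr => i _.
  rewrite linearZ extend_subK; last exact: st.
  exact: (esym (scalerA _ _ _)).
rewrite functional_sum; apply: ideal_sum => i; exact: idealMl.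
Qed.

(** Expand an element of [P H] in the basis [x k], then each coefficient, which lies in [H], in the
    basis [h j]; the products of [x k] and [h j] form the new basis. *)
Lemma trace_sub_dual_basis P : right_dual_basis H -> dual_basis P ->
  dual_basis (submod_type (trace_sub P)).
Proof.
move=> [J [h [phi [Hh phiL hE]]]] [K [x [xi gen]]].
have st b z : subgroup_set H b -> submod_set (trace_sub P) ((b : B^c) *: z).
  by move=> Hb zeta; rewrite functionalZ; apply: idealMl.
pose U := trace_sub P.
have lin (jk : K * J) : linear ((fun y => phi jk.2 (xi jk.1 (incl U y))) :
    submod_type U -> (B^c^o : rmodType B)).
  by move=> a y z; rewrite !linearP; apply: phiL; [exact: (inclP y (xi jk.1))|exact: (inclP z (xi jk.1))].
exists (K * J)%type, (fun jk => insubmod (st _ (x jk.1) (Hh jk.2))).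
exists (fun jk => mkHom (lin jk)) => y; apply: incl_inj.
transitivity (\sum_k \sum_j
    (phi j (xi k (incl U y)) : B^c) *: ((h j : B^c) *: x k)); last first.
  by rewrite pair_bigA linear_sum; apply: eq_bigr => jk _; rewrite linearZ.
rewrite [LHS]gen; apply: eq_bigr => k _.
rewrite {1}(hE _ (inclP y (xi k))) scaler_suml; apply: eq_bigr => j _.
exact: (esym (scalerA _ _ _)).
Qed.

End IdealTrace.

Section LeftApproximation.
Variables (B : pzRingType) (H : ideal B).
Hypothesis idem : idempotent_ideal H.
Variables (J : finType) (h : J -> B) (phi : J -> B -> B).
Hypothesis Hh : forall j, subgroup_set H (h j).
Hypothesis phiL : forall j x b y, subgroup_set H x -> subgroup_set H y ->
  phi j (b * x + y) = b * phi j x + phi j y.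
Hypothesis hE : forall x, subgroup_set H x -> x = \sum_j phi j x * h j.
Variables (P : rmodType B) (K : finType) (x : K -> P).
Variable xi : K -> {linear P -> (B^c^o : rmodType B)}.
Hypothesis gen : forall p, p = \sum_k (xi k p : B^c) *: x k.

(* [reject] is the dual of H P^*, cut out of the free module on the generators
   [h j * xi k] of H P^* by the idempotent matrix [reject_mx]. *)
Definition reject_mx (s t : K * J) : B := phi t.2 (h s.2 * (xi s.1 (x t.1) : B)).

Definition reject_free := dsum (fun _ : K * J => (B^c^o : rmodType B)).

Lemma Hhxi s y : subgroup_set H (h s.2 * (xi s.1 y : B)).
Proof. exact: idealMr. Qed.

Lemma hxi_gen (s : K * J) y : \sum_k h s.2 * (xi s.1 (x k) : B) * (xi k y : B) =
  h s.2 * (xi s.1 y : B).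
Proof.
rewrite [in RHS](gen y) functional_sum mulr_sumr.
by apply: eq_bigr => k _; rewrite mulrA.
Qed.

Lemma reject_mx_unit s y :
  \sum_t reject_mx s t * (h t.2 * (xi t.1 y : B)) = h s.2 * (xi s.1 y : B).
Proof.
rewrite -(pair_bigA _ (fun k j => phi j (h s.2 * (xi s.1 (x k) : B)) *
   (h j * (xi k y : B)))) /= -hxi_gen; apply: eq_bigr => k _.
rewrite [in RHS](hE (Hhxi s (x k))) mulr_suml.
by apply: eq_bigr => j _; rewrite mulrA.
Qed.

(** By left linearity [phi t.2] comes out of the sum, which leaves the preceding identity at the
    point [x t.1]. *)
Lemma reject_mx_idem s t : \sum_r reject_mx s r * reject_mx r t = reject_mx s t.
Proof.
rewrite /reject_mx -(left_map_sum _ (phiL t.2)); last by move=> r; apply: Hhxi.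
by congr (phi _ _); apply: reject_mx_unit.
Qed.

Lemma reject_mx_ideal s t : subgroup_set H (reject_mx s t).
Proof. by apply: (left_map_ideal idem (phiL _)); apply: Hhxi. Qed.

Program Definition reject_sub : submod (reject_free : rmodType B) :=
  @Submod _ (reject_free : rmodType B)
    [set v | forall s, v s = \sum_t reject_mx s t * (v t : B) :> B] _ _.
Next Obligation. by move=> s; rewrite big1 // => t _; apply: mulr0. Qed.
Next Obligation.
move=> a v w Hv Hw s.
have -> : (a *: v + w) s = (v s : B) * a + (w s : B) :> B by [].
rewrite (Hv s) (Hw s) mulr_suml -big_split /=; apply: eq_bigr => t _.
by rewrite -mulrA -mulrDr.
Qed.

Definition reject : rmodType B := submod_type reject_sub.

Lemma reject_col_sub t : submod_set reject_sub (fun s => reject_mx s t).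
Proof. by move=> s; rewrite reject_mx_idem. Qed.

Definition reject_col t : reject := insubmod (reject_col_sub t).

Definition reject_coord t : Hom reject (B^c^o : rmodType B) :=
  Hom_comp (dsum_proj _ t) (incl reject_sub).

Lemma dsum_sumE (S : pzRingType) (L T : finType) (X : L -> lmodType S) (F : T -> dsum X) l :
  (\sum_t F t) l = \sum_t F t l.
Proof. exact: (linear_sum (dsum_proj X l)). Qed.

Lemma reject_gen v : v = \sum_t (reject_coord t v : B^c) *: reject_col t.
Proof.
apply: incl_inj; rewrite linear_sum; apply: functional_extensionality_dep => s.
rewrite dsum_sumE [LHS](inclP v s); apply: eq_bigr => t _.
by rewrite linearZ.
Qed.

Lemma reject_dual_basis : dual_basis reject.
Proof. exists (K * J)%type, reject_col, reject_coord; exact: reject_gen. Qed.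

(** The coordinates of a fixed vector are combinations of matrix entries, and these lie in [H]
    because it is idempotent. *)
Lemma reject_traced : traced H reject.
Proof.
move=> v zeta; apply: traced_comb (reject_gen v) zeta => t.
rewrite [reject_coord t v](inclP v t); apply: ideal_sum => s.
by apply: idealMr; apply: reject_mx_ideal.
Qed.

Lemma reject_unit_sub y :
  submod_set reject_sub (fun s => h s.2 * (xi s.1 y : B) : B^c^o).
Proof. by move=> s; rewrite reject_mx_unit. Qed.

Lemma reject_unit_linear : linear (fun y => insubmod (reject_unit_sub y) : reject).
Proof.
move=> a y z; apply: incl_inj; apply: functional_extensionality_dep => s.
change (h s.2 * (xi s.1 (a *: y + z) : B) =
  h s.2 * (xi s.1 y : B) * (a : B) + h s.2 * (xi s.1 z : B)).
have -> : xi s.1 (a *: y + z) = (xi s.1 y : B) * (a : B) + (xi s.1 z : B) :> B.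
  by rewrite linearD functionalZ.
by rewrite mulrDr mulrA.
Qed.

Definition reject_unit : Hom P reject := mkHom reject_unit_linear.

(** Functionals separate the points of [Q], so it suffices that a functional [w] killing the image
    of the unit is zero. By left linearity of [phi], its value on column [t] is [phi t.2] applied to
    [w] of the unit at [x t.1], hence zero, and the columns generate. *)
Lemma reject_unit_epi (Q : rmodType B) (f g : {linear reject -> Q}) :
  dual_basis Q -> (forall y, f (reject_unit y) = g (reject_unit y)) ->
  forall v, f v = g v.
Proof.
move=> [L [y [zeta ygen]]] fg v; rewrite [LHS]ygen [RHS]ygen; apply: eq_bigr => l _.
congr (_ *: _).
pose w : Hom reject (B^c^o : rmodType B) := Hom_comp (zeta l) (HomD f (HomN g)).
suff w0 u : w u = 0.
  by apply/eqP; rewrite -subr_eq0 -linearB; apply/eqP; apply: (w0 v).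
have wu z : w (reject_unit z) = 0 by rewrite /w /= fg subrr linear0.
have wcol t : w (reject_col t) = 0.
  have -> : w (reject_col t) = \sum_s (w (reject_col s) : B) * reject_mx s t.
    by rewrite {1}(reject_gen (reject_col t)) functional_sum.
  rewrite /reject_mx -(left_map_sum _ (phiL t.2)); last by move=> s; apply: Hhxi.
  rewrite [X in phi _ X](_ : _ = 0); first exact: (left_map0 (phiL t.2)).
  by rewrite -[RHS](wu (x t.1)) [in RHS](reject_gen (reject_unit _)) functional_sum.
rewrite (reject_gen u) functional_sum big1 // => t _.
by rewrite wcol; apply: mul0r.
Qed.

(** As [Q] is traced, the coordinates of each [f (x k)] lie in [H]; their expansions in the [h j]
    give the coefficients [c] of the lifted map. *)
Lemma reject_unit_lift (Q : rmodType B) (f : {linear P -> Q}) :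
  dual_basis Q -> traced H Q ->
  exists g : {linear reject -> Q}, forall y, f y = g (reject_unit y).
Proof.
move=> [L [y [zeta ygen]]] tQ.
pose c l (t : K * J) : B := phi t.2 (zeta l (f (x t.1))).
have lin : linear (fun v : reject =>
    \sum_l ((\sum_t c l t * (reject_coord t v : B)) : B^c) *: y l).
  move=> a v w; rewrite scaler_sumr -big_split /=; apply: eq_bigr => l _.
  rewrite scalerA -scalerDl; congr (_ *: _).
  rewrite [a * _](_ : _ = \sum_t c l t * ((reject_coord t v : B) * (a : B))); last first.
    by rewrite [LHS]mulr_suml; apply: eq_bigr => t _; rewrite mulrA.
  rewrite -big_split /=; apply: eq_bigr => t _.
  exact: (mulrDr (c l t) ((reject_coord t v : B) * (a : B)) (reject_coord t w : B)).
exists (mkHom lin) => z; rewrite [LHS]ygen; apply: eq_bigr => l _; congr (_ *: _).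
rewrite {1}(gen z) linear_sum.
rewrite [LHS](_ : _ = \sum_k (zeta l (f (x k)) : B) * (xi k z : B)); last first.
  by rewrite linear_sum; apply: eq_bigr => k _; rewrite !linearZ.
rewrite -(pair_bigA _ (fun k j => phi j (zeta l (f (x k))) * (h j * (xi k z : B)))) /=.
apply: eq_bigr => k _; rewrite {1}(hE (tQ (f (x k)) (zeta l))) mulr_suml.
by apply: eq_bigr => j _; rewrite mulrA.
Qed.

End LeftApproximation.

(* A fully faithful additive functor from [C] to left [S]-modules. *)
Record module_category (S : pzRingType) (C : preadd_category) := ModuleCategory {
  carrier : C -> lmodType S;
  ap : forall X Y : C, hom X Y -> Hom (carrier X) (carrier Y);
  mk : forall X Y : C, Hom (carrier X) (carrier Y) -> hom X Y;
  apK : forall X Y (f : hom X Y), mk (ap f) = f;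
  mkK : forall X Y (f : Hom (carrier X) (carrier Y)), ap (mk f) = f;
  ap_comp : forall X Y Z (g : hom Y Z) (f : hom X Y), ap (g ∘ f) = Hom_comp (ap g) (ap f);
  ap_id : forall X, ap (idm X) = Hom_id (carrier X);
  apD : forall X Y (f g : hom X Y), ap (f + g) = HomD (ap f) (ap g) }.
Arguments carrier {S C} _ X.
Arguments ap {S C} _ {X Y} f.
Arguments mk {S C} _ {X Y} f.

Definition Mod_module_category (S : pzRingType) : module_category S (Mod S) :=
  @ModuleCategory S (Mod S) (fun X => X) (fun X Y f => f) (fun X Y f => f)
    (fun X Y f => erefl) (fun X Y f => erefl) (fun X Y Z g f => erefl)
    (fun X => erefl) (fun X Y f g => erefl).

Definition full_module_category (S : pzRingType) (C : additive_category)
    (D : subcategory C) (c : module_category S C) : module_category S (full D) :=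
  @ModuleCategory S (full D) (fun X => carrier c (sval X))
    (fun X Y f => ap c (f : hom (sval X) (sval Y)))
    (fun X Y f => (mk c f : hom (sval X) (sval Y)))
    (fun X Y f => apK c (f : hom (sval X) (sval Y)))
    (fun X Y f => mkK f)
    (fun X Y Z g f => ap_comp c (g : hom (sval Y) (sval Z)) (f : hom (sval X) (sval Y)))
    (fun X => ap_id c (sval X))
    (fun X Y f g => apD c (f : hom (sval X) (sval Y)) g).

(** * Approximations and factor categories in terms of modules *)

Section ConcreteCategory.
Variables (S : pzRingType) (C : additive_category) (c : module_category S C).
Variable E : subcategory C.
Implicit Types X Y Z : C.

Lemma ap_ext X Y (f g : hom X Y) : (forall x, ap c f x = ap c g x) -> f = g.
Proof. by move=> /Hom_ext e; rewrite -(apK c f) e apK. Qed.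

Lemma apB X Y (f g : hom X Y) x : ap c (f - g) x = ap c f x - ap c g x.
Proof. by apply/eqP; rewrite eq_sym subr_eq -[X in _ == X](congr1 (fun h : Hom _ _ => h x) (apD c (f - g) g)) subrK. Qed.

Lemma ap0 X Y x : ap c (0 : hom X Y) x = 0.
Proof. by rewrite -[0 : hom X Y](subrr 0) apB subrr. Qed.

Lemma fproj_eqP X Y (f g : hom X Y) : fproj E f = fproj E g <-> factors E (f - g).
Proof. exact: (zprojP (factor_ideal E X Y)). Qed.

Lemma fproj_surj X Y (f : fhom E X Y) : exists g, f = fproj E g.
Proof. by exists (zrepr f); rewrite /fproj zreprK. Qed.

Definition right_approx X :=
  exists (X' : C) (e : Hom (carrier c X') (carrier c X)),
  [/\ E X', forall Z (g : Hom (carrier c Z) (carrier c X')),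
        (forall z, e (g z) = 0) -> forall z, g z = 0
    & forall Y (h : Hom (carrier c Y) (carrier c X)), E Y ->
      exists h' : Hom (carrier c Y) (carrier c X'), forall y, h y = e (h' y)].

Definition left_approx X :=
  exists (X' : C) (e : Hom (carrier c X) (carrier c X')),
  [/\ E X', forall Z (g : Hom (carrier c X') (carrier c Z)),
        (forall x, g (e x) = 0) -> forall x, g x = 0
    & forall Y (h : Hom (carrier c X) (carrier c Y)), E Y ->
      exists h' : Hom (carrier c X') (carrier c Y), forall x, h x = h' (e x)].

Lemma right_approxP X : has_right_approx E X <-> right_approx X.
Proof.
split=> -[X' [e [EX' me le]]].
  exists X', (ap c e); split=> // [Z g eg z|Y h EY].
    suff -> : g = ap c 0 by rewrite ap0.
    rewrite -[g](mkK (m := c)); congr (ap c _); apply: me; apply: ap_ext => y.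
    by rewrite comp0r ap0 ap_comp mkK /= eg.
  have [h' hE] := le Y (mk c h) EY; exists (ap c h') => y.
  by rewrite -[h](mkK (m := c)) hE ap_comp.
exists X', (mk c e); split=> // [Z g g' eg|Y h EY].
  apply: ap_ext => z; apply/eqP; rewrite -subr_eq0 -apB; apply/eqP.
  apply: me => y; rewrite apB linearB; apply/eqP; rewrite subr_eq0; apply/eqP.
  have := congr1 (fun h => ap c h y) eg.
  by rewrite /= !ap_comp mkK.
have [h' hE] := le Y (ap c h) EY; exists (mk c h').
by apply: ap_ext => y; rewrite ap_comp !mkK hE.
Qed.

Lemma left_approxP X : has_left_approx E X <-> left_approx X.
Proof.
split=> -[X' [e [EX' me le]]].
  exists X', (ap c e); split=> // [Z g eg z|Y h EY].
    suff -> : g = ap c 0 by rewrite ap0.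
    rewrite -[g](mkK (m := c)); congr (ap c _); apply: me; apply: ap_ext => y.
    by rewrite comp0l ap0 ap_comp mkK /= eg.
  have [h' hE] := le Y (mk c h) EY; exists (ap c h') => y.
  by rewrite -[h](mkK (m := c)) hE ap_comp.
exists X', (mk c e); split=> // [Z g g' eg|Y h EY].
  apply: ap_ext => z; apply/eqP; rewrite -subr_eq0 -apB; apply/eqP.
  apply: me => y; rewrite apB; apply/eqP; rewrite subr_eq0; apply/eqP.
  have := congr1 (fun h => ap c h y) eg.
  by rewrite /= !ap_comp mkK.
have [h' hE] := le Y (ap c h) EY; exists (mk c h').
by apply: ap_ext => y; rewrite ap_comp !mkK hE.
Qed.

(** Plain functions are allowed, so that expressions such as [u x - g (f (u x)) - x] can be used
    without packaging their linearity. *)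
Definition factors_thru X Y (f : carrier c X -> carrier c Y) :=
  exists (Z : C) (a : Hom (carrier c X) (carrier c Z)) (b : Hom (carrier c Z) (carrier c Y)),
    E Z /\ forall x, f x = b (a x).

Lemma factorsP X Y (f : hom X Y) : factors E f <-> factors_thru (ap c f).
Proof.
split=> -[Z [a [b [EZ fE]]]].
  by exists Z, (ap c a), (ap c b); split=> // x; rewrite fE ap_comp.
exists Z, (mk c a), (mk c b); split=> //.
by apply: ap_ext => x; rewrite fE ap_comp !mkK.
Qed.

(** Membership in the radical of the factor category, unfolded: [1 - g f] has a two-sided inverse
    [u] modulo maps that factor through [E]. *)
Definition radical_map X Y (f : Hom (carrier c X) (carrier c Y)) :=
  forall g : Hom (carrier c Y) (carrier c X), exists u : Hom (carrier c X) (carrier c X),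
    factors_thru (fun x => u (x - g (f x)) - x) /\
    factors_thru (fun x => u x - g (f (u x)) - x).

Lemma factors_thru_ext X Y (f g : carrier c X -> carrier c Y) :
  f =1 g -> factors_thru f -> factors_thru g.
Proof.
by move=> fg [Z [a [b [EZ fE]]]]; exists Z, a, b; split=> // x; rewrite -fg.
Qed.

Lemma fproj_radicalP X Y (f : hom X Y) :
  radical (C := factor_category E) X Y (fproj E f) <-> radical_map (ap c f).
Proof.
have key (g : hom Y X) (u : hom X X) :
  (fcomp (fproj E u) (fproj E (idm X) - fcomp (fproj E g) (fproj E f)) = fproj E (idm X) /\
   fcomp (fproj E (idm X) - fcomp (fproj E g) (fproj E f)) (fproj E u) = fproj E (idm X)) <->
  (factors_thru (fun x => ap c u (x - ap c g (ap c f x)) - x) /\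
   factors_thru (fun x => ap c u x - ap c g (ap c f (ap c u x)) - x)).
  have -> : fproj E (idm X) - fcomp (fproj E g) (fproj E f) = fproj E (idm X - g ∘ f).
    by rewrite fproj_comp /fproj zprojD zprojN.
  have e1 x : ap c (u ∘ (idm X - g ∘ f) - idm X) x = ap c u (x - ap c g (ap c f x)) - x.
    by rewrite apB ap_comp /= apB ap_comp ap_id.
  have e2 x : ap c ((idm X - g ∘ f) ∘ u - idm X) x = ap c u x - ap c g (ap c f (ap c u x)) - x.
    by rewrite apB ap_comp /= apB ap_comp ap_id.
  rewrite !fproj_comp; split=> -[h1 h2]; split.
  - by apply: factors_thru_ext e1 _; apply/factorsP/fproj_eqP.
  - by apply: factors_thru_ext e2 _; apply/factorsP/fproj_eqP.
  - by apply/fproj_eqP/factorsP; apply: factors_thru_ext h1 => x; rewrite e1.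
  - by apply/fproj_eqP/factorsP; apply: factors_thru_ext h2 => x; rewrite e2.
split=> [rad g|rad g'].
  have [u' uE] := rad (fproj E (mk c g)); have [u u'E] := fproj_surj u'.
  by move: uE; rewrite u'E => /key; rewrite mkK; exists (ap c u).
have [g ->] := fproj_surj g'.
have [u h] := rad (ap c g); exists (fproj E (mk c u)).
by apply/key; rewrite mkK.
Qed.

Lemma cosemisimpleP : cosemisimple E <->
  forall X Y (f : Hom (carrier c X) (carrier c Y)), radical_map f -> factors_thru f.
Proof.
split=> [cs X Y f rad|h X Y].
  have : radical (C := factor_category E) X Y (fproj E (mk c f)).
    by apply/fproj_radicalP; rewrite mkK.
  rewrite (cs X Y) /= => f0; rewrite -[f](mkK (m := c)); apply/factorsP.
  rewrite -[mk c f]subr0; apply/fproj_eqP; rewrite f0.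
  exact: (esym (zproj0 (factor_ideal E X Y))).
apply/seteqP; split=> [f'|_ ->].
  have [f ->] := fproj_surj f'.
  move=> /fproj_radicalP/h/factorsP fE.
  rewrite /= -[0](zproj0 (factor_ideal E X Y)); apply/fproj_eqP.
  by rewrite subr0.
move=> g.
have -> : g ∘ (0 : @hom (factor_category E) X Y) = 0.
  by apply: (addrI (g ∘ 0)); rewrite -compDr !addr0.
by rewrite subr0; exists (idm X); rewrite comp1m.
Qed.

End ConcreteCategory.

(** * From heredity chains to rejective chains *)

Section TracedSubcategory.
Variables (B : pzRingType) (C : additive_category) (c : module_category B^c C).

Lemma ap_cancel (P Q : C) (i : hom P Q) (p : hom Q P) :
  p ∘ i = idm P -> cancel (ap c i) (ap c p).
Proof.
by move=> e x; have := congr1 (fun h => ap c h x) e; rewrite /= ap_comp ap_id.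
Qed.

Program Definition traced_subcat (H : ideal B) : subcategory C :=
  @Subcategory C (fun P => traced H (carrier c P)) _ _ _ _.
Next Obligation.
move=> H P Q f [g [_ fg1]]; exact: (traced_retract (ap_cancel fg1)).
Qed.
Next Obligation.
move=> H Z Z0 y zeta; have := congr1 (fun h => ap c h y) Z0.
by rewrite /= ap_id ap0 /= => ->; rewrite linear0; apply: subgroup0.
Qed.
Next Obligation.
move=> H X Y Z [i1 [i2 [p1 [p2 [_ _ _ _ e]]]]] tX tY z zeta.
have := congr1 (fun h => ap c h z) e; rewrite /= apD !ap_comp ap_id /= => <-.
rewrite linearD; apply: subgroupD.
  exact: (trace_sub_map (ap c i1) tX).
exact: (trace_sub_map (ap c i2) tY).
Qed.
Next Obligation.
move=> H X Y Z [i1 [_ [p1 [_ [e _ _ _ _]]]]]; exact: (traced_retract (ap_cancel e)).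
Qed.

End TracedSubcategory.

Section TracedRejective.
Variable B : pzRingType.

Definition proj_cat : module_category B^c (proj B) :=
  full_module_category (proj_subcategory B^c) (Mod_module_category B^c).

Lemma proj_dual_basis (P : proj B) : dual_basis (carrier proj_cat P).
Proof. by case: (svalP P) => fg pr; apply: fg_projective_dual_basis. Qed.

Definition proj_of (P : rmodType B) (dP : dual_basis P) : proj B :=
  exist _ P (conj (dual_basis_fg dP) (dual_basis_projective dP)).

Variables (H H' : ideal B).
Hypothesis HH' : H' `<=` H.
Hypothesis idem' : idempotent_ideal H'.

Local Notation D := (traced_subcat proj_cat H).
Local Notation D' := (traced_subcat proj_cat H').
Local Notation cD := (full_module_category D proj_cat).

Lemma traced_sub P : traced H' P -> traced H P.
Proof. by move=> tP y xi; apply: HH'; apply: tP. Qed.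

Lemma traced_object P : dual_basis P -> traced H' P ->
  exists X : full D, D' (sval X) /\ carrier cD X = P.
Proof.
by move=> dP tP; exists (exist _ (proj_of dP) (traced_sub tP)).
Qed.

Lemma traced_right_rejective : right_dual_basis H' -> right_rejective (sub_in D D').
Proof.
move=> db; apply: right_rejective_of_approx => X; apply/(right_approxP cD).
have dP : dual_basis (carrier cD X) := proj_dual_basis (sval X).
pose P' := submod_type (trace_sub H' (carrier cD X)).
have [X' [D'X' eX']] := traced_object (trace_sub_dual_basis db dP) (trace_sub_traced idem' dP).
exists X'; rewrite eX'.
exists (incl (trace_sub H' (carrier cD X))); split=> // [Z g e z|Y h tY].
  by apply: incl_inj; rewrite e linear0.
by exists (corestr (trace_sub_map h tY)).
Qed.

Lemma traced_left_rejective : left_dual_basis H' -> left_rejective (sub_in D D').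
Proof.
move=> [J [h [phi [Hh phiL hE]]]]; apply: left_rejective_of_approx => X.
apply/(left_approxP cD).
have [K [x [xi gen]]] : dual_basis (carrier cD X) := proj_dual_basis (sval X).
have [X' [D'X' eX']] := traced_object (reject_dual_basis Hh phiL hE gen)
  (reject_traced idem' Hh phiL hE gen).
exists X'; rewrite eX'.
exists (reject_unit Hh hE gen); split=> // [Z g e z|Y f tY].
  apply: (reject_unit_epi phiL (g := Hom0 _ _) (proj_dual_basis (sval Z))) => y.
  exact: e.
exact: (reject_unit_lift Hh hE gen f (proj_dual_basis (sval Y)) tY).
Qed.

Hypothesis layer : forall u v r, subgroup_set H u -> subgroup_set H v ->
  jacobson (rquot H') (rproj H' r) -> subgroup_set H' (u * r * v).

(** With [r = zeta (f p)], a right inverse of [1 - r * b] modulo [H'] is needed for every [b]. It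
    comes from inverting [1 - g f] for the map [g] sending [q] to [p] times [b * zeta q], by the
    usual exchange: if [1 - x y] has inverse [u], then [1 + y u x] inverts [1 - y x]. *)
Lemma radical_jacobson (X Y : full D) (f : Hom (carrier cD X) (carrier cD Y))
    (zeta : {linear carrier cD Y -> (B^c^o : rmodType B)}) p :
  radical_map (sub_in D D') f ->
  jacobson (rquot H') (rproj H' (zeta (f p))).
Proof.
move=> rad; apply: jacobson_intro => b'; pose b : B := zrepr b'.
have bE : rproj H' b = b' by apply: zreprK.
have ling : linear (fun q => (b * (zeta q : B) : B^c) *: p).
  move=> a q q'; rewrite linearD functionalZ mulrDr mulrA [LHS]scalerDl.
  by congr (_ + _); exact: (esym (scalerA _ _ _)).
have [u [_ [Z [a [d [tZ uE]]]]]] := rad (mkHom ling).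
have key y : subgroup_set H' (zeta (f (u y - (b * (zeta (f (u y)) : B) : B^c) *: p - y))).
  rewrite [u y - _ - y](uE y); exact: (trace_sub_map d tZ (a y) (Hom_comp zeta f)).
pose z : B := zeta (f (u p)); pose r : B := zeta (f p).
(* The product of [1 - r * b] and [1 + z * b] differs from 1 exactly by the element that [key],
   taken at [p] times [b], puts in [H']. *)
exists (rproj H' (1 + z * b)); rewrite -bE -/r.
rewrite [LHS](_ : _ = rproj H' ((1 - r * b) * (1 + z * b))); last first.
  rewrite [RHS]rprojM; congr (rmul _ _).
  rewrite [RHS](zprojD H' 1 (- (r * b))) zprojN; congr (_ - _).
  exact: (esym (rprojM H' r b)).
apply/(zprojP H').
pose zf : Hom (carrier cD X) (B^c^o : rmodType B) := Hom_comp zeta f.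
have zuE : zf (u ((b : B^c) *: p)) = z * b := functionalZ (Hom_comp zf u) b p.
have := key ((b : B^c) *: p); rewrite [zeta (f (u _))]zuE.
rewrite [zeta (f _)](linearB zf) [zf (_ - _)](linearB zf) zuE !(functionalZ zf).
change (zf p : B) with r => keyE.
suff -> : (1 - r * b) * (1 + z * b) - 1 = z * b - r * (b * (z * b)) - r * b by [].
rewrite mulrBl mul1r mulrDr mulr1 [1 + _]addrC -!addrA opprD; congr (_ + _).
rewrite addrC -!addrA addNr addr0.
by rewrite addrC mulrA.
Qed.

(** Any functional on [f p] is a sum of products of an element of [H], an element that is radical
    modulo [H'], and an element of [H]: the outer factors come from tracedness of both modules, the
    middle one from [radical_jacobson]. The layer condition puts it in [H'], so [f] factors through
    the trace of [H']. *)
Lemma traced_cosemisimple : right_dual_basis H' -> cosemisimple (sub_in D D').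
Proof.
move=> db; apply/(cosemisimpleP cD) => X Y f rad.
have dQ : dual_basis (carrier cD Y) := proj_dual_basis (sval Y).
have [K [x [xi gen]]] : dual_basis (carrier cD X) := proj_dual_basis (sval X).
have [L [y [zt ygen]]] := dQ.
have tP : traced H (carrier cD X) := svalP X.
have tQ : traced H (carrier cD Y) := svalP Y.
have sub p : submod_set (trace_sub H' (carrier cD Y)) (f p).
  move=> zeta; rewrite [f p]ygen functional_sum; apply: ideal_sum => l.
  have -> : zt l (f p) = \sum_k (zt l (f (x k)) : B) * (xi k p : B) :> B.
    rewrite {1}(gen p) !linear_sum; apply: eq_bigr => k _; by rewrite !linearZ.
  rewrite mulr_sumr; apply: ideal_sum => k; rewrite mulrA; apply: layer => //.
  exact: radical_jacobson rad.
have [Z [D'Z eZ]] := traced_object (trace_sub_dual_basis db dQ) (trace_sub_traced idem' dQ).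
exists Z; rewrite eZ; exists (corestr sub), (incl _); split=> //.
Qed.

End TracedRejective.

Lemma zero_right_dual_basis (B : pzRingType) (H : ideal B) :
  H = [set 0] :> set B -> right_dual_basis H.
Proof.
move=> H0; exists void, (of_void B), (fun=> id); split=> [[]|[]|x].
by rewrite H0 => ->; rewrite big1 // => -[].
Qed.

Lemma zero_left_dual_basis (B : pzRingType) (H : ideal B) :
  H = [set 0] :> set B -> left_dual_basis H.
Proof.
move=> H0; exists void, (of_void B), (fun=> id); split=> [[]|[]|x].
by rewrite H0 => ->; rewrite big1 // => -[].
Qed.

Lemma set_mul_mem (B : pzRingType) (U V : set B) x y : U x -> V y -> set_mul U V (x * y).
Proof. by move=> Ux Vy; exists 1%N, (fun=> x), (fun=> y); split=> //; rewrite big_ord1. Qed.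

Lemma semisimple_layerE (B : pzRingType) (H : nat -> ideal B) i u v r :
  semisimple_layer H i -> subgroup_set (H i) u -> subgroup_set (H i) v ->
  jacobson (rquot (H i.+1)) (rproj (H i.+1) r) -> subgroup_set (H i.+1) (u * r * v).
Proof.
set p := rproj (H i.+1) => lay Hu Hv Jr.
have : set_mul (set_mul (ideal_quot (H i) (H i.+1)) (jacobson (rquot (H i.+1))))
    (ideal_quot (H i) (H i.+1)) (p u * p r * p v).
  by apply: set_mul_mem; [apply: set_mul_mem => //; exists u|exists v].
rewrite lay => e; rewrite -[u * r * v]subr0; apply/(zprojP (H i.+1)).
rewrite zproj0 -[RHS]e; rewrite [LHS]rprojM [X in rmul X _]rprojM //.
Qed.

Lemma strongly_quasi_hereditary_rejective_chain (B : pzRingType) :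
  (forall H : ideal B, ideal_fg H) ->
  strongly_quasi_hereditary B -> has_rejective_chain (proj B).
Proof.
move=> fgB [n [H [[[H0 Hn Hsub Hidem] _] [_ Hr] [_ Hl]]]].
exists n, (fun i => traced_subcat (proj_cat B) (H i)); split.
- by move=> P y xi; rewrite H0.
- move=> P; split=> [tP|P0].
    have [K [x [xi gen]]] := proj_dual_basis P.
    apply: (ap_ext (c := proj_cat B)) => y; rewrite ap_id ap0 /= [LHS]gen big1 // => k _.
    have := tP y (xi k); rewrite Hn => ->; exact: scale0r.
  exact: (sub_zero (traced_subcat (proj_cat B) (H n)) P0).
move=> i lin; have HH : H i.+1 `<=` H i by apply: properW; apply: Hsub.
have idem : idempotent_ideal (H i.+1) by apply: Hidem.
have lay u v r := semisimple_layerE (u := u) (v := v) (r := r) (Hr i lin).2.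
(* Projectivity is given only for indices below [n]; the last ideal is zero and has the empty dual
   basis. *)
have rdb : right_dual_basis (H i.+1).
  case: (ltngtP i.+1 n) lin => // [lt _|e _].
    by apply: right_projective_dual_basis => //; case: (Hr _ lt).
  by apply: zero_right_dual_basis; rewrite e.
have ldb : left_dual_basis (H i.+1).
  case: (ltngtP i.+1 n) lin => // [lt _|e _].
    by apply: left_projective_dual_basis => //; case: (Hl _ lt).
  by apply: zero_left_dual_basis; rewrite e.
split; first by move=> P; apply: traced_sub.
  exact: traced_cosemisimple.
by split; [exact: traced_right_rejective|exact: traced_left_rejective].
Qed.

(** * Projective modules over an endomorphism ring *)

Section DirectSumMaps.
Variables (S : pzRingType) (J : finType) (X : J -> lmodType S).

Definition dsum_inj_fun j (x : X j) : dsum X := dfwith (0 : dsum X) x.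

Lemma dsum_inj_linear j : linear (@dsum_inj_fun j).
Proof.
move=> a x y; apply: functional_extensionality_dep => i; rewrite /dsum_inj_fun.
have [<-|ne] := eqVneq j i; first by rewrite -[RHS]/(a *: dfwith (0 : dsum X) x j + dfwith (0 : dsum X) y j) !dfwith_in.
rewrite -[RHS]/(a *: dfwith (0 : dsum X) x i + dfwith (0 : dsum X) y i) !dfwith_out //.
by rewrite -[RHS]/(a *: (0 : X i) + 0) scaler0 addr0.
Qed.

Definition dsum_inj j : Hom (X j) (dsum X) := mkHom (@dsum_inj_linear j).

Lemma dsum_injK j : cancel (dsum_inj j) (dsum_proj X j).
Proof. by move=> x /=; rewrite /dsum_inj_fun dfwith_in. Qed.

Hypothesis hS : finite_length (S^o : lmodType S).

Lemma fg_dsum : (forall j, finitely_generated (X j)) -> finitely_generated (dsum X).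
Proof.
move=> Xfg; apply: finite_length_fg.
apply: (finite_length_joint_inj (f := fun i : 'I_#|J| => dsum_proj X (enum_val i))).
  by move=> i; apply: fg_finite_length.
move=> x x0; apply: functional_extensionality_dep => j.
by have := x0 (enum_rank j); rewrite enum_rankK.
Qed.

End DirectSumMaps.

Section HomModule.
Variables (S : pzRingType) (M : lmodType S).
Implicit Types N L : lmodType S.
Local Notation B := (Endo M).

Definition hmod N : Type := Hom M N.

Section Lmod.
Variable N : lmodType S.
HB.instance Definition _ := GRing.Zmodule.on (hmod N).
Definition hmod_scale (b : B^c) (f : hmod N) : hmod N := Hom_comp f (b : B).
Fact hmod_scaleA a b f : hmod_scale a (hmod_scale b f) = hmod_scale (a * b) f.
Proof. exact: Hom_ext. Qed.
Fact hmod_scale1 : left_id 1 hmod_scale.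
Proof. by move=> f; apply: Hom_ext. Qed.
Fact hmod_scaleDr : right_distributive hmod_scale +%R.
Proof. by move=> a f g; apply: Hom_ext. Qed.
Fact hmod_scaleDl f : {morph hmod_scale^~ f : a b / a + b}.
Proof. by move=> a b; apply: Hom_ext => x; apply: (linearD f). Qed.
HB.instance Definition _ := GRing.Zmodule_isLmodule.Build B^c (hmod N)
  hmod_scaleA hmod_scale1 hmod_scaleDr hmod_scaleDl.
End Lmod.

Lemma hmod_scaleE N (b : B) (f : hmod N) x : ((b : B^c) *: f : hmod N) x = f (b x).
Proof. by []. Qed.

Lemma hmod_sumE N (J : finType) (F : J -> hmod N) x : (\sum_j F j : hmod N) x = \sum_j F j x.
Proof. by elim/big_rec2: _ => // j u v _ <-. Qed.

Lemma hmap_linear N L (g : {linear N -> L}) : linear (fun f : hmod N => (Hom_comp g f : hmod L)).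
Proof.
by move=> a f f'; apply: Hom_ext => x; apply: (linearD g).
Qed.

Definition hmap N L (g : {linear N -> L}) : Hom (hmod N : rmodType B) (hmod L) :=
  mkHom (hmap_linear g).

Lemma hmapE N L (g : {linear N -> L}) f x : hmap g f x = g (f x).
Proof. by []. Qed.

(** The identity of [N] factors through a finite power of [M]: [N] belongs to add M. *)
Definition in_add N := exists (J : finType) (p : J -> {linear M -> N}) (q : J -> {linear N -> M}),
  forall x, x = \sum_j p j (q j x).

Lemma hmod_dual_basis N : in_add N -> dual_basis (hmod N : rmodType B).
Proof.
move=> [J [p [q pq]]].
have lin j : linear ((fun f : hmod N => Hom_comp (q j) f : B) : hmod N -> (B^c^o : rmodType B)).
  by move=> a f g; apply: Hom_ext => x; apply: (linearD (q j)).
exists J, p, (fun j => mkHom (lin j)) => f; apply: Hom_ext => x.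
by rewrite hmod_sumE [LHS]pq.
Qed.

(** The maps [p j] generate [Hom M N] over [B], so [F] is determined by its values there and is
    composition with the sum of the [F (p j)] after [q j]. *)
Lemma hmod_full N L (F : Hom (hmod N : rmodType B) (hmod L)) : in_add N ->
  exists g : {linear N -> L}, forall f, F f = hmap g f.
Proof.
move=> [J [p [q pq]]].
have lin : linear (fun x => \sum_j (F (p j) : hmod L) (q j x)).
  move=> a x y; rewrite scaler_sumr -big_split /=; apply: eq_bigr => j _.
  by rewrite !linearP.
exists (mkHom lin) => f; apply: Hom_ext => x.
have -> : f = \sum_j ((Hom_comp (q j) f : B) : B^c) *: (p j : hmod N).
  by apply: Hom_ext => z; rewrite hmod_sumE [LHS]pq.
rewrite linear_sum !hmod_sumE /=; apply: eq_bigr => j _.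
rewrite linearZ hmod_scaleE /=; congr ((F (p j) : hmod L) _).
rewrite hmod_sumE -[RHS]/(q j (\sum_i p i (q i (f x)))).
by rewrite -pq.
Qed.

Lemma hmod_faithful N L (g : {linear N -> L}) : in_add N ->
  (forall f x, g ((f : hmod N) x) = 0) -> forall x, g x = 0.
Proof.
by move=> [J [p [q pq]]] g0 x; rewrite (pq x) linear_sum big1 // => j _; apply: g0.
Qed.

Hypothesis hS : finite_length (S^o : lmodType S).

(** The matrix [e] is idempotent over [B], and [P] is its image on a free module. The same matrix
    acts on a power of [M]; its fixed vectors form [N], and maps from [M] to [N] are the fixed
    vectors with entries in [B]. *)
Lemma hmod_dense (P : rmodType B) : finitely_generated M -> dual_basis P ->
  exists N, finitely_generated N /\ isomorphic (hmod N : rmodType B) P.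
Proof.
move=> Mfg [J [x [xi gen]]].
pose T := dsum (fun _ : J => M).
pose e i j : B := xi i (x j).
pose Us : set T := [set m | forall i, m i = \sum_j (e i j : Hom M M) (m j)].
have U0 : Us 0 by move=> i; rewrite big1 // => j _; apply: (linear0 (e i j : Hom M M)).
have UL a m m' : Us m -> Us m' -> Us (a *: m + m').
  move=> Um Um' i; rewrite -[LHS]/(a *: m i + m' i) (Um i) (Um' i) scaler_sumr -big_split /=.
  by apply: eq_bigr => j _; apply: (esym (linearP (e i j : Hom M M) a (m j) (m' j))).
pose U : submod T := Submod U0 UL.
exists (submod_type U); split; first by apply/fg_submod/fg_dsum.
have xiE i p : xi i p = \sum_j e i j * (xi j p : B) :> B.
  by rewrite {1}(gen p) functional_sum.
have linF p : linear (fun m : M => (fun i => (xi i p : Hom M M) m) : T).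
  by move=> a m m'; apply: functional_extensionality_dep => i; apply: (linearP (xi i p : Hom M M)).
have FU p m : submod_set U (mkHom (linF p) m).
  move=> i; rewrite -[LHS]/((xi i p : Hom M M) m) xiE.
  exact: (hmod_sumE (N := M)).
have lin : linear (fun p : P => (corestr (FU p) : hmod (submod_type U))).
  move=> a p p'; apply: Hom_ext => m; apply: incl_inj.
  apply: functional_extensionality_dep => i.
  exact: (congr1 (fun h : Hom M M => h m) (linearP (xi i) a p p')).
apply: isomorphic_sym; exists (mkHom lin); apply: inj_surj_bij.
  apply: hom_inj0 => p p0; rewrite (gen p) big1 // => i _.
  suff -> : xi i p = 0 by apply: scale0r.
  apply: Hom_ext => m.
  have := congr1 (fun h : hmod (submod_type U) => (incl U (h m) : T) i) p0.
  by [].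
move=> f; pose fi i : B := Hom_comp (dsum_proj _ i) (Hom_comp (incl U) f).
exists (\sum_i (fi i : B^c) *: x i); apply: Hom_ext => m; apply: incl_inj.
apply: functional_extensionality_dep => i.
have -> : incl U (f m) i = \sum_j (e i j : Hom M M) ((fi j : Hom M M) m) by exact: (inclP (f m) i).
rewrite -[LHS]/((xi i (\sum_i (fi i : B^c) *: x i) : Hom M M) m) functional_sum.
exact: (hmod_sumE (N := M)).
Qed.

End HomModule.

Section ModuleClasses.
Variables (S : pzRingType) (M : lmodType S).
Hypothesis hS : finite_length (S^o : lmodType S).
Hypothesis Mfg : finitely_generated M.
Hypothesis Madd : forall N : lmodType S, finitely_generated N -> in_add M N.
Local Notation B := (Endo M).
Implicit Types N L U Y Z : lmodType S.

Lemma subcat_iso (D : subcategory (proj B)) (P Q : proj B) :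
  isomorphic (carrier (proj_cat B) P) (carrier (proj_cat B) Q) -> D P -> D Q.
Proof.
move=> /isomorphicP[f [g [fK gK]]]; apply: (@sub_iso _ D P Q (mk (proj_cat B) f)).
exists (mk (proj_cat B) g); split; apply: (ap_ext (c := proj_cat B)) => x.
  by rewrite ap_comp ap_id !mkK /= fK.
by rewrite ap_comp ap_id !mkK /= gK.
Qed.

Definition hobj N (fgN : finitely_generated N) : proj B :=
  proj_of (hmod_dual_basis (Madd fgN)).

(** The object [hobj] depends on a proof of finite generation, hence the existential; different
    proofs give isomorphic objects. *)
Definition in_class (D : subcategory (proj B)) N :=
  exists fgN : finitely_generated N, D (hobj fgN).

Lemma in_classP (D : subcategory (proj B)) N (P : proj B) : finitely_generated N ->
  isomorphic (hmod M N : rmodType B) (carrier (proj_cat B) P) -> D P -> in_class D N.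
Proof.
move=> fgN iso DP; exists fgN; apply: subcat_iso DP; exact: isomorphic_sym.
Qed.

Lemma in_class_object (D D' : subcategory (proj B)) (X : full D) : D' (sval X) ->
  exists N (f : {linear carrier (proj_cat B) (sval X) -> (hmod M N : rmodType B)})
    (g : {linear (hmod M N : rmodType B) -> carrier (proj_cat B) (sval X)}),
    [/\ in_class D' N, cancel f g & cancel g f].
Proof.
move=> D'X; have [N [fgN iso]] := hmod_dense hS Mfg (proj_dual_basis (sval X)).
have /isomorphicP[f [g [fK gK]]] := isomorphic_sym iso.
by exists N, f, g; split=> //; apply: in_classP iso D'X.
Qed.

Lemma hmap_inj N L (g h : {linear N -> L}) : finitely_generated N ->
  (forall f, hmap M g f = hmap M h f) -> forall x, g x = h x.
Proof.
move=> fgN gh x; apply/eqP; rewrite -subr_eq0; apply/eqP.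
apply: (hmod_faithful (g := HomD g (HomN h)) (Madd fgN)) => f y /=.
have /(congr1 (fun k : Hom M L => k y)) := gh f.
by rewrite !hmapE => ->; rewrite subrr.
Qed.

Lemma in_class_fg D N : in_class D N -> finitely_generated N. Proof. by case. Qed.

Lemma in_class_pair D N L : in_class D N -> in_class D L -> in_class D (N * L)%type.
Proof.
move=> [fgN DN] [fgL DL]; exists (fg_pair fgN fgL).
pose c := proj_cat B; pose n := hobj fgN; pose l := hobj fgL.
pose nl := hobj (fg_pair fgN fgL); apply: sub_sum DN DL.
exists (@mk _ _ c n nl (hmap M (pair_i1 L : {linear N -> (N * L)%type}))).
exists (@mk _ _ c l nl (hmap M (@pair_i2 _ N L : {linear L -> (N * L)%type}))).
exists (@mk _ _ c nl n (hmap M (fst : {linear (N * L)%type -> N}))).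
exists (@mk _ _ c nl l (hmap M (snd : {linear (N * L)%type -> L}))).
split; apply: (ap_ext (c := c)) => f; rewrite ?apD /= ?ap_comp ?ap_id ?ap0 ?mkK;
  apply: Hom_ext => x //.
by apply: (esym _); rewrite [LHS]surjective_pairing; congr pair; rewrite /= ?addr0 ?add0r.
Qed.

Section Layer.
Variables D D' : subcategory (proj B).
Hypothesis D'D : forall P, D' P -> D P.
Local Notation cD := (full_module_category D (proj_cat B)).

Lemma class_object N (DN : in_class D N) :
  exists X : full D, carrier cD X = (hmod M N : rmodType B) /\
    (in_class D' N -> D' (sval X)).
Proof.
case: DN => fgN DN; exists (exist _ (hobj fgN) DN); split=> // -[fgN' D'N].
apply: subcat_iso D'N; exists (Hom_id _); by exists id.
Qed.

(** Transport of the approximation of [hmod M N]: density supplies the module [N'], fullness the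
    maps, and faithfulness the identities between them. *)
Lemma class_right_approx N : right_rejective (sub_in D D') -> in_class D N ->
  exists N' (e : {linear N' -> N}),
  [/\ in_class D' N',
      forall Z (g : {linear Z -> N'}), in_class D Z -> (forall z, e (g z) = 0) ->
        forall z, g z = 0 &
      forall Y (h : {linear Y -> N}), in_class D' Y ->
        exists h' : {linear Y -> N'}, forall y, h y = e (h' y)].
Proof.
move=> rej DN; have [X [eX _]] := class_object DN.
have := right_rejective_approx X rej; move/(right_approxP cD).
case=> X'; rewrite eX => -[e [D'X' me le]].
have [N' [f [g [D'N' fK gK]]]] := in_class_object D'X'.
have fgN' := in_class_fg D'N'.
have [e' eE] := hmod_full (Hom_comp e g) (Madd fgN').
exists N', e'; split=> // [Z k DZ ek|Y h D'Y].
  have [Z' [eZ _]] := class_object DZ.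
  have := me Z' ; rewrite eZ => /(_ (Hom_comp g (hmap M k))) mk0.
  apply: (hmod_faithful (Madd (in_class_fg DZ))) => y x.
  have gk0 : g (hmap M k y) = 0.
    apply: (mk0 _ y) => z; rewrite [LHS](eE (hmap M k z)); apply: Hom_ext => w.
    by rewrite !hmapE ek.
  have : hmap M k y = 0 by rewrite -[LHS]gK gk0 linear0.
  by move=> /(congr1 (fun k : Hom M N' => k x)).
have fgY := in_class_fg D'Y; have DY : in_class D Y by case: D'Y => fg h'; exists fg; apply: D'D.
have [Y' [eY D'Y']] := class_object DY.
have := le Y'; rewrite eY => /(_ (hmap M h) (D'Y' D'Y))[h' hE].
have [k kE] := hmod_full (Hom_comp f h') (Madd fgY).
exists k; apply: (hmap_inj (h := Hom_comp e' k)) => // y.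
rewrite [LHS]hE -[h' y]fK -[f (h' y)]/(Hom_comp f h' y) kE.
rewrite [LHS](eE (hmap M k y)); exact: Hom_ext.
Qed.

Lemma class_left_approx N : left_rejective (sub_in D D') -> in_class D N ->
  exists N' (e : {linear N -> N'}),
  [/\ in_class D' N',
      forall Z (g : {linear N' -> Z}), in_class D Z -> (forall x, g (e x) = 0) ->
        forall x, g x = 0 &
      forall Y (h : {linear N -> Y}), in_class D' Y ->
        exists h' : {linear N' -> Y}, forall x, h x = h' (e x)].
Proof.
move=> rej DN; have [X [eX _]] := class_object DN.
have := left_rejective_approx X rej; move/(left_approxP cD).
case=> X'; rewrite eX => -[e [D'X' me le]].
have [N' [f [g [D'N' fK gK]]]] := in_class_object D'X'.
have fgN' := in_class_fg D'N'; have fgN := in_class_fg DN.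
have [e' eE] := hmod_full (Hom_comp f e) (Madd fgN).
exists N', e'; split=> // [Z k DZ ke|Y h D'Y].
  have [Z' [eZ _]] := class_object DZ.
  have := me Z' ; rewrite eZ => /(_ (Hom_comp (hmap M k) f)) mk0.
  apply: (hmod_faithful (Madd fgN')) => y x.
  have : hmap M k y = 0.
    rewrite -[y]gK; apply: (mk0 _ (g y)) => z.
    rewrite [LHS](congr1 (hmap M k) (eE z)); apply: Hom_ext => w.
    by rewrite !hmapE ke.
  by move=> /(congr1 (fun k : Hom M Z => k x)).
have DY : in_class D Y by case: D'Y => fg h'; exists fg; apply: D'D.
have [Y' [eY D'Y']] := class_object DY.
have := le Y'; rewrite eY => /(_ (hmap M h) (D'Y' D'Y))[h' hE].
have [k kE] := hmod_full (Hom_comp h' g) (Madd fgN').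
exists k; apply: (hmap_inj (h := Hom_comp k e')) => // y.
rewrite [LHS]hE -[e y]fK -[h' _]/(Hom_comp h' g (f (e y))) kE.
by rewrite [f (e y)](eE y); apply: Hom_ext.
Qed.

Lemma class_cosemisimple N L (f : {linear N -> L}) : cosemisimple (sub_in D D') ->
  in_class D N -> in_class D L ->
  (forall g : {linear L -> N}, bijective (fun x => x - g (f x))) ->
  exists Z (a : {linear N -> Z}) (b : {linear Z -> L}),
    in_class D' Z /\ forall x, f x = b (a x).
Proof.
move=> cs DN DL rad.
have [X [eX _]] := class_object DN; have [Y [eY _]] := class_object DL.
have fgN := in_class_fg DN; have fgL := in_class_fg DL.
have := (cosemisimpleP cD (sub_in D D')).1 cs X Y.
rewrite /radical_map /factors_thru eX eY => /(_ (hmap M f))[].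
  move=> G; have [g gE] := hmod_full G (Madd fgL).
  have [u [uK Ku]] : exists u : {linear N -> N},
      cancel (HomD (Hom_id N) (HomN (Hom_comp g f))) u /\
      cancel u (HomD (Hom_id N) (HomN (Hom_comp g f))).
    by apply: hom_inv; [apply: bij_inj|apply: bij_surj]; apply: rad.
  (* Here [1 - g f] is invertible outright, so both error terms are zero and factor through a zero
     object. *)
  have [Z Z0] := has_zero (full D); have D'Z := sub_zero (sub_in D D') Z0.
  exists (hmap M u); split; exists Z, (Hom0 _ _), (Hom0 _ _); split=> // y; apply: Hom_ext => x.
    rewrite -[LHS]/(u (y x - (G (hmap M f y) : Hom M N) x) - y x) gE.
    by rewrite [u _]uK subrr.
  rewrite -[LHS]/(u (y x) - (G (hmap M f (hmap M u y)) : Hom M N) x - y x) gE.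
  by rewrite [u (y x) - _]Ku subrr.
move=> Z [a [b [D'Z fE]]].
have [Z' [h [k [D'Z' hK kK]]]] := in_class_object (D' := D') D'Z.
have [a' aE] := hmod_full (Hom_comp h a) (Madd fgN).
have [b' bE] := hmod_full (Hom_comp b k) (Madd (in_class_fg D'Z')).
exists Z', a', b'; split=> //; apply: (hmap_inj (h := Hom_comp b' a')) => // y.
rewrite [LHS]fE -[a y]hK -[b (k _)]/(Hom_comp b k (h (a y))) bE.
by rewrite [h (a y)](aE y); apply: Hom_ext.
Qed.

End Layer.

End ModuleClasses.

(** * Classes closed under submodules and quotients *)

Section ClosedClass.
Variable S : pzRingType.
Implicit Types (C : lmodType S -> Prop) (N L U Q Y Z : lmodType S).

Definition closed_class C :=
  [/\ forall N, zero_module N -> C N,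
      forall U N (f : {linear U -> N}), injective f -> C N -> C U,
      forall N Q (f : {linear N -> Q}), surj f -> C N -> C Q &
      forall N L, C N -> C L -> C (N * L)%type].

Variable C : lmodType S -> Prop.
Hypothesis cC : closed_class C.

Lemma closed_zero N : zero_module N -> C N. Proof. by case: cC => h _ _ _; apply: h. Qed.
Lemma closed_inj U N (f : {linear U -> N}) : injective f -> C N -> C U.
Proof. by case: cC => _ h _ _; apply: h. Qed.
Lemma closed_surj N Q (f : {linear N -> Q}) : surj f -> C N -> C Q.
Proof. by case: cC => _ _ h _; apply: h. Qed.
Lemma closed_pair N L : C N -> C L -> C (N * L)%type.
Proof. by case: cC => _ _ _ h; apply: h. Qed.

Lemma closed_sub N (U : submod N) : C N -> C (submod_type U).
Proof. exact/closed_inj/incl_inj. Qed.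

Lemma closed_range N L (f : {linear N -> L}) : C N -> C (submod_type (submod_range f)).
Proof.
have fR x : submod_set (submod_range f) (f x) by exists x.
apply: (closed_surj (f := corestr fR)) => y; have [x _ xE] := inclP y.
by exists x; apply: incl_inj; rewrite corestrE.
Qed.

Lemma closed_subS N (U V : submod N) : U `<=` V -> C (submod_type V) -> C (submod_type U).
Proof.
move=> UV; have h x : submod_set V (incl U x) by apply: UV; apply: inclP.
apply: (closed_inj (f := corestr h)) => x y /(congr1 (incl V)).
by rewrite !corestrE => /incl_inj.
Qed.

Lemma closed_range_factor N L Z (h : {linear N -> L}) (a : {linear N -> Z})
    (b : {linear Z -> L}) : (forall x, h x = b (a x)) -> C Z ->
  C (submod_type (submod_range h)).
Proof.
move=> hE CZ; apply: closed_subS (closed_range b CZ) => _ [x _ <-].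
by exists (a x).
Qed.

Lemma closed_submodA N (U V : submod N) :
  C (submod_type U) -> C (submod_type V) -> C (submod_type (submodA U V)).
Proof.
move=> CU CV; have h (z : (submod_type U * submod_type V)%type) :
    submod_set (submodA U V) (copair (incl U) (incl V) z).
  by exists (incl U z.1), (incl V z.2); split=> //; apply: inclP.
apply: (closed_surj (f := corestr h)) (closed_pair CU CV) => y.
have [u [v [Uu Vv yE]]] := inclP y.
by exists (insubmod Uu, insubmod Vv); apply: incl_inj; rewrite corestrE yE.
Qed.

Lemma closed_cover U (J : finType) (Y : J -> lmodType S) (p : forall a, {linear Y a -> U}) :
  (forall a, C (submod_type (submod_range (p a)))) ->
  (forall x, exists y : forall a, Y a, x = \sum_a p a (y a)) -> C U.
Proof.
move=> Cp gen.
have [V [CV VP]] : exists V : submod U, C (submod_type V) /\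
    forall a, a \in enum J -> forall x, submod_set V (p a x).
  elim: (enum J) => [|a s [V [CV VP]]].
    exists (submod0m U); split=> //; apply: closed_zero => x; apply: incl_inj.
    by rewrite linear0; apply: (inclP x).
  exists (submodA (submod_range (p a)) V); split; first exact: closed_submodA.
  move=> b; rewrite inE => /orP[/eqP ->|bs] x.
    exists (p a x), 0; rewrite addr0; split=> //; [by exists x|exact: submod0].
  by exists 0, (p b x); rewrite add0r; split=> //; [exact: submod0|exact: VP].
have VT x : submod_set V (Hom_id U x).
  have [y {1}->] := gen x; apply: submod_sum => a; apply: VP.
  by rewrite mem_enum.
by apply: (closed_inj (f := corestr VT)) => // x y /(congr1 (incl V)).
Qed.

(** Intersect the kernels one at a time: the quotient by an intersection embeds in the product of
    the quotients. *)
Lemma closed_joint U (J : finType) (Y : J -> lmodType S) (q : forall a, {linear U -> Y a}) :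
  (forall a, C (submod_type (submod_range (q a)))) ->
  (forall x, (forall a, q a x = 0) -> x = 0) -> C U.
Proof.
move=> Cq inj.
have [V [CV VP]] : exists V : submod U, C (mquot V) /\
    forall a, a \in enum J -> forall x, submod_set V x -> q a x = 0.
  elim: (enum J) => [|a s [V [CV VP]]].
    exists (submodT U); split=> //; apply: closed_zero => x.
    by have [y <-] := mproj_surj x; apply/mproj_eq0.
  exists (submodI V (submod_ker (q a))); split; last first.
    by move=> b; rewrite inE => /orP[/eqP ->|bs] x [Vx qx]; [exact: qx|exact: VP Vx].
  have qR x : submod_set (submod_range (q a)) (q a x) by exists x.
  pose f := pairing (mproj V) (corestr qR).
  have f0 x : submod_set (submodI V (submod_ker (q a))) x -> f x = 0.
    move=> [Vx qx]; congr pair; first by apply/mproj_eq0.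
    by apply: incl_inj; rewrite linear0.
  apply: (closed_inj (f := mfactor f0)) (closed_pair CV (Cq a)).
  apply: hom_inj0 => y; have [x <-] := mproj_surj y; rewrite mfactorE => e.
  apply/mproj_eq0; split; first by apply/mproj_eq0; apply: (congr1 fst e).
  exact: (congr1 (fun z => incl _ z.2) e).
apply: (closed_inj (f := mproj V)) CV; apply: hom_inj0 => x /mproj_eq0 Vx.
by apply: inj => a; apply: VP Vx; rewrite mem_enum.
Qed.

End ClosedClass.

(** * From rejective chains to uniserial modules *)

Section UniserialFromChain.
Variable S : pzRingType.
Variables (C : nat -> lmodType S -> Prop) (n : nat).
Hypothesis C0 : forall N, finitely_generated N -> C 0%N N.
Hypothesis Cn : forall N, C n N -> zero_module N.
Hypothesis cC : forall i, (i <= n)%N -> closed_class (C i).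
Hypothesis Clayer : forall i N, (i < n)%N -> indecomposable N -> C i N -> ~ C i.+1 N ->
  (forall (U : lmodType S) (f : {linear U -> N}), injective f -> ~ surj f -> C i.+1 U) /\
  (forall (Q : lmodType S) (f : {linear N -> Q}), surj f -> ~ injective f -> C i.+1 Q).

(* Let N lie in C i but not in C i.+1.  If nonzero submodules U, V met in 0, then
   N would embed into N/U x N/V; if proper submodules U, V had sum N, then N
   would be a quotient of U x V.  Hence U + V is proper and indecomposable. *)
Lemma chain_uniserial (N : lmodType S) : finitely_generated N -> indecomposable N -> uniserial N.
Proof.
move=> fgN Ni; have := C0 fgN; rewrite -{1}(subnn n); have : (n <= n)%N by [].
(* Induction on the distance [k] to the end of the chain: [N] lies in [C (n - k)], and only zero
   modules lie in [C n]. *)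
elim: {1 4}n N {fgN} Ni => [|k IHk] N Ni lekn.
  by rewrite subn0 => /Cn Nz; case: Ni => /(_ Nz).
set i := (n - k.+1)%N => CiN.
have Ei : (n - k)%N = i.+1 by rewrite -subSn // subSS.
have lin : (i < n)%N by rewrite -Ei leq_subr.
have IH L : indecomposable L -> C i.+1 L -> uniserial L.
  by move=> Li; rewrite -Ei; apply: IHk => //; apply: ltnW.
have [/(IH _ Ni)//|nC] := pselect (C i.+1 N).
have [Csub Cquo] := Clayer lin Ni CiN nC.
have c1 : closed_class (C i.+1) by apply: cC.
have meet (U V : submod N) : (forall x, submod_set U x -> submod_set V x -> x = 0) ->
    (forall x, submod_set U x -> x = 0) \/ (forall x, submod_set V x -> x = 0).
  move=> UV0; apply: contrapT => /not_orP[nU nV]; apply: nC.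
  have CQ (W : submod N) : ~ (forall x, submod_set W x -> x = 0) -> C i.+1 (mquot W).
    move=> nW; apply: (Cquo _ (mproj W)); first exact: mproj_surj.
    by move=> inj; apply: nW => x /mproj_eq0 x0; apply: inj; rewrite x0 linear0.
  apply: (closed_inj c1 (f := pairing (mproj U) (mproj V))) (closed_pair c1 (CQ _ nU) (CQ _ nV)).
  by apply: hom_inj0 => x [/mproj_eq0 Ux /mproj_eq0 Vx]; apply: UV0.
have proper (W : submod N) : (W : set N) <> setT -> C i.+1 (submod_type W).
  move=> WT; apply: (Csub _ (incl W)); first exact: incl_inj.
  move=> sj; apply: WT; apply/seteqP; split=> // x _; have [y <-] := sj x.
  exact: inclP.
move=> U V.
have [UT|nUT] := pselect ((U : set N) = setT); first by right; rewrite UT.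
have [VT|nVT] := pselect ((V : set N) = setT); first by left; rewrite VT.
pose W := submodA U V.
have nWT : (W : set N) <> setT.
  move=> WT; apply: nC; apply: (closed_surj c1 (f := copair (incl U) (incl V))).
    move=> x; have : (W : set N) x by rewrite WT.
    by case=> u [v [Uu Vv ->]]; exists (insubmod Uu, insubmod Vv).
  by apply: closed_pair => //; apply: proper.
have UW : U `<=` W.
  by move=> x Ux; exists x, 0; rewrite addr0; split=> //; apply: submod0.
have VW : V `<=` W.
  by move=> x Vx; exists 0, x; rewrite add0r; split=> //; apply: submod0.
have [Wz|Wnz] := pselect (zero_module (submod_type W)).
  left=> x Ux; have x0 : x = 0 := congr1 (incl W) (Wz (insubmod (UW _ Ux))).
  by rewrite x0; apply: submod0.
(* The two summands of a decomposition of [W] would be submodules of [N] meeting in 0, so [meet]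
   makes one of them vanish. *)
have Wi : indecomposable (submod_type W).
  split=> // Y Z /isomorphicP[f [g [fK gK]]].
  pose gY : Hom Y N := Hom_comp (incl W) (Hom_comp g (@pair_i1 _ Y Z : {linear _ -> _})).
  pose gZ : Hom Z N := Hom_comp (incl W) (Hom_comp g (@pair_i2 _ Y Z : {linear _ -> _})).
  have [|hY|hZ] := meet (submod_range gY) (submod_range gZ).
  - move=> _ [y _ <-] [z _ /incl_inj /(can_inj gK)[<- _]].
    by rewrite linear0.
  - left=> y; have /= := hY (gY y); rewrite -(linear0 (incl W)) => h.
    have /incl_inj := h (ex_intro2 _ _ y I erefl).
    by rewrite -(linear0 g) => /(can_inj gK)[].
  - right=> z; have /= := hZ (gZ z); rewrite -(linear0 (incl W)) => h.
    have /incl_inj := h (ex_intro2 _ _ z I erefl).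
    by rewrite -(linear0 g) => /(can_inj gK)[].
have Wu := IH _ Wi (proper _ nWT).
case: (Wu (submod_preim (incl W) U) (submod_preim (incl W) V)) => h; [left|right].
  by move=> x Ux; apply: (h (insubmod (UW _ Ux))).
by move=> x Vx; apply: (h (insubmod (VW _ Vx))).
Qed.

End UniserialFromChain.

(** By locality either [g h] or [1 - g h] is bijective. In the first case [h] is a split injection
    into an indecomposable module, hence bijective. *)
Lemma indecomposable_radical (S : pzRingType) (Y Z : lmodType S) (h : {linear Y -> Z})
    (g : {linear Z -> Y}) : finite_length Y -> indecomposable Y -> indecomposable Z ->
  ~ bijective h -> bijective (fun x => x - g (h x)).
Proof.
move=> flY Yi Zi nh.
have [||b] := endo_local (f := Hom_comp g h : Endo Y)
  (g := HomD (Hom_id Y) (HomN (Hom_comp g h)) : Endo Y) flY Yi.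
- by move=> x /=; rewrite addrC subrK.
- move=> b; case: nh.
  have [v [ghK vK]] := hom_inv (bij_inj b) (bij_surj b).
  have hK : cancel h (Hom_comp v g) by move=> x; apply: ghK.
  exists (Hom_comp v g) => //; apply: indecomposable_split Zi _ hK.
  by case: Yi.
- exact: b.
Qed.

Section RejectiveChainUniserial.
Variables (S : pzRingType) (I : finType) (X : I -> lmodType S).
Hypothesis hS : finite_length (S^o : lmodType S).
Hypothesis Xfg : forall i, finitely_generated (X i).
Hypothesis Xind : forall i, indecomposable (X i).
Hypothesis Xall : forall N : lmodType S, finitely_generated N -> indecomposable N ->
  exists i, isomorphic N (X i).

Lemma dsum_in_add (N : lmodType S) : finitely_generated N -> in_add (dsum X) N.
Proof.
move=> /(decomposition_exists hS Xall)[J [k [p [q [_ pq]]]]].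
exists J, (fun a => Hom_comp (p a) (dsum_proj X (k a))), (fun a => Hom_comp (dsum_inj X (k a)) (q a)).
by move=> x; rewrite [LHS]pq; apply: eq_bigr => a _; rewrite /= [dsum_inj_fun _ _]dsum_injK.
Qed.

Lemma rejective_chain_uniserial : has_rejective_chain (proj (Endo (dsum X))) ->
  forall N : lmodType S, finitely_generated N -> indecomposable N -> uniserial N.
Proof.
move=> [n [D [D0 Dn Dchain]]].
have Mfg := fg_dsum hS Xfg.
pose C i N := in_class dsum_in_add (D i) N.
have Cfg i N : C i N -> finitely_generated N by apply: in_class_fg.
have C0 N : finitely_generated N -> C 0%N N by move=> fgN; exists fgN; apply: D0.
have Cz i N : zero_module N -> C i N.
  move=> Nz; have fgN : finitely_generated N.
    by exists 0%N, (fun=> 0) => x; exists (fun=> 0); rewrite big_ord0; apply: Nz.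
  exists fgN; apply: sub_zero; apply: (ap_ext (c := proj_cat _)) => f.
  by rewrite ap_id ap0; apply: Hom_ext => x; exact: Nz.
have Cn N : C n N -> zero_module N.
  move=> [fgN /Dn Z0] x.
  have [J [p [q pq]]] := dsum_in_add fgN; rewrite (pq x) big1 // => j _.
  pose P := hobj dsum_in_add fgN.
  pose pj : carrier (proj_cat _) P := p j.
  have : ap (proj_cat _) (idm P) pj = ap (proj_cat _) 0 pj by rewrite Z0.
  rewrite ap_id ap0 => e; exact: (congr1 (fun h : Hom (dsum X) N => h (q j x)) e).
have cC i : (i <= n)%N -> closed_class (C i).
  elim: i => [_|i IHi lin].
    split; first exact: Cz.
    - by move=> U N f fI /Cfg fgN; apply: C0; apply: fg_inj fI fgN.
    - by move=> N Q f fS /Cfg fgN; apply: C0; apply: fg_surj fS fgN.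
    - by move=> N L CN CL; apply: in_class_pair.
  have ci := IHi (ltnW lin); have [DD cs [rr lr]] := Dchain i lin.
  have CC N : C i.+1 N -> C i N by move=> [fgN DN]; exists fgN; apply: DD.
  split; first exact: Cz.
  - move=> U N f fI CN.
    have CiU : C i U by apply: (closed_inj ci fI); apply: CC.
    (* The injection [f] factors through the left approximation [e], so [e] is injective. Its
       cokernel is a quotient of [U'], so it lies in [C i] and may be used to test that [e] is epi;
       thus [e] is onto and [U] is isomorphic to [U']. *)
    have [U' [e [CU' me le]]] := class_left_approx hS Mfg DD lr CiU.
    have [h hE] := le _ f CN.
    have eI : injective e by move=> x y exy; apply: fI; rewrite !hE exy.
    have eS : surj e.
      move=> y; have : mproj (submod_range e) y = 0.
        apply: (me _ (mproj (submod_range e))).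
          by apply: (closed_surj ci (mproj_surj (U := _))); apply: CC.
        by move=> x; apply/mproj_eq0; exists x.
      by move=> /mproj_eq0[x _ <-]; exists x.
    have [g [_ gK]] := hom_inv eI eS.
    case: CU' => fgU' DU'; apply: (in_classP dsum_in_add (Cfg _ _ CiU) _ DU').
    apply/isomorphicP; exists (hmap _ e), (hmap _ g); split=> y; apply: Hom_ext => x.
      by rewrite !hmapE; apply: eI; rewrite gK.
    by rewrite !hmapE gK.
  - move=> N Q f fS CN.
    have CiQ : C i Q by apply: (closed_surj ci fS); apply: CC.
    (* Dually [e] is onto because [f] factors through it, and its kernel, a submodule of [Q'], lies
       in [C i] and is a test object for [e] being mono. *)
    have [Q' [e [CQ' me le]]] := class_right_approx hS Mfg DD rr CiQ.
    have [h hE] := le _ f CN.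
    have eS : surj e by move=> y; have [x <-] := fS y; exists (h x); rewrite hE.
    have eI : injective e.
      apply: hom_inj0 => x ex0.
      have ker0 z : incl (submod_ker e) z = 0.
        apply: (me _ (incl (submod_ker e))).
          by apply: (closed_sub ci); apply: CC.
        by move=> w; apply: (inclP w).
      exact: (ker0 (insubmod (ex0 : submod_set (submod_ker e) x))).
    have [g [_ gK]] := hom_inv eI eS.
    case: CQ' => fgQ' DQ'; apply: (in_classP dsum_in_add (Cfg _ _ CiQ) _ DQ').
    apply/isomorphicP; exists (hmap _ g), (hmap _ e); split=> y; apply: Hom_ext => x.
      by rewrite !hmapE gK.
    by rewrite !hmapE; apply: eI; rewrite gK.
  - by move=> N L CN CL; apply: in_class_pair.
apply: (chain_uniserial C0 Cn cC) => i N lin Ni CiN nC.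
have [DD cs _] := Dchain i lin; have ci := cC i (ltnW lin); have c1 := cC i.+1 lin.
(* A non-isomorphism of indecomposables is radical, so cosemisimplicity makes it factor through
   [C i.+1], which is closed. *)
have fact (Y Z : lmodType S) (h : {linear Y -> Z}) : indecomposable Y -> indecomposable Z ->
    C i Y -> C i Z -> ~ bijective h -> C i.+1 (submod_type (submod_range h)).
  move=> Yi Zi CY CZ nh; have flY := fg_finite_length hS (Cfg _ _ CY).
  have [T [a [b [CT hE]]]] := class_cosemisimple hS Mfg cs CY CZ
    (fun g => indecomposable_radical g flY Yi Zi nh).
  exact: closed_range_factor hE CT.
split=> [U f fI nfS|Q f fS nfI].
  have CU := closed_inj ci fI CiN.
  (* [U] itself may be decomposable, so [fact] is applied to each indecomposable summand; its map to
     [N] is not onto because [f] is not. *)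
  have [J [k [p [q [pK pq]]]]] := decomposition_exists hS Xall (Cfg _ _ CU).
  apply: (closed_cover c1 (p := p)); last by move=> x; exists (fun a => q a x).
  move=> a.
  have Ck : C i (X (k a)) by apply: (closed_inj ci (can_inj (pK a))) CU.
  have nb : ~ bijective (Hom_comp f (p a)).
    by move=> /bij_surj s; apply: nfS => y; have [x <-] := s y; exists (p a x).
  have := fact _ _ _ (Xind _) Ni Ck CiN nb.
  have fR (x : submod_type (submod_range (p a))) :
      submod_set (submod_range (Hom_comp f (p a))) (Hom_comp f (incl _) x).
    by have [y _ yE] := inclP x; exists y => //; exact: (congr1 f yE).
  apply: (closed_inj c1 (f := corestr fR)) => x y /(congr1 (incl _)).
  by rewrite !corestrE => /fI /incl_inj.
have CQ := closed_surj ci fS CiN.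
have [J [k [p [q [pK pq]]]]] := decomposition_exists hS Xall (Cfg _ _ CQ).
apply: (closed_joint c1 (q := q)); last first.
  by move=> x qx; rewrite (pq x) big1 // => a _; rewrite qx linear0.
move=> a.
have Ck : C i (X (k a)) by apply: (closed_inj ci (can_inj (pK a))) CQ.
have nb : ~ bijective (Hom_comp (q a) f).
  by move=> /bij_inj inj; apply: nfI => x y fxy; apply: inj; rewrite /= fxy.
have := fact _ _ _ Ni (Xind _) CiN Ck nb; apply: (closed_subS c1).
by move=> _ [y _ <-]; have [x <-] := fS y; exists x.
Qed.

End RejectiveChainUniserial.

(** * The ideal of endomorphisms with image in a closed class *)

Section ClassIdeal.
Variables (S : pzRingType) (M : lmodType S) (C : lmodType S -> Prop).
Hypothesis hS : finite_length (S^o : lmodType S).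
Hypothesis Mfg : finitely_generated M.
Hypothesis Madd : forall N : lmodType S, finitely_generated N -> in_add M N.
Hypothesis cC : closed_class C.
Local Notation B := (Endo M).

Definition class_set : set B :=
  [set f | C (submod_type (submod_range (f : Hom M M)))].

Lemma class_factor (f : B) (Z : lmodType S) (a : {linear M -> Z}) (b : {linear Z -> M}) :
  (forall x, f x = b (a x)) -> C Z -> class_set f.
Proof. exact: closed_range_factor. Qed.

Lemma class_set0 : class_set 0.
Proof.
apply: (closed_zero cC) => y; apply: incl_inj; rewrite linear0.
by have [x _ <-] := inclP y.
Qed.

Lemma class_setB (f g : B) : class_set f -> class_set g -> class_set (f - g).
Proof.
move=> Cf Cg; apply: closed_subS (closed_submodA cC Cf Cg) => // _ [x _ <-].
exists (f x), (- g x); split=> //; first by exists x.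
by apply: submodN; exists x.
Qed.

Lemma class_setMl (b f : B) : class_set f -> class_set (b * f).
Proof.
move=> Cf; have fR x : submod_set (submod_range (f : Hom M M)) (f x) by exists x.
exact: (class_factor (a := corestr fR) (b := Hom_comp b (incl _))) Cf.
Qed.

Lemma class_setMr (b f : B) : class_set f -> class_set (f * b).
Proof.
move=> Cf; have fR x : submod_set (submod_range (f : Hom M M)) ((f * b : Hom M M) x) by exists (b x).
exact: (class_factor (a := corestr fR) (b := incl _)) Cf.
Qed.

Definition class_ideal : ideal B :=
  @Ideal B (Subgroup class_set0 class_setB) class_setMl class_setMr.

(** Choose [U] of greatest length in the class. For any other [V] in the class the sum with [U] is
    again in the class and not longer, so it equals [U]. *)
Lemma max_class_submod : exists U : submod M, C (submod_type U) /\
  forall V : submod M, C (submod_type V) -> V `<=` U.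
Proof.
have flM := fg_finite_length hS Mfg.
have fl (U : submod M) : finite_length (submod_type U).
  exact: finite_length_inj (@incl_inj _ _ U) flM.
have ex : exists l, `[< exists2 U : submod M, C (submod_type U) & len (submod_type U) = l >].
  exists (len (submod_type (submod0m M))); apply/asboolP; exists (submod0m M) => //.
  by apply: (closed_zero cC) => x; apply: incl_inj; apply: (inclP x).
have bd l : `[< exists2 U : submod M, C (submod_type U) & len (submod_type U) = l >] ->
    (l <= len M)%N.
  by move=> /asboolP[U _ <-]; apply: len_inj (@incl_inj _ _ U) flM.
have [l /asboolP[U CU Ul] lmax] := ex_maxnP ex bd.
exists U; split=> // V CV x Vx; pose W := submodA U V.
have CW : C (submod_type W) by apply: closed_submodA.
have UW (u : submod_type U) : submod_set W (incl U u).
  by exists (incl U u), 0; rewrite addr0; split=> //; [exact: inclP|exact: submod0].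
have inj : injective (corestr UW).
  by move=> u v /(congr1 (incl W)); rewrite !corestrE => /incl_inj.
have le : (len (submod_type W) <= len (submod_type U))%N.
  by rewrite Ul; apply: lmax; apply/asboolP; exists W.
have Wx : submod_set W x by exists 0, x; rewrite add0r; split=> //; apply: submod0.
have [u uE] := len_inj_eq inj (fl W) le (insubmod Wx).
have <- : incl U u = x := congr1 (incl W) uE.
exact: inclP.
Qed.

(** Dual argument: choose [U] with the longest quotient in the class; cutting it down by [V] keeps
    the quotient in the class. *)
Lemma min_class_submod : exists U : submod M, C (mquot U) /\
  forall V : submod M, C (mquot V) -> U `<=` V.
Proof.
have flM := fg_finite_length hS Mfg.
have fl (U : submod M) : finite_length (mquot U).
  exact: finite_length_surj (@mproj_surj _ _ U) flM.
have ex : exists l, `[< exists2 U : submod M, C (mquot U) & len (mquot U) = l >].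
  exists (len (mquot (submodT M))); apply/asboolP; exists (submodT M) => //.
  by apply: (closed_zero cC) => x; have [y <-] := mproj_surj x; apply/mproj_eq0.
have bd l : `[< exists2 U : submod M, C (mquot U) & len (mquot U) = l >] -> (l <= len M)%N.
  by move=> /asboolP[U _ <-]; apply: len_surj (@mproj_surj _ _ U) flM.
have [l /asboolP[U CU Ul] lmax] := ex_maxnP ex bd.
exists U; split=> // V CV x Ux; pose W := submodI U V.
have f0 z : submod_set W z -> pairing (mproj U) (mproj V) z = 0.
  by move=> [/mproj_eq0 Uz /mproj_eq0 Vz]; congr pair.
have CW : C (mquot W).
  apply: (closed_inj cC (f := mfactor f0)) (closed_pair cC CU CV).
  apply: hom_inj0 => y; have [z <-] := mproj_surj y; rewrite mfactorE => e.
  by apply/mproj_eq0; split; apply/mproj_eq0; [apply: (congr1 fst e)|apply: (congr1 snd e)].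
have g0 z : submod_set W z -> mproj U z = 0 by move=> [Uz _]; apply/mproj_eq0.
have sj : surj (mfactor g0).
  by move=> y; have [z <-] := mproj_surj y; exists (mproj W z); rewrite mfactorE.
have le : (len (mquot W) <= len (mquot U))%N.
  by rewrite Ul; apply: lmax; apply/asboolP; exists W.
have inj := len_surj_eq sj (fl W) le.
have : mproj W x = 0 by apply: inj; rewrite mfactorE linear0; apply/mproj_eq0.
by move=> /mproj_eq0[].
Qed.

(** The ideal consists of the maps landing in the largest submodule [U], and writing [U] in add M
    gives the basis. The last clause, that coefficients lie in the ideal again, yields
    idempotence. *)
Lemma class_right_dual_basis : exists (J : finType) (h : J -> B) (phi : J -> B -> B),
  [/\ forall j, class_set (h j),
      forall j x b y, class_set x -> class_set y -> phi j (x * b + y) = phi j x * b + phi j y,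
      forall x, class_set x -> x = \sum_j h j * phi j x &
      forall j x, class_set x -> class_set (phi j x)].
Proof.
have [U [CU Umax]] := max_class_submod.
have [J [p [q pq]]] := Madd (fg_submod hS U Mfg).
have HU (f : B) x : class_set f -> submod_set U (f x).
  by move=> Cf; apply: Umax Cf _ _; exists x.
pose phi j (f : B) : B := if pselect (forall x, submod_set U ((f : Hom M M) x)) is left h
  then Hom_comp (q j) (corestr h) else 0.
have phiE j f x : class_set f -> phi j f x = q j (extend_sub U (f x)).
  move=> Cf; rewrite /phi; case: pselect => [h|[y]]; last exact: HU.
  congr (q j _); apply: incl_inj; rewrite extend_subK //.
exists J, (fun j => Hom_comp (incl U) (p j)), phi; split.
- by move=> j; apply: (class_factor (a := p j) (b := incl U)).
- move=> j f b g Cf Cg; apply: Hom_ext => x.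
  have Cfb : class_set (f * b + g).
    by rewrite -[g]opprK; apply: class_setB; [exact: class_setMr|
      rewrite -sub0r; apply: class_setB => //; exact: class_set0].
  rewrite phiE // -[RHS]/(phi j f (b x) + phi j g x) !phiE // -linearD; congr (q j _).
  have := extend_subL (U := U) 1 (HU f (b x) Cf) (HU g x Cg).
  by rewrite !scale1r.
- move=> f Cf; apply: Hom_ext => x; rewrite [RHS](hmod_sumE (N := M)).
  have {1}<- : incl U (extend_sub U (f x)) = f x by apply/extend_subK/HU.
  rewrite [in LHS](pq (extend_sub U (f x))) linear_sum; apply: eq_bigr => j _.
  by rewrite -[RHS]/(incl U (p j (phi j f x))) phiE.
- move=> j f Cf; rewrite /phi; case: pselect => [h|_]; last exact: class_set0.
  exact: (class_factor (a := corestr h) (b := q j)).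
Qed.

(** The ideal consists of the maps vanishing on the smallest [U], because the quotient by the kernel
    of such a map embeds in its image. Writing the quotient by [U] in add M gives the basis. *)
Lemma class_left_dual_basis : left_dual_basis class_ideal.
Proof.
have [U [CU Umin]] := min_class_submod.
have [J [p [q pq]]] := Madd (fg_mquot U Mfg).
have HU (f : B) x : class_set f -> submod_set U x -> f x = 0.
  move=> Cf Ux; suff : C (mquot (submod_ker (f : Hom M M))) by move=> /Umin/(_ _ Ux).
  have fR y : submod_set (submod_range (f : Hom M M)) (f y) by exists y.
  have k0 y : submod_set (submod_ker (f : Hom M M)) y -> corestr fR y = 0.
    by move=> fy; apply: incl_inj; rewrite corestrE linear0.
  apply: (closed_inj cC (f := mfactor k0)) Cf; apply: hom_inj0 => y.
  have [z <-] := mproj_surj y; rewrite mfactorE => /(congr1 (incl _)) e.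
  by apply/mproj_eq0.
pose phi j (f : B) : B := if pselect (forall x, submod_set U x -> (f : Hom M M) x = 0) is left h
  then Hom_comp (mfactor h) (p j) else 0.
have phiE j f x : class_set f -> phi j f x = f (zrepr (p j x)).
  by move=> Cf; rewrite /phi; case: pselect => // -[] y; apply: HU.
exists J, (fun j => Hom_comp (q j) (mproj U)), phi; split.
- by move=> j; apply: (class_factor (a := mproj U) (b := q j)).
- move=> j f b g Cf Cg; apply: Hom_ext => x.
  have Cfb : class_set (b * f + g).
    by rewrite -[g]opprK; apply: class_setB; [exact: class_setMl|
      rewrite -sub0r; apply: class_setB => //; exact: class_set0].
  by rewrite phiE // -[RHS]/(b (phi j f x) + phi j g x) !phiE.
- move=> f Cf; apply: Hom_ext => x; rewrite [RHS](hmod_sumE (N := M)).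
  have fU := fun z => HU f z Cf.
  rewrite -[LHS](mfactorE fU) (pq (mproj U x)) linear_sum; apply: eq_bigr => j _.
  by rewrite -[RHS]/(phi j f (q j (mproj U x))) phiE.
Qed.

Lemma class_ideal_right_dual_basis : right_dual_basis class_ideal.
Proof. by have [J [h [phi [? ? ? _]]]] := class_right_dual_basis; exists J, h, phi. Qed.

Lemma class_ideal_idempotent : idempotent_ideal class_ideal.
Proof.
apply/seteqP; split=> [_ [n [x [y [Hx _ ->]]]]|f Cf].
  by apply: ideal_sum => i; apply: idealMr.
have [J [h [phi [Ch _ fE Cphi]]]] := class_right_dual_basis.
exists #|J|, (h \o enum_val), (fun i => phi (enum_val i) f); split.
- by move=> i; apply: Ch.
- by move=> i; apply: Cphi.
- by rewrite {1}(fE f Cf) sum_enum_val.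
Qed.

End ClassIdeal.

(** Since [phi j (u * v) = phi j u * v] and [H'] is idempotent, the functionals map [H'] into itself
    and descend to the quotient. *)
Lemma right_dual_basis_quot (B : pzRingType) (H H' : ideal B) : H' `<=` H ->
  idempotent_ideal H' -> right_dual_basis H -> right_dual_basis (ideal_quot H H').
Proof.
move=> HH' idem [J [h [phi [Hh phiL hE]]]].
have phi' j x : subgroup_set H' x -> subgroup_set H' (phi j x).
  move=> /(idempotent_idealP idem)[n [u [v [Hu Hv ->]]]].
  rewrite (right_map_sum _ (phiL j)); last by move=> i; apply: HH'.
  by apply: ideal_sum => i; apply: idealMl.
have phiQ j x y : subgroup_set H x -> subgroup_set H y ->
    rproj H' x = rproj H' y -> rproj H' (phi j x) = rproj H' (phi j y).
  move=> Hx Hy /(zprojP H') xy; apply/(zprojP H').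
  suff -> : phi j x - phi j y = phi j (x - y) by apply: phi'.
  have := phiL j y (- 1) x Hy Hx.
  by rewrite !mulrN1 ![- _ + _]addrC => ->.
have /choice[rep repP] : forall u : rquot H', exists x,
    subgroup_set (ideal_quot H H') u -> subgroup_set H x /\ rproj H' x = u.
  move=> u; have [[x Hx xE]|nu] := pselect (subgroup_set (ideal_quot H H') u).
    by exists x.
  by exists 0 => /nu.
exists J, (fun j => rproj H' (h j)), (fun j u => rproj H' (phi j (rep u))); split.
- by move=> j; exists (h j).
- move=> j u b v Hu Hv.
  have [Hru ru] := repP _ Hu; have [Hrv rv] := repP _ Hv.
  have bE : rproj H' (zrepr b) = b by apply: zreprK.
  have Huv : subgroup_set (ideal_quot H H') (u * b + v).
    by apply: subgroupD => //; apply: idealMr.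
  have [Hr rE] := repP _ Huv.
  rewrite (phiQ j _ (rep u * zrepr b + rep v) Hr).
  + rewrite phiL // -[in RHS]bE [LHS](zprojD H'); congr (_ + _); exact: rprojM.
  + by apply: subgroupD => //; apply: idealMr.
  + rewrite rE [RHS](zprojD H') -{1}bE -{1}ru -{1}rv; congr (_ + _).
    exact: (esym (rprojM H' _ _)).
- move=> u Hu; have [Hr rE] := repP _ Hu; rewrite -{1}rE {1}(hE _ Hr).
  rewrite [LHS](big_morph _ (zprojD H') (zproj0 H')); apply: eq_bigr => j _.
  exact: rprojM.
Qed.

(** * The chain of a Nakayama algebra *)

Section UniserialFamilies.
Variables (S : pzRingType) (M : lmodType S).
Hypothesis Mu : uniserial M.
Hypothesis Mnz : ~ zero_module M.
Variables (J : finType) (V : J -> submod M).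

Lemma nonzero_mem : exists x : M, x <> 0.
Proof. by apply: contrapT => nx; apply: Mnz => x; apply: contrapT => x0; apply: nx; exists x. Qed.

Lemma uniserial_meet : (forall x, (forall j, submod_set (V j) x) -> x = 0) ->
  exists j, forall x, submod_set (V j) x -> x = 0.
Proof.
move=> V0; apply: contrapT => nj.
suff [W [[x Wx x0] WV]] : exists W : submod M, (exists2 x, submod_set W x & x <> 0) /\
    forall j, j \in enum J -> W `<=` V j.
  by apply: x0; apply: V0 => j; apply: (WV j) Wx; rewrite mem_enum.
elim: (enum J) => [|j s [W [[x Wx x0] WV]]].
  by have [x x0] := nonzero_mem; exists (submodT M); split=> //; exists x.
have [y Vy y0] : exists2 y, submod_set (V j) y & y <> 0.
  apply: contrapT => ny; apply: nj; exists j => y Vy; apply: contrapT => y0.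
  by apply: ny; exists y.
case: (Mu W (V j)) => le.
  exists W; split; first by exists x.
  by move=> i; rewrite inE => /orP[/eqP ->|/WV].
exists (V j); split; first by exists y.
by move=> i; rewrite inE => /orP[/eqP ->|/WV h] // z /le /h.
Qed.

Lemma uniserial_join : (forall x, exists y : J -> M,
    (forall j, submod_set (V j) (y j)) /\ x = \sum_j y j) ->
  exists j, (V j : set M) = setT.
Proof.
move=> VT; apply: contrapT => nj.
suff [W [WT WV]] : exists W : submod M, (W : set M) <> setT /\
    forall j, j \in enum J -> V j `<=` W.
  apply: WT; apply/seteqP; split=> // x _; have [y [Vy ->]] := VT x.
  by apply: submod_sum => j; apply: (WV j) (Vy j); rewrite mem_enum.
elim: (enum J) => [|j s [W [WT WV]]].
  exists (submod0m M); split=> // e; apply: Mnz => x.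
  by have : (submod0m M : set M) x by rewrite e.
have nVT : (V j : set M) <> setT by move=> e; apply: nj; exists j.
case: (Mu W (V j)) => le.
  exists (V j); split=> // i; rewrite inE => /orP[/eqP -> //|/WV h] z /h; exact: le.
by exists W; split=> // i; rewrite inE => /orP[/eqP ->|/WV].
Qed.

End UniserialFamilies.

Section NakayamaChain.
Variables (S : pzRingType) (I : finType) (X : I -> lmodType S).
Hypothesis hS : finite_length (S^o : lmodType S).
Hypothesis Xfg : forall i, finitely_generated (X i).
Hypothesis Xind : forall i, indecomposable (X i).
Hypothesis Xinj : forall i j, isomorphic (X i) (X j) -> i = j.
Hypothesis Xall : forall N : lmodType S, finitely_generated N -> indecomposable N ->
  exists i, isomorphic N (X i).
Hypothesis Xuni : forall i, uniserial (X i).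
Implicit Types N L : lmodType S.
Local Notation M := (dsum X).
Local Notation B := (Endo (dsum X)).

Let Xfl i : finite_length (X i). Proof. exact: fg_finite_length. Qed.
Let Xnz i : ~ zero_module (X i). Proof. by case: (Xind i). Qed.
Let Mfg : finitely_generated M. Proof. exact: fg_dsum. Qed.
Let Madd N : finitely_generated N -> in_add M N. Proof. exact: dsum_in_add. Qed.

(** The strict inequality allows modules of equal length to be removed one at a time. *)
Definition down (E : {set I}) := forall k l, k \in E -> (len (X l) < len (X k))%N -> l \in E.

Definition add_class (E : {set I}) (N : lmodType S) := finitely_generated N /\
  forall k (p : {linear X k -> N}) (q : {linear N -> X k}), cancel p q -> k \in E.

Section DownSet.
Variable E : {set I}.
Hypothesis dE : down E.

Lemma down_inj k l (f : {linear X k -> X l}) : injective f -> l \in E -> k \in E.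
Proof.
move=> fI lE; have := len_inj fI (Xfl l); rewrite leq_eqVlt => /orP[/eqP e|]; last exact: dE.
suff -> : k = l by [].
apply: Xinj; exists f; apply: inj_surj_bij => //.
by apply: len_inj_eq => //; rewrite e.
Qed.

Lemma down_surj k l (f : {linear X l -> X k}) : surj f -> l \in E -> k \in E.
Proof.
move=> fS lE; have := len_surj fS (Xfl l); rewrite leq_eqVlt => /orP[/eqP e|]; last exact: dE.
suff -> : k = l by [].
apply/esym/Xinj; exists f; apply: inj_surj_bij => //.
by apply: len_surj_eq => //; rewrite e.
Qed.

(** The kernels of the coordinates of [f] meet in 0, so by uniseriality one of them is 0 and [X k]
    embeds in a single summand of [N]; then [down] applies. *)
Lemma add_class_sub k N (f : {linear X k -> N}) : injective f -> add_class E N -> k \in E.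
Proof.
move=> fI [fgN NE].
have [J [l [p [q [pK pq]]]]] := decomposition_exists hS Xall fgN.
have [|a h] := uniserial_meet (@Xuni k) (@Xnz k) (V := fun a => submod_ker (Hom_comp (q a) f)).
  move=> x x0; apply: fI; rewrite linear0 (pq (f x)) big1 // => a _.
  by rewrite [q a (f x)](x0 a) linear0.
apply: (down_inj (f := Hom_comp (q a) f)); first by apply: hom_inj0.
exact: NE (pK a).
Qed.

Lemma add_class_quot k N (f : {linear N -> X k}) : surj f -> add_class E N -> k \in E.
Proof.
move=> fS [fgN NE].
have [J [l [p [q [pK pq]]]]] := decomposition_exists hS Xall fgN.
have [|a h] := uniserial_join (@Xuni k) (@Xnz k) (V := fun a => submod_range (Hom_comp f (p a))).
  move=> y; have [x <-] := fS y; exists (fun a => f (p a (q a x))); split.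
    by move=> a; exists (q a x).
  by rewrite {1}(pq x) linear_sum.
apply: (down_surj (f := Hom_comp f (p a))).
  move=> y; have : (submod_range (Hom_comp f (p a)) : set (X k)) y by rewrite h.
  by case=> x _ <-; exists x.
exact: NE (pK a).
Qed.

Lemma add_class_closed : closed_class (add_class E).
Proof.
split=> [N Nz|U N f fI NE|N Q f fS NE|N L NE LE].
- split; first by exists 0%N, (fun=> 0) => x; exists (fun=> 0); rewrite big_ord0; apply: Nz.
  by move=> k p q pK; case: (@Xnz k) => x; rewrite -[x]pK (Nz (p x)) linear0.
- split=> [|k p q pK]; first by case: NE => fgN _; apply: fg_inj fI fgN.
  exact: (add_class_sub (f := Hom_comp f p) (inj_comp fI (can_inj pK)) NE).
- split=> [|k p q pK]; first by case: NE => fgN _; apply: fg_surj fS fgN.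
  apply: (add_class_quot (f := Hom_comp q f) _ NE) => y.
  by have [x xE] := fS (p y); exists x; rewrite /= xE pK.
- split=> [|k p q pK]; first by case: NE => ? _; case: LE => ? _; apply: fg_pair.
  pose p1 : Hom (X k) N := Hom_comp (fst : {linear (N * L)%type -> N}) p.
  pose p2 : Hom (X k) L := Hom_comp (snd : {linear (N * L)%type -> L}) p.
  have [|[] h] := uniserial_meet (@Xuni k) (@Xnz k)
    (V := fun b : bool => if b then submod_ker p1 else submod_ker p2).
  + move=> x x0; apply: (can_inj pK); rewrite linear0 [LHS]surjective_pairing.
    by congr pair; [exact: (x0 true)|exact: (x0 false)].
  + by apply: (add_class_sub (f := p1)) NE; apply: hom_inj0.
  + by apply: (add_class_sub (f := p2)) LE; apply: hom_inj0.
Qed.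

Lemma add_class_X k : k \in E -> add_class E (X k).
Proof.
move=> kE; split=> // l p q pK; suff -> : l = k by [].
apply: Xinj; exists p; exists q => //.
exact: indecomposable_split (Xind k) (@Xnz l) pK.
Qed.

Definition add_ideal : ideal B := class_ideal M add_class_closed.

Lemma add_idealP (f : B) : subgroup_set add_ideal f <->
  add_class E (submod_type (submod_range (f : Hom M M))).
Proof. by []. Qed.

Lemma add_class_decomposition N : add_class E N -> exists (J : finType) (k : J -> I)
    (p : forall a, {linear X (k a) -> N}) (q : forall a, {linear N -> X (k a)}),
  (forall a, k a \in E) /\ forall x, x = \sum_a p a (q a x).
Proof.
move=> [fgN NE]; have [J [k [p [q [pK pq]]]]] := decomposition_exists hS Xall fgN.
by exists J, k, p, q; split=> // a; apply: NE (pK a).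
Qed.

End DownSet.

Section RemoveMaximal.
Variables (E : {set I}) (k : I).
Hypothesis dE : down E.
Hypothesis dE' : down (E :\ k).
Hypothesis kE : k \in E.
Local Notation H := (add_ideal dE).
Local Notation H' := (add_ideal dE').

Lemma add_ideal_sub : H' `<=` H.
Proof.
move=> f /add_idealP[fg h]; apply/add_idealP; split=> // l p q /h.
by rewrite in_setD1 => /andP[].
Qed.

Lemma add_ideal_proper : H' `<` H.
Proof.
split; first exact: add_ideal_sub.
(* The projection onto the removed summand separates the two ideals: its image contains a copy of
   [X k]. *)
pose f : B := Hom_comp (dsum_inj X k) (dsum_proj X k).
move=> /(_ f) h.
have /h/add_idealP fE' : subgroup_set H f.
  apply: (class_factor (add_class_closed dE) (f := f) (a := dsum_proj X k) (b := dsum_inj X k)) => //.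
  exact: add_class_X.
have fR x : submod_set (submod_range (f : Hom M M)) (dsum_inj X k x).
  exists (dsum_inj X k x) => //; congr (dsum_inj X k _); exact: dsum_injK.
have : k \in E :\ k.
  apply: (add_class_sub dE' (f := corestr fR)) fE'.
  by move=> x y /(congr1 (incl _)); rewrite !corestrE => /(can_inj (@dsum_injK _ _ X k)).
by rewrite setD11.
Qed.

(** Modulo [H'] the idempotent [s] is radical, so [1 - s] has a right inverse [c] and
    [s = s * (1 - s) * c = 0]. *)
Lemma class_jacobson_idem (r w : B) : jacobson (rquot H') (rproj H' r) ->
  (r * w) * (r * w) = r * w -> subgroup_set H' (r * w).
Proof.
move=> Jr idem; set s := r * w.
have Js : jacobson (rquot H') (rproj H' s).
  move=> m /Jr mr; rewrite [rproj H' s]rprojM.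
  exact: (@submodZ _ _ m (rproj H' w : (rquot H')^c) _ mr).
have [c cE] := jacobson_right_inv Js.
have ss : rproj H' s * rproj H' s = rproj H' s.
  by rewrite -[RHS](congr1 (rproj H') idem); apply/esym/rprojM.
have : rproj H' s = 0 by rewrite -[LHS]mulr1 -cE mulrA mulrBr mulr1 ss subrr mul0r.
by rewrite -(zproj0 H') => /(zprojP H'); rewrite subr0.
Qed.

(** The map factors through a module of the smaller class unless both ends are the removed [X k]. It
    is then an endomorphism of [X k], and the radical condition prevents it from being
    surjective. *)
Lemma add_layer_component i j (w : {linear X i -> M}) (z : {linear M -> X j}) (r : B) :
  i \in E -> j \in E -> jacobson (rquot H') (rproj H' r) ->
  add_class (E :\ k) (submod_type (submod_range (Hom_comp z (Hom_comp (r : Hom M M) w)))).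
Proof.
move=> iE jE Jr; have cE' := add_class_closed dE'.
have [iE'|] := boolP (i \in E :\ k); first by apply: closed_range => //; apply: add_class_X.
have [jE'|] := boolP (j \in E :\ k); first by move=> _; apply: closed_sub => //; apply: add_class_X.
rewrite !in_setD1 iE jE !andbT !negbK => /eqP jk /eqP ik; subst i j.
set al := Hom_comp z _.
have [alS|nalS] := pselect (surj al).
  have alI : injective al by apply: len_surj_eq alS _ _.
  have [be [alK beK]] := hom_inv alI alS.
  (* As [al] is [z r w] and [be] inverts it, [r * wv] is idempotent. It fixes the image of [r w], a
     copy of [X k], which cannot occur in the smaller class. *)
  pose wv : B := Hom_comp w (Hom_comp be z).
  have Hs : subgroup_set H' (r * wv).
    apply: class_jacobson_idem => //; apply: Hom_ext => x.
    by rewrite -[LHS]/(r (w (be (al (be (z x)))))) beK.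
  have sR x : submod_set (submod_range (r * wv : Hom M M)) (Hom_comp (r : Hom M M) w x).
    exists (r (w x)) => //.
    by rewrite -[LHS]/(r (w (be (al x)))) alK.
  have : k \in E :\ k.
    apply: (add_class_sub dE' (f := corestr sR)) Hs.
    by move=> x y /(congr1 (incl _)); rewrite !corestrE => /(congr1 z) /alI.
  by rewrite setD11.
(* The image of [al] is a proper submodule of [X k], so its summands are strictly shorter than
   [X k]: they belong to [E] and differ from [X k]. *)
split=> [|l p q pK]; first by apply: fg_submod.
pose f : Hom (X l) (X k) := Hom_comp (incl _) p.
have fI : injective f by apply: (inj_comp (@incl_inj _ _ _) (can_inj pK)).
have lt : (len (X l) < len (X k))%N.
  rewrite ltnNge; apply/negP => le; apply: nalS => y.
  have [x <-] := len_inj_eq fI (Xfl k) le y.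
  by have [t _ tE] := inclP (p x); exists t.
rewrite in_setD1 (dE kE lt) andbT; apply/eqP => e.
by move: lt; rewrite e ltnn.
Qed.

(** Decomposing the images of [u] and [v] into indecomposables writes [u * r * v] as a sum of maps,
    each passing through one component treated in [add_layer_component]. *)
Lemma add_layer (u v r : B) : subgroup_set H u -> subgroup_set H v ->
  jacobson (rquot H') (rproj H' r) -> subgroup_set H' (u * r * v).
Proof.
move=> /add_idealP/add_class_decomposition[J [k1 [p [q [k1E pq]]]]].
move=> /add_idealP/add_class_decomposition[J2 [k2 [p2 [q2 [k2E pq2]]]]] Jr.
have uR x : submod_set (submod_range (u : Hom M M)) ((u : Hom M M) x) by exists x.
have vR x : submod_set (submod_range (v : Hom M M)) ((v : Hom M M) x) by exists x.
pose t a b : B := Hom_comp (Hom_comp (incl _) (p a)) (Hom_comp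
  (Hom_comp (Hom_comp (q a) (corestr uR)) (Hom_comp (r : Hom M M) (Hom_comp (incl _) (p2 b))))
  (Hom_comp (q2 b) (corestr vR))).
have -> : u * r * v = \sum_a \sum_b t a b.
  apply: Hom_ext => x; rewrite [RHS](hmod_sumE (N := M)) -[LHS]/(u (r (v x))).
  rewrite -[LHS](corestrE uR) [in LHS](pq (corestr uR _)) linear_sum.
  apply: eq_bigr => a _; rewrite [RHS](hmod_sumE (N := M)).
  rewrite -[in LHS](corestrE vR) [in LHS](pq2 (corestr vR x)).
  by rewrite !linear_sum.
apply: ideal_sum => a; apply: ideal_sum => b; apply/add_idealP.
have := add_layer_component (Hom_comp (incl _) (p2 b)) (Hom_comp (q a) (corestr uR)) (k2E b) (k1E a) Jr.
set g := Hom_comp (Hom_comp (q a) _) _ => Cg.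
have gR x : submod_set (submod_range g) (Hom_comp g (Hom_comp (q2 b) (corestr vR)) x).
  by exists (q2 b (corestr vR x)).
apply: (closed_range_factor (add_class_closed dE') (a := corestr gR)
  (b := Hom_comp (Hom_comp (incl _) (p a)) (incl _))) Cg => x.
by [].
Qed.

End RemoveMaximal.

(** The empty set is left unchanged, so that iteration is defined for every number of steps. *)
Definition remove_longest (E : {set I}) : {set I} :=
  if [pick k in E | [forall l in E, (len (X l) <= len (X k))%N]] is Some k
  then E :\ k else E.

Lemma remove_longestP (E : {set I}) : E != finset.set0 -> exists2 k, k \in E &
  remove_longest E = E :\ k /\ forall l, l \in E -> (len (X l) <= len (X k))%N.
Proof.
move=> /set0Pn[k0 k0E]; rewrite /remove_longest; case: pickP => [k /andP[kE kmax]|none].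
  by exists k => //; split=> // l lE; apply: (implyP (forallP kmax l)).
have [k kE kmax] := @arg_maxnP I k0 (mem E) (fun k => len (X k)) k0E.
have /negP[] := negbT (none k); apply/andP; split=> //.
by apply/forallP => l; apply/implyP; apply: kmax.
Qed.

Lemma remove_longest_down E : down E -> down (remove_longest E).
Proof.
move=> dE; have [->|/remove_longestP[k kE [-> kmax]]] := eqVneq E finset.set0.
  rewrite /remove_longest; case: pickP => [k|_]; first by rewrite inE.
  by move=> k l; rewrite inE.
move=> a l; rewrite !in_setD1 => /andP[ak aE] lt.
rewrite (dE _ _ aE lt) andbT; apply/eqP => lk; move: lt.
by rewrite lk ltnNge kmax.
Qed.

Definition level j := iter j remove_longest (finset.setTfor I).

Lemma level_down j : down (level j).
Proof. by elim: j => [|j IHj]; [move=> k l _ _; rewrite inE|exact: remove_longest_down]. Qed.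

Lemma card_level j : (j <= #|I|)%N -> #|level j| = (#|I| - j)%N.
Proof.
elim: j => [|j IHj] lt; first by rewrite cardsT subn0.
have cj := IHj (ltnW lt).
have [|k kE [e _]] := @remove_longestP (level j); first by rewrite -card_gt0 cj subn_gt0.
move: cj; rewrite [level j.+1]e (cardsD1 k) kE add1n subnS => <-.
by [].
Qed.

Definition level_ideal j := add_ideal (@level_down j).

Lemma level_idealS j : (j < #|I|)%N -> exists2 k, k \in level j & level j.+1 = level j :\ k.
Proof.
move=> lt; have [|k kE [e _]] := @remove_longestP (level j); last by exists k.
by rewrite -card_gt0 card_level ?subn_gt0 // ltnW.
Qed.

Lemma level_step j : (j < #|I|)%N -> level_ideal j.+1 `<` level_ideal j /\
  forall u v r, subgroup_set (level_ideal j) u -> subgroup_set (level_ideal j) v ->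
    jacobson (rquot (level_ideal j.+1)) (rproj (level_ideal j.+1) r) ->
    subgroup_set (level_ideal j.+1) (u * r * v).
Proof.
move=> lt; have [k kE e] := level_idealS lt; rewrite /level_ideal.
move: (@level_down j.+1); rewrite e => dE'; split; first exact: add_ideal_proper.
by move=> u v r; apply: add_layer.
Qed.

Lemma uniserial_strongly_quasi_hereditary : strongly_quasi_hereditary B.
Proof.
have idem j : idempotent_ideal (level_ideal j) by apply: class_ideal_idempotent.
have rdb j : right_dual_basis (level_ideal j) by apply: class_ideal_right_dual_basis.
have ldb j : left_dual_basis (level_ideal j) by apply: class_left_dual_basis.
have chain : idempotent_chain #|I| level_ideal.
  split=> [||j /level_step[]|j _] //.
    apply/seteqP; split=> // f _; split=> [|k p q _]; first exact: fg_submod.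
    by rewrite inE.
  apply/seteqP; split=> [f /add_class_decomposition[J [k [p [q [kE pq]]]]]|_ ->].
    apply: Hom_ext => x.
    have fR y : submod_set (submod_range (f : Hom M M)) ((f : Hom M M) y) by exists y.
    rewrite -[LHS](corestrE fR) (pq (corestr fR x)) big1 ?linear0 // => a _.
    have : (0 < #|level #|I| |)%N by apply/card_gt0P; exists (k a).
    by rewrite card_level // subnn.
  exact: subgroup0.
have lay j : (j < #|I|)%N -> semisimple_layer level_ideal j.
  move=> /level_step[_ lay]; apply/seteqP; split=> [_ [n [x [y [Hx Hy ->]]]]|_ ->]; last first.
    by exists 0%N, (fun=> 0), (fun=> 0); split=> [[]|[]|]; rewrite ?big_ord0.
  rewrite /= big1 // => i _; have [m [a [b [Ha Jb ->]]]] := Hx i.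
  have [v Hv <-] := Hy i; rewrite mulr_suml big1 // => l _.
  have [u Hu <-] := Ha l; have := Jb l.
  have [r <-] : exists r, rproj (level_ideal j.+1) r = b l by exists (zrepr (b l)); apply: zreprK.
  move=> Jr; have h := lay _ _ _ Hu Hv Jr.
  rewrite -(zproj0 (level_ideal j.+1)) -[LHS](_ : rproj _ (u * r * v) = _).
    by apply/(zprojP (level_ideal j.+1)); rewrite subr0.
  by rewrite rprojM; congr (rmul _ _); apply: rprojM.
exists #|I|, level_ideal; split.
- split=> // j lt; have [prop _] := level_step lt.
  split; last exact: lay.
    apply/seteqP; split=> [_ [n [x [y [Hx _ ->]]]]|_ [f Hf <-]].
      by apply: ideal_sum => i; apply: idealMr.
    have [n [u [v [Hu Hv ->]]]] := idempotent_idealP (idem j) Hf.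
    exists n, (fun i => rproj (level_ideal j.+1) (u i)), (fun i => rproj (level_ideal j.+1) (v i)).
    split=> [i|i|]; [by exists (u i)|by exists (v i)|].
    rewrite [LHS](big_morph _ (zprojD (level_ideal j.+1)) (zproj0 (level_ideal j.+1))).
    by apply: eq_bigr => i _; apply: rprojM.
  (* A heredity chain asks for projectivity of each layer over the quotient ring, so the dual basis
     has to descend. *)
  apply: right_dual_basis_projective; apply: right_dual_basis_quot => //.
  exact: properW.
- split=> // j lt; split; last exact: lay.
  exact: right_dual_basis_projective.
- split=> // j lt; split; last exact: lay.
  exact: left_dual_basis_projective.
Qed.

End NakayamaChain.

Theorem theorem4p6 (A : pzRingType) (hA : artin_algebra A)
    (hfin : representation_finite A)
    (I : finType) (X : I -> rmodType A) (hX : indec_representatives X)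
    (B := auslander_algebra X) :
  (strongly_quasi_hereditary B <-> has_rejective_chain (proj B)) /\
  (has_rejective_chain (proj B) <-> nakayama A).
Proof.
have hS := artin_algebra_finite_length hA.
have [Xrep Xinj Xcov] := hX.
have Xfg i : finitely_generated (X i) by case: (Xrep i).
have Xind i : indecomposable (X i) by case: (Xrep i).
have Xall (N : rmodType A) : finitely_generated N -> indecomposable N ->
    exists i, isomorphic N (X i) by move=> fgN Ni; apply: Xcov.
have i_ii : strongly_quasi_hereditary B -> has_rejective_chain (proj B).
  apply: strongly_quasi_hereditary_rejective_chain => H.
  exact: endo_ideal_fg hA (fg_dsum hS Xfg).
have ii_iii : has_rejective_chain (proj B) -> nakayama A.
  by move=> ch N [fgN Ni]; apply: (rejective_chain_uniserial hS Xfg Xind Xall ch).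
have iii_i : nakayama A -> strongly_quasi_hereditary B.
  move=> nak; apply: (uniserial_strongly_quasi_hereditary hS Xfg Xind Xinj Xall).
  by move=> i; apply: nak.
by split; split=> // h; [exact: iii_i (ii_iii h)|exact: i_ii (iii_i h)].
Qed.
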